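(* Let $T\ge2$, $\mathcal{T}=\{1,\dots,T\}$, and consider the general model described in the context. For each $i\in\mathcal{T}$ with $i\ge2$ there exists $\gamma_i\in(0,\infty)$ such that, as $\alpha\to\infty$, $$C^{\alpha}_{i,T-i+1}\bigg(\prod_{s=T-i+1}^{T-1}f_s-\prod_{s=T-i+1}^{T-1}\widehat{f}_s\bigg)^2\xrightarrow{d}\gamma_i^2\chi^2_1,$$ where $\chi^2_1$ has a chi-squared distribution with one degree of freedom. Moreover, if $Z$ and $D$ are independent, then $$\gamma_i^2=\lambda_i\operatorname{E}[ZI\{D\le T-i+1\}]\prod_{s=T-i+1}^{T-1}f_s^2\sum_{t=T-i+1}^{T-1}\frac{\sigma^2_t/f_t^2}{\sum_{j=1}^{T-t}\lambda_j\operatorname{E}[ZI\{D\le t\}]}.$$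
   Context: General model. Fix an integer $T\ge2$ and $\mathcal{T}=\{1,\dots,T\}$. For each $i\in\mathcal{T}$ there is a family of nonnegative integer-valued random variables $(M^{\alpha}_i)_{\alpha\ge0}$ and a sequence of random pairs $(D_{i,k},Z_{i,k})_{k\ge1}$ with $D_{i,k}\in\mathcal{T}$ and $Z_{i,k}$ real. Define $C^{\alpha}_{i,t}=\sum_{k=1}^{M^{\alpha}_i}Z_{i,k}I\{D_{i,k}\le t\}$ for $i,t\in\mathcal{T}$. Assumptions: (GM1) for each $i$, $(D_{i,k},Z_{i,k})_{k\ge1}$ is i.i.d. with a common distribution not depending on $i$; for a generic pair $(D,Z)$ with this distribution, $\operatorname{E}[Z^2]<\infty$ and $\operatorname{E}[ZI\{D=t\}]>0$ for all $t\in\mathcal{T}$. (GM2) For each $i$, $(D_{i,k},Z_{i,k})_{k\ge1}$ is independent of $(M^{\alpha}_i)_{\alpha\ge0}$. (GM3) The families $\{(M^{\alpha}_i)_\alpha,(D_{i,k},Z_{i,k})_{k\ge1}\}$, $i=1,\dots,T$, are independent. (GM4) For each $i$ there is $\lambda_i\in(0,\infty)$ with $M^{\alpha}_i/\alpha\to\lambda_i$ a.s. as $\alpha\to\infty$. Notation: for $t\le T-1$, $\widehat{f}_t=\sum_{i=1}^{T-t}C^{\alpha}_{i,t+1}/\sum_{i=1}^{T-t}C^{\alpha}_{i,t}$ and $f_t=\operatorname{E}[ZI\{D\le t+1\}]/\operatorname{E}[ZI\{D\le t\}]$; and $$\sigma^2_t=(f_t-1)\bigg(\frac{\operatorname{E}[Z^2I\{D=t+1\}]}{\operatorname{E}[ZI\{D=t+1\}]}+(f_t-1)\frac{\operatorname{E}[Z^2I\{D\le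 t\}]}{\operatorname{E}[ZI\{D\le t\}]}\bigg).$$ *)

(* Defs.v *)
From HB Require Import structures.
From mathcomp Require Import all_boot all_order all_algebra.
From mathcomp Require Import all_classical all_reals all_analysis.
Set Implicit Arguments. Unset Strict Implicit. Unset Printing Implicit Defensive.
Import Order.TTheory GRing.Theory Num.Theory.
Import numFieldNormedType.Exports.
Local Open Scope classical_set_scope.
Local Open Scope ring_scope.

Section defs.
Context {R : realType} {d : measure_display} {Omega : measurableType d}.
Variable (P : probability Omega R).

Definition gen_sigma (G : set (set Omega)) : set (set Omega) := <<s G >>.

Definition events_nat (X : Omega -> nat) : set (set Omega) :=
  [set X @^-1` A | A in [set: set nat]].

Definition events_real (X : Omega -> R) : set (set Omega) :=
  [set X @^-1` B | B in [set B : set R | measurable B]].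

Definition mutually_independent (I : eqType) (G : I -> set (set Omega)) :=
  forall (J : seq I) (A : I -> set Omega), uniq J ->
    (forall i, i \in J -> gen_sigma (G i) (A i)) ->
    (P (\bigcap_(i in [set i | i \in J]) A i) = \prod_(i <- J) P (A i))%E.

Definition Expe (X : Omega -> R) : R := fine (\int[P]_w (X w)%:E)%E.

Definition cvg_in_distribution (Y : R -> Omega -> R) (F : R -> R) :=
  forall x : R, {for x, continuous F} ->
    (P [set w | Y a w <= x]) @[a --> +oo] --> (F x)%:E.

End defs.

Definition scaled_chi2_1_cdf {R : realType} (c : R) (x : R) : R :=
  fine (normal_prob 0 1 [set u : R | c * u ^+ 2 <= x]).

Section model.
Context {R : realType} {d : measure_display} {Omega : measurableType d}.
Variables (P : probability Omega R)
  (M : nat -> R -> Omega -> nat) (D : nat -> nat -> Omega -> nat)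
  (Z : nat -> nat -> Omega -> R).

Definition Cit (i t : nat) (a : R) (w : Omega) : R :=
  \sum_(1 <= k < (M i a w).+1) Z i k w * ((D i k w <= t)%N)%:R.

Definition fhat (T t : nat) (a : R) (w : Omega) : R :=
  (\sum_(1 <= i < (T - t).+1) Cit i t.+1 a w) /
  (\sum_(1 <= i < (T - t).+1) Cit i t a w).

(** generic pair (D, Z): (D_{1,1}, Z_{1,1}) (all pairs share its law) *)
Definition gD := D 1 1.
Definition gZ := Z 1 1.

Definition EZle (t : nat) : R := Expe P (fun w => gZ w * ((gD w <= t)%N)%:R).
Definition EZeq (t : nat) : R := Expe P (fun w => gZ w * ((gD w == t)%N)%:R).
Definition EZ2eq (t : nat) : R :=
  Expe P (fun w => gZ w ^+ 2 * ((gD w == t)%N)%:R).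
Definition EZ2le (t : nat) : R :=
  Expe P (fun w => gZ w ^+ 2 * ((gD w <= t)%N)%:R).

Definition fdev (t : nat) : R := EZle t.+1 / EZle t.

Definition sigma2 (t : nat) : R :=
  (fdev t - 1) * (EZ2eq t.+1 / EZeq t.+1 + (fdev t - 1) * (EZ2le t / EZle t)).

End model.

(* Main.v *)
(* Let a_n -> oo and let V_t = sum_{i <= T-t} (C_{i,t+1} - f_t C_{i,t}) / sqrt a_n.
   Since (1/a_n) sum_{i <= T-t} C_{i,t} -> b_t in probability, the delta method gives
   sqrt a_n (prod fhat - prod f) = (prod f) sum_t V_t / (f_t b_t) + o_P(1).  The V_t are
   sums of M_i centred claims, and Chebyshev's inequality conditionally on M_i allows one
   to replace M_i by the deterministic index floor(lambda_i a_n).  The linear combination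
   then splits into T independent normalised sums of i.i.d. centred variables; Lindeberg's
   replacement method, run uniformly over translates of smooth test functions so that
   independent limits add up, shows that it is asymptotically N(0, s).  Squaring and
   multiplying by C_{i,T-i+1} / a_n, which converges in probability to a constant c, gives
   c s chi^2_1.  When Z and D are independent the variables
   Z (1{D <= t+1} - f_t 1{D <= t}), t < T, are uncorrelated and s becomes explicit. *)
Require Import Defs.
From HB Require Import structures.
From mathcomp Require Import all_boot all_order all_algebra.
From mathcomp Require Import all_classical all_reals all_analysis.
From mathcomp Require Import measurable_realfun ring lra.
Import Order.TTheory GRing.Theory Num.Theory.
Import numFieldNormedType.Exports.
Local Open Scope classical_set_scope.
Local Open Scope ring_scope.

Set Implicit Arguments. Unset Strict Implicit. Unset Printing Implicit Defensive.

(** The V_t share rows, so they are dependent and their limits cannot be combined directly.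
    Exchanging the sums over t and over rows collects the total weight [eta t0 j] of row j + 1,
    which leaves one sum of i.i.d. centred variables per row, independent across rows. No moment of
    the row lengths M_i is assumed, so a sum of M_i claims need not have a variance. Hence the
    replacement of M_i is carried out in probability, on the event that M_i is close to its
    deterministic index, before any limit law is taken. The class of test functions must be stable
    under averaging against an arbitrary law, with one constant K throughout: each replacement step
    turns the test function into its average, and the number of steps grows with n. Claims may be
    negative, so a denominator of [fhat] may vanish with positive probability; there the quotient is
    0 by convention and a correction term is carried along. The parameter alpha is real, whereas
    dominated convergence and the o_P calculus are run along sequences, so the limit is proved along
    every positive sequence that tends to infinity. *)

Section integration.
Context d (T : measurableType d) (R : realType).
Implicit Types (P : probability T R) (f g : T -> R) (e K : R).

Lemma bounded_integrable P f K : measurable_fun setT f ->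
  (forall x, `|f x| <= K) -> P.-integrable setT (EFin \o f).
Proof.
move=> mf fK; apply: measurable_bounded_integrable => //.
  by rewrite ltey_eq fin_num_measure.
exists K; split; first exact: num_real.
by move=> x Kx y _ /=; exact: le_trans (fK y) (ltW Kx).
Qed.

Lemma integrable_le P f g : measurable_fun setT f ->
  (forall x, `|f x| <= g x) -> P.-integrable setT (EFin \o g) ->
  P.-integrable setT (EFin \o f).
Proof.
move=> mf fg ig; apply: le_integrable ig => //.
  exact/measurable_EFinP.
by move=> x _ /=; rewrite lee_fin (le_trans (fg x))// ler_norm.
Qed.

Lemma Rint_cst P (c : R) : \int[P]_x c = c.
Proof.
transitivity (c * fine (P setT)); first exact: Rintegral_cst.
by rewrite probability_setT mulr1.
Qed.

Lemma ge0_le_Rint P f g : measurable_fun setT f ->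
  (forall x, 0 <= f x <= g x) -> P.-integrable setT (EFin \o g) ->
  \int[P]_x f x <= \int[P]_x g x.
Proof.
move=> mf fg ig; apply: le_Rintegral => //.
  by apply: integrable_le ig => // x; case/andP: (fg x) => f0 ?; rewrite ger0_norm.
by move=> x _; case/andP: (fg x).
Qed.

Lemma Rint_le_cst P f K : measurable_fun setT f ->
  (forall x, `|f x| <= K) -> `|\int[P]_x f x| <= K.
Proof.
move=> mf fK; have intf := bounded_integrable P mf fK.
apply: (le_trans (le_normr_Rintegral _ intf)) => //.
rewrite -[leRHS](Rint_cst P); apply: le_Rintegral => //.
- exact: integrable_norm.
- exact: finite_measure_integrable_cst.
Qed.

Lemma RintE P f : P.-integrable setT (EFin \o f) ->
  (\int[P]_x (f x)%:E)%E = (\int[P]_x f x)%:E.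
Proof. by move=> fi; rewrite /Rintegral fineK//; exact: integrable_fin_num. Qed.

Lemma markovR P f e : measurable_fun setT f -> P.-integrable setT (EFin \o f) ->
  (forall x, 0 <= f x) -> 0 < e ->
  (P [set x | (e <= f x)%R] <= ((\int[P]_x f x) / e)%:E)%E.
Proof.
move=> mf fi f0 e0.
have mA : measurable [set x | e <= f x].
  by rewrite -[X in measurable X]setTI; exact: measurable_fun_le.
have : (e%:E * P [set x | (e <= f x)%R] <= \int[P]_x (f x)%:E)%E.
  rewrite -[X in P X]setIT -integral_indic// -ge0_integralZl//=; last first.
  - by rewrite lee_fin ltW.
  - by apply/measurable_EFinP; exact: measurable_indic.
  apply: ge0_le_integral => //.
  - by move=> x _; rewrite lee_fin mulr_ge0// ltW.
  - by apply/measurable_EFinP; exact: measurable_funM.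
  - exact/measurable_EFinP.
  move=> x _; rewrite lee_fin indicE; case: (boolP (x \in _)) => xA.
    by move: xA; rewrite inE/= mulr1.
  by rewrite mulr0.
rewrite RintE// => h; rewrite EFinM lee_pdivlMr// muleC.
exact: h.
Qed.

End integration.

(** * Independence and laws *)

Section laws.
Context d (T : measurableType d) (R : realType) (P : probability T R).

(** Both sides are finite measures in A: the restriction of P to E, and P scaled by the number P E.
    They agree on the pi-system G, hence on the sigma-algebra it generates. *)
Lemma pi_indep (G : set (set T)) (E : set T) :
  setI_closed G -> G setT -> G `<=` measurable -> measurable E ->
  (forall A, G A -> (P (A `&` E) = P A * P E)%E) ->
  forall A, <<s G >> A -> (P (A `&` E) = P A * P E)%E.
Proof.
move=> GI GT Gm mE GE A sA.
have PE0 : 0 <= fine (P E) by rewrite fine_ge0.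
have PEE : (fine (P E))%:E = P E by rewrite fineK// fin_num_measure.
pose m2 := mscale (NngNum PE0) P.
pose m1 := mrestr P mE.
have -> : (P (A `&` E) = m1 A)%E by [].
have -> : (P A * P E = m2 A)%E by rewrite /m2/= /mscale/= PEE muleC.
apply: (@g_sigma_algebra_measure_unique _ _ _ G Gm (fun _ => setT)) => //.
- by rewrite bigcup_const//; exists 0%N.
- by move=> B GB; rewrite /m1 /m2 /=  /mscale /mrestr/= GE// PEE muleC.
- by move=> _; rewrite /m1/= /mrestr/= setTI ltey_eq fin_num_measure.
Qed.

Definition indep2 (X Y : T -> R) := forall A B : set R, measurable A -> measurable B ->
  (P (X @^-1` A `&` Y @^-1` B) = P (X @^-1` A) * P (Y @^-1` B))%E.

Lemma joint_law (X Y : {mfun T >-> R}) : indep2 X Y ->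
  forall A, measurable A ->
  (distribution P X \x distribution P Y)%E A = P [set w | A (X w, Y w)].
Proof.
move=> XY A mA.
pose XYf w := (X w, Y w).
have mXY : measurable_fun setT XYf by apply/measurable_fun_pairP; split; exact: measurable_funP.
pose Z : {mfun T >-> (R * R)%type} := HB.pack XYf (isMeasurableFun.Build _ _ _ _ XYf mXY).
have -> : P [set w | A (X w, Y w)] = distribution P Z A by [].
by apply: product_measure_unique => // A1 B1 mA1 mB1; rewrite /= /pushforward/= -XY.
Qed.

(** Tonelli for independent variables. It asks for no integrability, so it can be used to establish
    the integrability of products. *)
Lemma indep2_law_ge0 (X Y : {mfun T >-> R}) : indep2 X Y ->
  forall f : R * R -> \bar R, measurable_fun setT f -> (forall z, 0 <= f z)%E ->
  (\int[P]_w f (X w, Y w) = \int[distribution P X]_x \int[distribution P Y]_y f (x, y))%E.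
Proof.
move=> XY f mf f0.
pose XYf w := (X w, Y w).
have mXY : measurable_fun setT XYf by apply/measurable_fun_pairP; split; exact: measurable_funP.
pose Z : {mfun T >-> (R * R)%type} := HB.pack XYf (isMeasurableFun.Build _ _ _ _ XYf mXY).
have <- := @fubini_tonelli1 _ _ _ _ _ (distribution P X) (distribution P Y) f mf f0.
transitivity (\int[distribution P Z]_z f z)%E; first by rewrite ge0_integral_distribution.
by apply: eq_measure_integral => A mA _; exact/esym/(joint_law XY).
Qed.

Lemma indep2_law (X Y : {mfun T >-> R}) (f : R * R -> R) : indep2 X Y ->
  measurable_fun setT f ->
  P.-integrable setT (EFin \o (fun w => f (X w, Y w))) ->
  (\int[P]_w (f (X w, Y w))%:E =
   \int[distribution P X]_x \int[distribution P Y]_y (f (x, y))%:E)%E.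
Proof.
move=> XY mf fi.
pose XYf w := (X w, Y w).
have mXY : measurable_fun setT XYf by apply/measurable_fun_pairP; split; exact: measurable_funP.
pose Z : {mfun T >-> (R * R)%type} := HB.pack XYf (isMeasurableFun.Build _ _ _ _ XYf mXY).
have mf' : measurable_fun setT (EFin \o f) by exact/measurable_EFinP.
have i2 : ((distribution P X \x distribution P Y)%E).-integrable setT (EFin \o f).
  apply/integrableP; split => //.
  rewrite (eq_measure_integral (distribution P Z)); last by move=> A mA _; exact/(joint_law XY).
  rewrite (ge0_integral_distribution Z)//=.
    by case/integrableP : fi.
  by apply/measurable_EFinP; exact: measurableT_comp.
transitivity (\int[distribution P Z]_z (f z)%:E)%E; first by rewrite integral_distribution.
transitivity (\int[(distribution P X \x distribution P Y)%E]_z (EFin \o f) z)%E.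
  by apply: eq_measure_integral => A mA _; exact/esym/(joint_law XY).
exact/esym/(integral12_prod_meas1 i2).
Qed.

Lemma law_integrable (V : {mfun T >-> R}) (g : R -> R) : measurable_fun setT g ->
  P.-integrable setT (EFin \o (g \o V)) ->
  (distribution P V).-integrable setT (EFin \o g).
Proof.
move=> mg iV; apply: integrable_pushforward => //.
exact/measurable_EFinP.
Qed.

Lemma law_Rint (V : {mfun T >-> R}) (g : R -> R) : measurable_fun setT g ->
  P.-integrable setT (EFin \o (g \o V)) ->
  \int[distribution P V]_x g x = \int[P]_w g (V w).
Proof.
move=> mg iV; rewrite /Rintegral integral_distribution//.
exact/measurable_EFinP.
Qed.

Lemma indep2_integrableM (X Y : {mfun T >-> R}) : indep2 X Y ->
  P.-integrable setT (EFin \o X) -> P.-integrable setT (EFin \o Y) ->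
  P.-integrable setT (EFin \o (fun w => X w * Y w)).
Proof.
move=> XY iX iY; apply/integrableP; split.
  by apply/measurable_EFinP; exact: measurable_funM.
have -> : (\int[P]_x `|(EFin \o (fun w => (X w * Y w)%R)) x| =
  \int[P]_w (fun z : R * R => (`|z.1| * `|z.2|)%:E) (X w, Y w))%E.
  by apply: eq_integral => w _ /=; rewrite normrM.
rewrite (indep2_law_ge0 XY (f := fun z => (`|z.1| * `|z.2|)%:E)); last 2 first.
- by apply/measurable_EFinP; apply: measurable_funM; apply: measurableT_comp.
- by move=> z; rewrite lee_fin mulr_ge0.
have h (V : {mfun T >-> R}) : P.-integrable setT (EFin \o V) ->
    exists2 c : R, 0 <= c & (\int[distribution P V]_x (`|x|)%:E = c%:E)%E.
  move=> iV; exists (\int[P]_w `|V w|); first exact: Rintegral_ge0.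
  rewrite (ge0_integral_distribution V)//=; last exact/measurable_EFinP.
  by rewrite RintE//; exact: integrable_norm.
have [a a0 Ea] := h X iX; have [b b0 Eb] := h Y iY.
under eq_integral => x _.
  under eq_integral do rewrite /= EFinM.
  rewrite ge0_integralZl//; last exact/measurable_EFinP.
  rewrite Eb; over.
rewrite ge0_integralZr//; last exact/measurable_EFinP.
by rewrite Ea -EFinM ltry.
Qed.

Lemma indep2_RintM (X Y : {mfun T >-> R}) : indep2 X Y ->
  P.-integrable setT (EFin \o X) -> P.-integrable setT (EFin \o Y) ->
  \int[P]_w (X w * Y w) = (\int[P]_w X w) * (\int[P]_w Y w).
Proof.
move=> XY iX iY; have iXY := indep2_integrableM XY iX iY.
have iX' := law_integrable (@measurable_id _ _ setT) iX.
have iY' := law_integrable (@measurable_id _ _ setT) iY.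
apply: EFin_inj; rewrite -RintE//.
rewrite (indep2_law (f := fun z => z.1 * z.2))//; last exact: measurable_funM.
have EX := law_Rint (@measurable_id _ _ setT) iX.
have EY := law_Rint (@measurable_id _ _ setT) iY.
under eq_integral => x _.
  under eq_integral do rewrite /= EFinM.
  rewrite integralZl// RintE// EY; over.
by rewrite integralZr// RintE// EX.
Qed.

(** The mechanism of one replacement: with X frozen, the independent summand Y acts on the test
    function as an average against its law. *)
Lemma indep2_avg (X Y : {mfun T >-> R}) (phi : R -> R) (K x0 : R) : indep2 X Y ->
  measurable_fun setT phi -> (forall x, `|phi x| <= K) ->
  \int[P]_w phi (x0 + X w + Y w) =
  \int[P]_w \int[distribution P Y]_y phi (x0 + X w + y).
Proof.
move=> XY mphi phiK.
have mf : measurable_fun setT (fun z : R * R => phi (x0 + z.1 + z.2)).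
  apply: (measurableT_comp mphi); apply: measurable_funD => //.
  exact: measurable_funD.
have intf : P.-integrable setT (EFin \o (fun w => phi (x0 + X w + Y w))).
  apply: (@bounded_integrable _ _ _ P _ K) => //.
  apply: (measurableT_comp mphi); apply: measurable_funD => //.
  exact: measurable_funD.
rewrite /Rintegral; congr fine.
rewrite (indep2_law (f := fun z => phi (x0 + z.1 + z.2)) XY mf intf) /=.
have ib x : (distribution P Y).-integrable setT (EFin \o (fun y => phi (x0 + x + y))).
  apply: (@bounded_integrable _ _ _ _ _ K) => //.
  by apply: (measurableT_comp mphi); exact: measurable_funD.
under eq_integral do rewrite RintE//.
have mF : measurable_fun setT (fun x => (\int[distribution P Y]_y phi (x0 + x + y))%:E).
  have := @measurable_fubini_F _ _ _ _ _ (distribution P X) (distribution P Y) (EFin \o (fun z : R * R => phi (x0 + z.1 + z.2))).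
  rewrite /fubini_F.
  have -> : (fun x => \int[distribution P Y]_y ((EFin \o (fun z : R * R => (phi (x0 + z.1 + z.2))%R)) (x, y)))%E = (fun x => (\int[distribution P Y]_y phi (x0 + x + y))%:E).
    by apply/funext => x; exact/RintE/ib.
  apply; apply: (@bounded_integrable _ _ _ (distribution P X \x distribution P Y)%E _ K) => //.
rewrite (integral_distribution mF)//.
apply: (@bounded_integrable _ _ _ P (fun w => \int[distribution P Y]_y phi (x0 + X w + y)) K).
  have mG : measurable_fun setT (fun x => \int[distribution P Y]_y phi (x0 + x + y)).
    exact/measurable_EFinP.
  exact: (measurableT_comp mG (measurable_funP X)).
by move=> w; apply: Rint_le_cst => //; apply: (measurableT_comp mphi); exact: measurable_funD.
Qed.

End laws.

(** * Test functions and their averages *)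

Section lipschitz.
Context (R : realType).
Implicit Types (f : R -> R) (K : R).

(** One number serves as bound and as Lipschitz constant, so that averaging preserves the class
    without any change of constant. *)
Definition lipb K f :=
  (forall x, `|f x| <= K) /\ (forall x y, `|f x - f y| <= K * `|x - y|).

Lemma lipb_continuous K f : lipb K f -> continuous f.
Proof.
move=> [fK fL] x; have K0 : 0 <= K by apply: le_trans (fK 0); exact: normr_ge0.
apply/cvgrPdist_le => e e0; near=> y.
apply: (le_trans (fL _ _)).
apply: (@le_trans _ _ ((K + 1) * `|x - y|)).
  by rewrite ler_wpM2r// lerDl.
rewrite mulrC -ler_pdivlMr ?ltr_wpDl//.
near: y; have /cvgrPdist_le := @cvg_id _ (nbhs x); apply.
by rewrite divr_gt0// ltr_wpDl.
Unshelve. all: by end_near. Qed.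

Lemma lipb_measurable K f : lipb K f -> measurable_fun setT f.
Proof. by move=> fK; apply: continuous_measurable_fun; exact: lipb_continuous fK. Qed.

Lemma shift_measurable f (x : R) : measurable_fun setT f ->
  measurable_fun setT (fun y : R => f (x + y)).
Proof. by move=> mf; apply: (measurableT_comp mf); exact: measurable_funD. Qed.

Lemma lipb_integrable (mu : probability R R) K f x : lipb K f ->
  mu.-integrable setT (EFin \o (fun y => f (x + y))).
Proof.
move=> fK; apply: (@bounded_integrable _ _ _ mu _ K).
  by apply: shift_measurable; exact: lipb_measurable fK.
by move=> y; exact: fK.1.
Qed.

Definition avg (mu : probability R R) f x := \int[mu]_y f (x + y).

Lemma avg_ge0 mu f : (forall y, 0 <= f y) -> forall x, 0 <= avg mu f x.
Proof. by move=> f0 x; apply: Rintegral_ge0. Qed.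

Lemma avg_lipb mu K f : lipb K f -> lipb K (avg mu f).
Proof.
move=> fK; have mf := lipb_measurable fK; split=> [x|x y].
  apply: Rint_le_cst; first exact: shift_measurable.
  by move=> y; exact: fK.1.
rewrite /avg -RintegralB//; try exact: lipb_integrable fK.
apply: Rint_le_cst.
  by apply: measurable_funB; exact: shift_measurable.
move=> z; apply: (le_trans (fK.2 _ _)).
by rewrite opprD addrACA subrr addr0.
Qed.

(* [|r(y)| <= K min(y^2, |y|^3)] is the Taylor remainder bound for a function with
   bounded second and third derivatives; unlike differentiability it passes
   trivially through averaging *)
Record taylor K f f1 f2 : Prop := Taylor {
  taylor_ge0 : forall x, 0 <= f x;
  taylor_lipb0 : lipb K f;
  taylor_lipb1 : lipb K f1;
  taylor_lipb2 : lipb K f2;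
  taylor_rem : forall x y, `|f (x + y) - f x - y * f1 x - y ^+ 2 / 2 * f2 x|
     <= K * Num.min (y ^+ 2) (`|y| ^+ 3) }.

Lemma avg_taylor (mu : probability R R) K f f1 f2 : taylor K f f1 f2 ->
  taylor K (avg mu f) (avg mu f1) (avg mu f2).
Proof.
move=> [f0 l0 l1 l2 fr]; split; try exact: avg_lipb.
  by move=> x; apply: Rintegral_ge0.
move=> x y.
have i0 z := lipb_integrable mu z l0.
have i1 z := lipb_integrable mu z l1.
have i2 z := lipb_integrable mu z l2.
have iZ c g : mu.-integrable setT (EFin \o g) -> mu.-integrable setT (EFin \o (fun w => c * g w)).
  by move=> ig; have := integrableZl measurableT c ig; apply: eq_integrable.
have iB g h : mu.-integrable setT (EFin \o g) -> mu.-integrable setT (EFin \o h) ->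
    mu.-integrable setT (EFin \o (fun w => g w - h w)).
  by move=> ig ih; have := integrableB measurableT ig ih; apply: eq_integrable.
rewrite /avg -!RintegralZl// -!RintegralB//; try by [do ?(apply: iB || apply: iZ)].
apply: Rint_le_cst.
  apply: measurable_funB; last first.
    by apply: measurable_funM => //; apply: shift_measurable; exact: lipb_measurable l2.
  apply: measurable_funB; last first.
    by apply: measurable_funM => //; apply: shift_measurable; exact: lipb_measurable l1.
  by apply: measurable_funB; apply: shift_measurable; exact: lipb_measurable l0.
  by move=> z; have := fr (x + z) y; rewrite (addrAC x z y).
by apply: (iB _ _ (iB _ _ (i0 _) (i0 _)) (iZ _ _ (i1 _))).
Qed.

End lipschitz.

(** * Averages against Gaussian laws *)

Section gaussian.
Import HBNNSimple.
Context (R : realType).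
Notation leb := (@lebesgue_measure R).
Local Open Scope ereal_scope.

(** On indicators this is the definition of [normal_prob]; linearity extends it to simple functions
    and monotone convergence to nonnegative functions. *)
Lemma integral_normal_prob (m s : R) (f : R -> \bar R) : measurable_fun setT f ->
  (forall x, 0 <= f x) ->
  \int[normal_prob m s]_x f x = \int[leb]_x (f x * (normal_pdf m s x)%:E).
Proof.
move=> mf f0.
have pdf0 x : 0 <= (normal_pdf m s x)%:E by rewrite lee_fin normal_pdf_ge0.
have mpdf : measurable_fun setT (fun x => (normal_pdf m s x)%:E).
  by apply/measurable_EFinP; exact: measurable_normal_pdf.
have indE A : measurable A -> \int[normal_prob m s]_x (\1_A x)%:E =
    \int[leb]_x ((\1_A x)%:E * (normal_pdf m s x)%:E).
  move=> mA; rewrite integral_indic// setIT -[LHS]/(\int[leb]_(x in A) (normal_pdf m s x)%:E).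
  rewrite integral_mkcond.
  apply: eq_integral => x _; rewrite patchE indicE.
  by case: ifPn => _; rewrite ?mul1e ?mul0e.
have sfE (h : {nnsfun (measurableTypeR R) >-> R}) : \int[normal_prob m s]_x (h x)%:E =
    \int[leb]_x ((h x)%:E * (normal_pdf m s x)%:E).
  under eq_integral do rewrite fimfunE -fsumEFin//.
  rewrite ge0_integral_fsum//; last 2 first.
  - by move=> r; exact/measurable_EFinP/measurableT_comp.
  - by move=> n x _; rewrite EFinM nnfun_muleindic_ge0.
  under [RHS]eq_integral.
    move=> x _; rewrite fimfunE -fsumEFin// ge0_mule_fsuml; last first.
      by move=> r; rewrite EFinM nnfun_muleindic_ge0.
    over.
  rewrite [RHS]ge0_integral_fsum//; last 2 first.
  - move=> r; apply: emeasurable_funM => //.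
    by apply/measurable_EFinP/measurableT_comp.
  - by move=> n x _; rewrite EFinM mule_ge0// nnfun_muleindic_ge0.
  apply: eq_fsbigr => r _.
  rewrite integralZl_indic_nnsfun// indE//.
  under [RHS]eq_integral do rewrite EFinM -muleA.
  have [r0|r0] := leP 0%R r.
    rewrite ge0_integralZl//.
      by apply: emeasurable_funM => //; exact/measurable_EFinP.
    by move=> x _; rewrite mule_ge0// lee_fin.
  (* A nonnegative simple function does not take the negative value r, so both sides vanish. *)
  have -> : h @^-1` [set r] = set0 by rewrite preimage_nnfun0.
  by rewrite !integral0_eq ?mule0// => x _; rewrite indicE in_set0/= mul0e ?mule0.
have mf' : measurable_fun (setT : set (measurableTypeR R)) f := mf.
pose f_ := nnsfun_approx measurableT mf'.
transitivity (lim (\int[normal_prob m s]_x (f_ n x)%:E @[n --> \oo])).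
  rewrite -monotone_convergence//=.
  - apply: eq_integral => x _; apply/esym/cvg_lim => //=.
    exact: cvg_nnsfun_approx.
  - by move=> n; exact/measurable_EFinP/measurable_funTS.
  - by move=> n x _; rewrite lee_fin.
  - by move=> x _ a b ab; rewrite lee_fin; exact/lefP/nd_nnsfun_approx.
under eq_fun do rewrite sfE.
rewrite -monotone_convergence//=; last 3 first.
- move=> n; apply: emeasurable_funM => //.
  exact/measurable_EFinP/measurable_funTS.
- by move=> n x _; rewrite mule_ge0// lee_fin.
- move=> x _ a b ab; apply: lee_wpmul2r => //.
  by rewrite lee_fin; exact/lefP/nd_nnsfun_approx.
apply: eq_integral => x _; apply: cvg_lim => //.
apply: cvgeZr => //.
exact: cvg_nnsfun_approx.
Qed.

Lemma normal_prob_affine (x s : R) (f : R -> R) : (0 < s)%R -> continuous f ->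
  (forall y, (0 <= f y)%R) ->
  \int[normal_prob 0 1]_u (f (x + s * u)%R)%:E = \int[leb]_y (f y * normal_pdf x s y)%:E.
Proof.
move=> s0 cf f0.
rewrite integral_normal_prob; last 2 first.
- apply/measurable_EFinP; apply: measurableT_comp.
    exact: continuous_measurable_fun.
  by apply: measurable_funD => //; exact: measurable_funM.
- by move=> u; rewrite lee_fin.
have dF (u : R) : is_derive u 1%R (fun u : R => (x + s * u)%R) s.
  rewrite (_ : (fun _ => _) = cst x + s \*: id)%R//.
  by apply: is_derive_eq; rewrite add0r /GRing.scale/= mulr1.
have F'E : (fun u : R => (x + s * u)%R)^`()%classic = cst s.
  by apply/funext => u; rewrite derive1E; apply: derive_val.
rewrite [RHS](@increasing_ge0_integration_by_substitutionT _ (fun u => x + s * u)%R)//.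
- apply: eq_integral => u _; rewrite /= F'E/= -EFinM; congr EFin.
  rewrite /GRing.mul/= -mulrA; congr (_ * _)%R.
  rewrite !normal_pdfE ?gt_eqF// /normal_peak /normal_fun.
  (* The Jacobian s of u -> x + s u converts the peak for variance s ^+ 2 into the standard one. *)
  have -> : ((Num.sqrt (1 ^+ 2 * pi *+ 2))^-1 = (Num.sqrt (s ^+ 2 * pi *+ 2))^-1 * s :> R)%R.
    rewrite expr1n mul1r -[in RHS]mulrnAr [in RHS]sqrtrM ?sqr_ge0// sqrtr_sqr gtr0_norm//.
    by rewrite invfM mulrAC mulVf ?gt_eqF// mul1r.
  rewrite [in RHS]mulrAC; congr (_ * _ * expR _)%R.
  rewrite -[GRing.Nmodule_isPzSemiRing.mul _ s u]/(s * u)%R.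
  have -> : (x + s * u - x = s * u)%R by ring.
  rewrite subr0 expr1n exprMn !mulr2n; field.
  by rewrite gt_eqF// addr_gt0// exprn_gt0.
- by move=> u v uv; rewrite ltrD2l ltr_pM2l.
- by rewrite F'E => ?; exact: cvg_cst.
- by rewrite F'E; exact: is_cvg_cst.
- by rewrite F'E; exact: is_cvg_cst.
- apply/cvgrNyPle => A; near=> u.
  rewrite -lerBrDl mulrC -ler_pdivlMr//; near: u;
  apply: nbhs_ninfty_le; exact: num_real.
- apply/cvgryPge => A; near=> u.
  rewrite -lerBlDl mulrC -ler_pdivrMr//; near: u;
  apply: nbhs_pinfty_ge; exact: num_real.
- move=> y; apply: cvgM; first exact: cf.
  by apply: continuous_normal_pdf; rewrite gt_eqF.
- by move=> y; rewrite mulr_ge0// normal_pdf_ge0.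
Unshelve. all: by end_near. Qed.

(** Completing the square in y. The left side is the joint density of a Gaussian walk from x after
    variances r and r + s; the right side is the density of its endpoint z times the conditional
    density of y given z, so that y can be integrated out. *)
Lemma normal_pdf_conv (x y z r s : R) : (0 < r)%R -> (0 < s)%R ->
  (normal_pdf y (Num.sqrt s) z * normal_pdf x (Num.sqrt r) y =
   normal_pdf x (Num.sqrt (r + s)) z *
   normal_pdf ((s * x + r * z) / (r + s)) (Num.sqrt (r * s / (r + s))) y)%R.
Proof.
move=> r0 s0; have rs0 : (0 < r + s)%R by rewrite addr_gt0.
have q0 : (0 < r * s / (r + s))%R by rewrite divr_gt0// mulr_gt0.
rewrite !normal_pdfE ?gt_eqF ?sqrtr_gt0// /normal_peak /normal_fun.
rewrite !sqr_sqrtr ?ltW// mulrACA [RHS]mulrACA; congr (_ * _)%R.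
  rewrite -!invfM -!sqrtrM ?mulrn_wge0 ?mulr_ge0 ?pi_ge0 ?ltW//.
  congr (Num.sqrt _)^-1%R; rewrite !mulr2n; field.
  by rewrite gt_eqF.
rewrite -!expRD; congr expR; rewrite !mulr2n; field.
by rewrite !gt_eqF ?addr_gt0 ?mulr_gt0.
Qed.


Let e (u : R) : R := expR (- (u ^+ 2 / 2)).

Let normal_pdf01 u : normal_pdf 0 1 u = (normal_peak 1 * e u)%R.
Proof.
rewrite normal_pdfE ?oner_eq0// /normal_fun /e; congr (_ * expR _)%R.
by rewrite subr0 expr1n mulr2n mulNr.
Qed.

Let is_derive_e (u : R) : is_derive u 1%R e (- (u * e u))%R.
Proof.
have d1 : is_derive u 1%R (fun u : R => - (u ^+ 2 / 2))%R (- u)%R.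
  rewrite (_ : (fun _ => _) = (- 2^-1) \*: (@idfun R ^+ 2))%R; last first.
    by apply/funext => v; rewrite -[RHS]/(- 2^-1 * v ^+ 2)%R mulNr mulrC.
  apply: is_derive_eq.
  rewrite /GRing.scale/= !mulr1 expr1 mulrA.
  by rewrite mulNr mulVf ?pnatr_eq0// mulN1r.
have := @is_derive1_comp _ expR (fun v : R => - (v ^+ 2 / 2))%R u _ _ (is_derive_expR _) d1.
by rewrite mulrN [(_ * u)%R]mulrC.
Qed.

Let cts_e : continuous e.
Proof.
by move=> u; apply/differentiable_continuous/derivable1_diffP; case: (is_derive_e u).
Qed.

(* The derivative of [F] is [u ^+ 2 * e u - e u]: this is the integration by parts behind
   the value of the second moment. *)
Let F (u : R) : R := - (u * e u).

Let is_derive_F (u : R) : is_derive u 1%R F (u ^+ 2 * e u - e u)%R.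
Proof.
have := is_deriveN (is_deriveM (is_derive_id u 1%R) (is_derive_e u)).
rewrite /GRing.scale/= mulr1 mulrN opprD opprK mulrA -expr2.
exact.
Qed.

Let int_e_ge0 (A : set R) : measurable A ->
  0 <= \int[leb]_(u in A) (e u)%:E /\ \int[leb]_(u in A) (e u)%:E < +oo.
Proof.
move=> mA; split; first by apply: integral_ge0 => u _; rewrite lee_fin expR_ge0.
have me : measurable_fun setT (EFin \o e).
  by apply/measurable_EFinP; exact: continuous_measurable_fun.
apply: (@le_lt_trans _ _ (\int[leb]_u (e u)%:E)).
  by apply: ge0_subset_integral => // u _; rewrite lee_fin expR_ge0.
have p0 := @normal_peak_gt0 R 1%R (oner_neq0 _).
have := integral_normal_pdf 0 1 : _ = _ :> \bar R.
under eq_integral do rewrite normal_pdf01 EFinM.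
rewrite ge0_integralZl//; last 2 first.
- by move=> u _; rewrite lee_fin expR_ge0.
- by rewrite lee_fin ltW.
by move=> h; rewrite ltey; apply/eqP => E; move: h; rewrite E gt0_muley ?lte_fin.
Qed.

(** The half-line is cut at 1, where the derivative of [F] changes sign: it is nonnegative on [[1,
    +oo[], as the improper fundamental theorem of calculus requires, and the compact piece is
    covered by the ordinary one. *)
Let int_F01 : \int[leb]_(u in `[0%R, 1%R]) (u ^+ 2 * e u)%:E =
  (F 1)%:E + \int[leb]_(u in `[0%R, 1%R]) (e u)%:E.
Proof.
have cF : continuous F.
  by move=> u; apply/differentiable_continuous/derivable1_diffP; case: (is_derive_F u).
have cs : continuous (fun u : R => u ^+ 2 * e u)%R.
  by move=> u; apply: cvgM; [exact: sqr_continuous|exact: cts_e].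
have h : \int[leb]_(u in `[0%R, 1%R]) (u ^+ 2 * e u - e u)%:E = (F 1)%:E - (F 0)%:E.
  apply: continuous_FTC2 => //.
  - by apply: continuous_subspaceT => u; apply: cvgB; [exact: cs|exact: cts_e].
  - split; first by move=> u _; case: (is_derive_F u).
    + exact/cvg_at_right_filter/cF.
    + exact/cvg_at_left_filter/cF.
  - by move=> u _; rewrite derive1E; apply: derive_val.
have iC (g : R -> R) : continuous g -> leb.-integrable `[0%R, 1%R] (EFin \o g).
  move=> cg; apply: continuous_compact_integrable; first exact: segment_compact.
  exact: continuous_subspaceT.
have F0 : F 0 = 0%R by rewrite /F mul0r oppr0.
move: h; rewrite F0 sube0 => <-.
rewrite -integralD//; last 2 first.
- by apply: (iC (fun u => u ^+ 2 * e u - e u)%R) => u; apply: cvgB; [exact: cs|exact: cts_e].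
- exact: (iC e).
by apply: eq_integral => u _; rewrite -EFinD subrK.
Qed.

Let int_F1y : \int[leb]_(u in `[1%R, +oo[) (u ^+ 2 * e u)%:E =
  (- F 1)%:E + \int[leb]_(u in `[1%R, +oo[) (e u)%:E.
Proof.
have cF : continuous F.
  by move=> u; apply/differentiable_continuous/derivable1_diffP; case: (is_derive_F u).
have cs : continuous (fun u : R => u ^+ 2 * e u)%R.
  by move=> u; apply: cvgM; [exact: sqr_continuous|exact: cts_e].
have k0 (u : R) : (1 <= u -> 0 <= u ^+ 2 * e u - e u)%R.
  move=> u1; rewrite -{2}(mul1r (e u)) -mulrBl mulr_ge0 ?expR_ge0// subr_ge0.
  by rewrite expr_ge1// (le_trans _ u1).
have h : \int[leb]_(u in `[1%R, +oo[) (u ^+ 2 * e u - e u)%:E = 0%:E - (F 1)%:E.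
  apply: ge0_continuous_FTC2y => //.
  - by apply: continuous_subspaceT => u; apply: cvgB; [exact: cs|exact: cts_e].
  - rewrite -(oppr0 R); apply: cvgN.
    (* Since expR (u ^+ 2 / 2) is at least 1 + u ^+ 2 / 2, the product u ^+ 2 * e u stays below
       4. *)
    apply: (@squeeze_cvgr _ _ _ _ (cst 0)%R (fun u => 4 / u)%R); last 2 first.
    + exact: cvg_cst.
    + apply/cvgr0Pnorm_le => eps eps0; near=> u.
      have u0 : (0 < u)%R by near: u; exact: nbhs_pinfty_gt.
      rewrite ger0_norm; last by rewrite divr_ge0// ltW.
      rewrite ler_pdivrMr// mulrC -ler_pdivrMr//.
    near=> u; have u0 : (0 < u)%R by near: u; exact: nbhs_pinfty_gt.
    apply/andP; split; first by rewrite mulr_ge0 ?expR_ge0// ltW.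
    rewrite ler_pdivlMr// /e expRN mulrAC -expr2.
    rewrite ler_pdivrMr ?expR_gt0//.
    have := expR_ge1Dx (u ^+ 2 / 2)%R => h.
    have := sqr_ge0 u => h2; lra.
  - exact/cvg_at_right_filter/cF.
  - by move=> u _; rewrite derive1E; apply: derive_val.
move: h; rewrite sub0e -EFinN => <-.
have me : measurable_fun setT e by exact: continuous_measurable_fun.
rewrite -ge0_integralD//; first by apply: eq_integral => u _; rewrite -EFinD subrK.
- by move=> u /=; rewrite in_itv/= andbT => u1; rewrite lee_fin k0.
- apply/measurable_EFinP; apply: measurable_funTS; apply: measurable_funB => //.
  exact: continuous_measurable_fun.
- by move=> u _; rewrite lee_fin expR_ge0.
- by apply/measurable_EFinP; exact: measurable_funTS.
Unshelve. all: by end_near. Qed.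

(** By symmetry it suffices to compare u ^+ 2 * e u with e u on the half-line, where the boundary
    values at the cut, [F 1] and [- F 1], cancel. *)
Lemma normal_second_moment : \int[normal_prob 0 1]_u ((u : R) ^+ 2)%:E = 1.
Proof.
have cs : continuous (fun u : R => u ^+ 2 * e u)%R.
  by move=> u; apply: cvgM; [exact: sqr_continuous|exact: cts_e].
have msq : measurable_fun setT (fun u : R => u ^+ 2 * e u)%R by exact: continuous_measurable_fun.
have me : measurable_fun setT e by exact: continuous_measurable_fun.
have p0 := @normal_peak_gt0 R 1%R (oner_neq0 _).
have sq0 (u : R) : (0 <= u ^+ 2 * e u)%R by rewrite mulr_ge0 ?sqr_ge0 ?expR_ge0.
have split (g : R -> R) : (forall u, 0 <= g u)%R -> measurable_fun setT g ->
    \int[leb]_(u in [set u | 0 <= u]%R) (g u)%:E =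
    \int[leb]_(u in `[0%R, 1%R]) (g u)%:E + \int[leb]_(u in `[1%R, +oo[) (g u)%:E.
  move=> g0 mg.
  rewrite -[X in _ = _ + X]integral_itv_obnd_cbnd; last first.
    by apply/measurable_EFinP; exact: measurable_funTS.
  rewrite -ge0_integral_setU//.
  - congr (integral _ _ _); apply/seteqP; split=> u /=; rewrite !in_itv/= ?andbT.
      by move=> u0; have [u1|u1] := leP u 1%R; [left; rewrite u0|right].
    by move=> [/andP[]//|u1]; apply: le_trans (ltW u1).
  - by apply/measurable_EFinP; exact: measurable_funTS.
  - by move=> u _; rewrite lee_fin.
  - apply/disj_setPS => u [] /=; rewrite !in_itv/= andbT => /andP[_ u1].
    by move=> /lt_geF; rewrite u1.
have half : \int[leb]_(u in [set u | 0 <= u]%R) (u ^+ 2 * e u)%:E =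
            \int[leb]_(u in [set u | 0 <= u]%R) (e u)%:E.
  rewrite !split//; last by move=> u; exact: expR_ge0.
  rewrite int_F01 int_F1y.
  have [a0 a1] := @int_e_ge0 `[0%R, 1%R]%classic (measurable_itv _).
  have [b0 b1] := @int_e_ge0 `[1%R, +oo[%classic (measurable_itv _).
  have /fineK <- : \int[leb]_(u in `[0%R, 1%R]) (e u)%:E \is a fin_num by rewrite ge0_fin_numE.
  have /fineK <- : \int[leb]_(u in `[1%R, +oo[) (e u)%:E \is a fin_num by rewrite ge0_fin_numE.
  by rewrite -!EFinD; congr EFin; ring.
rewrite integral_normal_prob; last 2 first.
- by apply/measurable_EFinP; exact: measurable_funX.
- by move=> u; rewrite lee_fin sqr_ge0.
under eq_integral do rewrite -EFinM normal_pdf01 mulrCA EFinM.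
rewrite ge0_integralZl; [|exact: measurableT|exact/measurable_EFinP| |]; last 2 first.
- by move=> u _; rewrite lee_fin.
- by rewrite lee_fin ltW.
rewrite ge0_symfun_integralT//; last by move=> u /=; rewrite /e sqrrN.
rewrite half -ge0_symfun_integralT//; last 2 first.
- by move=> u; exact: expR_ge0.
- by move=> u /=; rewrite /e sqrrN.
rewrite -ge0_integralZl//; last 3 first.
- exact/measurable_EFinP.
- by move=> u _; rewrite lee_fin expR_ge0.
- by rewrite lee_fin ltW.
under eq_integral do rewrite -EFinM -normal_pdf01.
exact: integral_normal_pdf.
Qed.


Local Open Scope ring_scope.

Local Notation stdn := (normal_prob (0 : R) 1).

Definition scale_rv (s : R) : {mfun measurableTypeR R >-> R} :=
  HB.pack (fun u : measurableTypeR R => Num.sqrt s * u : R)%R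
    (isMeasurableFun.Build _ _ (measurableTypeR R) R (fun u : R => Num.sqrt s * u)%R
      (mulrl_measurable (Num.sqrt s))).

(* N(0, s), including the Dirac mass at [s = 0]. *)
Definition gau (s : R) : probability R R := distribution (stdn) (scale_rv s).

Lemma avg_gau_mu (s K x : R) (f : R -> R) : lipb K f ->
  avg (gau s) f x = \int[stdn]_u f (x + Num.sqrt s * u).
Proof.
move=> fK; have mf := lipb_measurable fK.
rewrite /avg /gau (law_Rint (V := scale_rv s) (g := fun y => f (x + y)))//.
  exact: shift_measurable.
apply: (@bounded_integrable _ _ _ _ _ K); last by move=> u; exact: fK.1.
apply: measurableT_comp; first exact: shift_measurable.
exact: measurable_funP.
Qed.

Lemma avg_gau_pdf (s K x : R) (f : R -> R) : 0 < s -> lipb K f -> (forall y, 0 <= f y) ->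
  ((avg (gau s) f x)%:E = \int[leb]_y (f y * normal_pdf x (Num.sqrt s) y)%:E)%E.
Proof.
move=> s0 fK f0; rewrite (avg_gau_mu _ _ fK).
rewrite -normal_prob_affine//; last 2 first.
- by rewrite sqrtr_gt0.
- exact: lipb_continuous fK.
rewrite RintE//.
apply: (@bounded_integrable _ _ _ _ _ K); last by move=> u; exact: fK.1.
apply: measurableT_comp; first exact: (lipb_measurable fK).
by apply: measurable_funD => //; exact: mulrl_measurable.
Qed.

Lemma avg_gau0 (K x : R) (f : R -> R) : lipb K f -> avg (gau 0) f x = f x.
Proof.
move=> fK; rewrite (avg_gau_mu _ _ fK) sqrtr0.
under eq_Rintegral do rewrite mul0r addr0.
exact: Rint_cst.
Qed.

(** The Gaussian semigroup: after [normal_pdf_conv], Tonelli lets y be integrated first. Zero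
    variances are split off because a Dirac mass has no density. *)
Lemma avg_gauD (s r K x : R) (f : R -> R) : 0 <= s -> 0 <= r -> lipb K f ->
  (forall y, 0 <= f y) -> avg (gau r) (avg (gau s) f) x = avg (gau (r + s)) f x.
Proof.
move=> + + fK f0; rewrite le0r => /predU1P[->|s0].
  move=> _; rewrite addr0; congr avg.
  by apply/funext => y; rewrite (avg_gau0 _ fK).
rewrite le0r => /predU1P[->|r0].
  by rewrite add0r (avg_gau0 _ (avg_lipb _ fK)).
apply: EFin_inj.
have E1 := avg_gau_pdf x r0 (avg_lipb (gau s) fK) (avg_ge0 _ f0).
have E2 := avg_gau_pdf x (addr_gt0 r0 s0) fK f0.
apply: (etrans E1); apply: (etrans _ (esym E2)) => {E1 E2}.
have mf := lipb_measurable fK.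
have mp (a b : R) := @measurable_normal_pdf R a b.
have mfp a b : measurable_fun setT (fun y : R => f y * normal_pdf a b y) :=
  measurable_funM mf (mp a b).
have p0 (a b c : R) : 0 <= normal_pdf a b c := normal_pdf_ge0 a b c.
under eq_integral => y _.
  rewrite EFinM (avg_gau_pdf y s0 fK f0) -ge0_integralZr//; last 3 first.
  - by apply/measurable_EFinP; exact: mfp.
  - by move=> z _; rewrite lee_fin mulr_ge0.
  - by rewrite lee_fin.
  under eq_integral => z _.
    rewrite -EFinM -mulrA normal_pdf_conv//; over.
  over.
pose g (p : R * R) := (f p.2 * (normal_pdf x (Num.sqrt (r + s)) p.2 *
  normal_pdf ((s * x + r * p.2) / (r + s)) (Num.sqrt (r * s / (r + s))) p.1))%:E.
have := @fubini_tonelli _ _ _ _ R leb leb g.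
rewrite /g/= => ->; last 2 first.
- apply/measurable_EFinP.
  have q0 : 0 < r * s / (r + s) by rewrite divr_gt0 ?addr_gt0// mulr_gt0.
  (* Moving the centre into the argument makes joint measurability in both variables a matter of
     composition. *)
  have nc a b : normal_pdf a (Num.sqrt (r * s / (r + s))) b =
      normal_pdf 0 (Num.sqrt (r * s / (r + s))) (b - a).
    by rewrite !normal_pdfE ?gt_eqF ?sqrtr_gt0// /normal_fun subr0.
  apply: measurable_funM; first exact: measurableT_comp.
  apply: measurable_funM; first exact: (measurableT_comp (mp _ _)).
  under eq_fun do rewrite nc.
  apply: (measurableT_comp (mp _ _)); apply: measurable_funB => //.
  apply: measurable_funM => //; apply: measurable_funD => //.
  exact: measurable_funM.
- by move=> p; rewrite lee_fin !mulr_ge0.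
apply: eq_integral => z _.
under eq_integral do rewrite mulrA EFinM.
rewrite ge0_integralZl//; last 3 first.
- by apply/measurable_EFinP; exact: mp.
- by move=> y _; rewrite lee_fin.
- by rewrite lee_fin mulr_ge0.
by rewrite integral_normal_pdf mule1.
Qed.

Lemma stdn_integrable2 : stdn.-integrable setT (EFin \o (fun x : R => x ^+ 2)).
Proof.
apply/integrableP; split.
  by apply/measurable_EFinP; exact: measurable_funX.
under eq_integral do rewrite /= ger0_norm ?sqr_ge0//.
by rewrite normal_second_moment ltry.
Qed.

Lemma stdn_integrable1 : stdn.-integrable setT (EFin \o (fun x : R => x)).
Proof.
have i1 : stdn.-integrable setT (EFin \o (fun x : R => 1 + x ^+ 2)).
  have := integrableD measurableT (finite_measure_integrable_cst stdn 1 measurableT) stdn_integrable2.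
  exact: eq_integrable.
apply: integrable_le i1 => // x.
have := sqr_ge0 (`|x| - 1); have := sqr_ge0 x; rewrite sqrrB expr1n mulr1 -normrX (ger0_norm (sqr_ge0 x)) mulr2n.
lra.
Qed.

(** The reflection x -> - x exchanges the integrals of the positive and the negative part. *)
Lemma stdn_mean0 : \int[stdn]_x x = 0.
Proof.
have mp : measurable_fun setT (fun x : R => Num.max x 0) by exact: measurable_maxr.
have mn : measurable_fun setT (fun x : R => Num.max (- x) 0).
  by apply: measurable_maxr => //; exact: measurable_funN.
have pE (x : R) : x = Num.max x 0 - Num.max (- x) 0.
  by rewrite /Num.max !ltNge; case: (leP 0 x) => x0; case: (leP 0 (- x)) => y0 /=; lra.
have ip : stdn.-integrable setT (EFin \o (fun x : R => Num.max x 0)).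
  apply: integrable_le (integrable_norm stdn_integrable1) => // x.
  by rewrite ger0_norm ?le_max ?lexx ?orbT// ge_max ler_norm normr_ge0.
have im : stdn.-integrable setT (EFin \o (fun x : R => Num.max (- x) 0)).
  apply: integrable_le (integrable_norm stdn_integrable1) => // x.
  have := ler_norm (- x : R); rewrite normrN => h.
  by rewrite ger0_norm ?le_max ?lexx ?orbT// ge_max h normr_ge0.
transitivity (\int[stdn]_x (Num.max x 0 - Num.max (- x) 0)).
  by apply: eq_Rintegral => x _; exact: pE.
rewrite RintegralB//; apply/eqP; rewrite subr_eq0; apply/eqP; congr fine.
rewrite !integral_normal_prob; first last.
- by move=> x; rewrite lee_fin le_max lexx orbT.
- exact/measurable_EFinP.
- by move=> x; rewrite lee_fin le_max lexx orbT.
- exact/measurable_EFinP.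
transitivity (\int[leb]_(x in `[0%R, +oo[) (x * normal_pdf 0 1 x)%:E)%E.
  rewrite [RHS]integral_mkcond; apply: eq_integral => x _.
  rewrite patchE -EFinM; have [x0|x0] := leP 0 (x : R).
    have -> : x \in `[0%R, +oo[%classic by rewrite inE/= in_itv/= x0.
    by [].
  have -> : x \in `[0%R, +oo[%classic = false.
    by apply/negbTE; rewrite notin_setE/= in_itv/= andbT; apply/negP; rewrite -ltNge.
  by rewrite mul0r.
pose g (x : R) := - x * normal_pdf 0 1 x.
transitivity (\int[leb]_(x in `]-oo, (- 0)%R]) (g x)%:E)%E; last first.
  rewrite [LHS]integral_mkcond; apply: eq_integral => x _.
  rewrite patchE -EFinM oppr0 /g; have [x0|x0] := leP (x : R) 0.
    have -> : x \in `]-oo, 0%R]%classic by rewrite inE/= in_itv/= x0.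
    by rewrite max_l// oppr_ge0.
  have -> : x \in `]-oo, 0%R]%classic = false.
    by apply/negbTE; rewrite notin_setE/= in_itv/=; apply/negP; rewrite -ltNge.
  by rewrite max_r ?mul0r// oppr_le0 ltW.
rewrite ge0_integration_by_substitutionNy; last 2 first.
- apply: continuous_subspaceT => x; apply: cvgM; first exact: cvgN.
  by apply: continuous_normal_pdf; rewrite oner_eq0.
- move=> x; rewrite in_itv/= oppr0 => x0.
  by rewrite mulr_ge0 ?normal_pdf_ge0// oppr_ge0 ltW.
apply: eq_integral => x _; rewrite /g/= opprK !normal_pdf01 /e sqrrN.
by [].
Qed.

Let gau_i2 (s : R) : stdn.-integrable setT (EFin \o ((fun x : R => x ^+ 2) \o scale_rv s)).
Proof.
apply: eq_integrable (integrableZl measurableT ((Num.sqrt s) ^+ 2) stdn_integrable2) => //.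
by move=> x _ /=; rewrite exprMn.
Qed.

Let gau_i1 (s : R) : stdn.-integrable setT (EFin \o (id \o scale_rv s)).
Proof.
exact: eq_integrable (integrableZl measurableT (Num.sqrt s) stdn_integrable1).
Qed.

Lemma gau_Rint (s : R) (g : R -> R) : measurable_fun setT g ->
  stdn.-integrable setT (EFin \o (fun u : R => g (Num.sqrt s * u))) ->
  \int[gau s]_x g x = \int[stdn]_u g (Num.sqrt s * u).
Proof. by move=> mg ig; rewrite (law_Rint (V := scale_rv s) (g := g)). Qed.

Lemma gau_integrable2 (s : R) : (gau s).-integrable setT (EFin \o (fun x : R => x ^+ 2)).
Proof. by apply: law_integrable; [exact: measurable_funX|exact: gau_i2]. Qed.

Lemma gau_integrable1 (s : R) : (gau s).-integrable setT (EFin \o (fun x : R => x)).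
Proof. by apply: law_integrable => //; exact: gau_i1. Qed.

Lemma gau_var (s : R) : 0 <= s -> \int[gau s]_x (x ^+ 2) = s.
Proof.
move=> s0; rewrite (law_Rint (V := scale_rv s) (g := fun x => x ^+ 2)).
- under eq_Rintegral do rewrite /= exprMn.
  rewrite RintegralZl//; last exact: stdn_integrable2.
  by rewrite sqr_sqrtr// /Rintegral normal_second_moment mulr1.
- exact: measurable_funX.
- exact: gau_i2.
Qed.

Lemma gau_mean (s : R) : \int[gau s]_x x = 0.
Proof.
rewrite (law_Rint (V := scale_rv s) (g := id)).
- by rewrite RintegralZl// ?stdn_mean0 ?mulr0//; exact: stdn_integrable1.
- exact: measurable_id.
- exact: gau_i1.
Qed.

End gaussian.

Global Opaque gau.

(** * Lindeberg's replacement method *)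

Section cubic.
Context (R : realType).
Implicit Types (K : R) (f : R -> R).

(** The size of a second-order Taylor remainder: the cube makes it negligible for small summands,
    the square keeps it integrable when only a second moment exists. *)
Definition cub (y : R) : R := Num.min (y ^+ 2) (`|y| ^+ 3).

Lemma cub_ge0 y : 0 <= cub y.
Proof. by rewrite le_min sqr_ge0 exprn_ge0. Qed.

Lemma cub_le y : cub y <= y ^+ 2.
Proof. by rewrite ge_min lexx. Qed.

Lemma measurable_cub : measurable_fun setT cub.
Proof.
apply: measurable_minr; first exact: measurable_funX.
by apply: measurable_funX; exact: normr_measurable.
Qed.

Lemma cub_integrable d (T : measurableType d) (P : probability T R) (X : T -> R) :
  measurable_fun setT X -> P.-integrable setT (EFin \o (fun w => X w ^+ 2)) ->
  P.-integrable setT (EFin \o (fun w => cub (X w))).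
Proof.
move=> mX; apply: integrable_le; first exact: (measurableT_comp measurable_cub).
by move=> w; rewrite ger0_norm ?cub_ge0// cub_le.
Qed.

(** This takes the place of the Lindeberg condition. The scaled integrand is dominated by X ^+ 2 and
    is at most |X| ^+ 3 / sqrt (a n) pointwise, so dominated convergence applies. *)
Lemma cub_vanish d (T : measurableType d) (P : probability T R) (X : T -> R) (a : nat -> R) :
  measurable_fun setT X -> P.-integrable setT (EFin \o (fun w => X w ^+ 2)) ->
  (forall n, 0 < a n) -> a n @[n --> \oo] --> +oo ->
  a n * \int[P]_w cub (X w / Num.sqrt (a n)) @[n --> \oo] --> 0.
Proof.
move=> mX iX a0 ay.
pose g n w := a n * cub (X w / Num.sqrt (a n)).
have mXa n : measurable_fun setT (fun w => X w / Num.sqrt (a n)) by exact: measurable_funM.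
have mg n : measurable_fun setT (g n).
  by apply: measurable_funM => //; exact: (measurableT_comp measurable_cub).
have g0 n w : 0 <= g n w by rewrite mulr_ge0 ?cub_ge0// ltW.
have gle n w : g n w <= X w ^+ 2.
  rewrite /g mulrC -ler_pdivlMr//; apply: (le_trans (cub_le _)).
  by rewrite exprMn exprVn sqr_sqrtr// ltW.
have gcvg w : g n w @[n --> \oo] --> 0.
  apply/cvgr0Pnorm_le => e e0; near=> n.
  rewrite ger0_norm//.
  apply: (@le_trans _ _ (`|X w| ^+ 3 / Num.sqrt (a n))).
    rewrite /g /cub.
    apply: (@le_trans _ _ (a n * `|X w / Num.sqrt (a n)| ^+ 3)).
      by apply: ler_wpM2l; [exact: ltW|rewrite ge_min lexx orbT].
    rewrite normrM normfV (ger0_norm (sqrtr_ge0 _)) exprMn exprVn mulrCA.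
    rewrite -{1}(sqr_sqrtr (ltW (a0 n))) ler_wpM2l ?exprn_ge0//.
    by rewrite [X in _ / X]exprS invfM mulrCA mulfV ?mulr1// expf_neq0// gt_eqF// sqrtr_gt0.
  rewrite ler_pdivrMr ?sqrtr_gt0// mulrC -ler_pdivrMr//.
  rewrite -[leLHS]ger0_norm ?divr_ge0 ?exprn_ge0 ?(ltW e0)// -sqrtr_sqr ler_wsqrtr//.
  near: n; move/cvgryPge : ay; exact.
have h : (\int[P]_w (g n w)%:E)%E @[n --> \oo] --> (\int[P]_w (cst 0%E) w)%E.
  have h1 n : measurable_fun setT (EFin \o g n) by exact/measurable_EFinP.
  have h2 : {ae P, forall w, setT w -> (EFin \o g n) w @[n --> \oo] --> 0%E}.
    by apply: aeW => w _; apply/fine_cvgP; split; [exact: nearW|exact: gcvg].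
  have h3 : {ae P, forall w n, setT w -> (`|(EFin \o g n) w| <= (EFin \o (fun w => (X w ^+ 2)%R)) w)%E}.
    by apply: aeW => w n _; rewrite /= lee_fin ger0_norm.
  by have [_ _] := dominated_convergence measurableT h1 (measurable_cst _) h2 iX h3.
have ig n : P.-integrable setT (EFin \o g n).
  by apply: integrable_le iX => // w; rewrite ger0_norm.
have gE n : (\int[P]_w (g n w)%:E)%E = (a n * \int[P]_w cub (X w / Num.sqrt (a n)))%:E.
  rewrite RintE// RintegralZl//; apply: cub_integrable => //.
  have := integrableZl measurableT (a n)^-1 iX; apply: eq_integrable => // w _ /=.
  by rewrite exprMn exprVn sqr_sqrtr ?(ltW (a0 n))// mulrC.
move: h; rewrite integral0; under eq_fun do rewrite gE.
by move=> /fine_cvgP[].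
Unshelve. all: by end_near. Qed.

End cubic.

Section lindeberg.
Context (R : realType).
Implicit Types (K : R) (f : R -> R) (mu : probability R R).

(** Integrate the Taylor bound against mu. The linear term disappears because mu is centred, so up
    to the [cub] moment only the variance of mu matters. *)
Lemma avg_taylor_step mu K f f1 f2 x : taylor K f f1 f2 ->
  mu.-integrable setT (EFin \o (fun y : R => y)) ->
  mu.-integrable setT (EFin \o (fun y : R => y ^+ 2)) ->
  \int[mu]_y y = 0 ->
  `|avg mu f x - f x - (\int[mu]_y (y ^+ 2)) / 2 * f2 x| <= K * \int[mu]_y cub y.
Proof.
move=> [f0 l0 l1 l2 fr] i1 i2 m0.
have if0 := lipb_integrable mu x l0.
have iZ c (g : R -> R) : mu.-integrable setT (EFin \o g) -> mu.-integrable setT (EFin \o (fun w => g w * c)).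
  by move=> ig; have := integrableZr measurableT c ig; apply: eq_integrable.
have iB (g h : R -> R) : mu.-integrable setT (EFin \o g) -> mu.-integrable setT (EFin \o h) ->
    mu.-integrable setT (EFin \o (fun w => g w - h w)).
  by move=> ig ih; have := integrableB measurableT ig ih; apply: eq_integrable.
have ic (c : R) : mu.-integrable setT (EFin \o (fun _ : R => c)) := finite_measure_integrable_cst mu c measurableT.
have -> : avg mu f x - f x - (\int[mu]_y (y ^+ 2)) / 2 * f2 x =
   \int[mu]_y (f (x + y) - f x - y * f1 x - y ^+ 2 / 2 * f2 x).
  rewrite RintegralB//; last 2 first.
  - exact: (iB _ _ (iB _ _ if0 (ic _)) (iZ _ _ i1)).
  - exact: (iZ _ _ (iZ _ _ i2)).
  rewrite RintegralB//; last 2 first.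
  - exact: (iB _ _ if0 (ic _)).
  - exact: (iZ _ _ i1).
  rewrite RintegralB// Rint_cst !RintegralZr//; last exact: iZ.
  by rewrite m0 mul0r subr0.
have ih := iB _ _ (iB _ _ (iB _ _ if0 (ic (f x))) (iZ (f1 x) _ i1)) (iZ (f2 x) _ (iZ 2^-1 _ i2)).
have mid : measurable_fun setT (fun y : R => y) by [].
have icub := cub_integrable mid i2.
apply: (le_trans (le_normr_Rintegral _ ih)) => //.
rewrite -RintegralZl//; apply: le_Rintegral => //.
- exact: integrable_norm.
- by have := integrableZl measurableT K icub; apply: eq_integrable.
Qed.

(** The quadratic term costs at most K s / 2 and the remainder at most K s, as [cub] lies below the
    square; the constant 2 rounds up 3 / 2. *)
Lemma avg_gau_step K f f1 f2 x s : 0 <= s -> taylor K f f1 f2 ->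
  `|avg (gau s) f x - f x| <= 2 * K * s.
Proof.
move=> s0 tf; have [f0 l0 l1 l2 fr] := tf.
have K0 : 0 <= K by apply: le_trans (l0.1 0); exact: normr_ge0.
have := avg_taylor_step x tf (gau_integrable1 s) (gau_integrable2 s) (gau_mean s).
rewrite (gau_var s0).
have h : \int[gau s]_y cub y <= s.
  rewrite -[leRHS](gau_var s0); apply: ge0_le_Rint.
  - exact: measurable_cub.
  - by move=> y; rewrite cub_ge0 cub_le.
  - exact: gau_integrable2.
have h2 := l2.1 x; move: h2; rewrite ler_norml => /andP[h2 h3].
have := ler_wpM2l K0 h; set I := \int[gau s]_y cub y => KI.
have : - (s * K) <= s * f2 x <= s * K.
  by rewrite -mulrN !ler_wpM2l.
move=> /andP[h4 h5]; rewrite !ler_norml => /andP[h6 h7]; apply/andP; split; lra.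
Qed.

(** Serves to move the variance of the approximating Gaussian to its limit. By the semigroup
    property the larger variance is reached from the smaller one by a further Gaussian average. *)
Lemma avg_gau_lip K f f1 f2 x s t : 0 <= s -> 0 <= t -> taylor K f f1 f2 ->
  `|avg (gau s) f x - avg (gau t) f x| <= 2 * K * `|s - t|.
Proof.
wlog st : s t / s <= t.
  move=> h s0 t0 tf; have [st|/ltW ts] := leP s t; first exact: h.
  by rewrite distrC (distrC s); exact: h.
move=> s0 t0 tf; have [f0 l0 _ _ _] := tf.
have ts : 0 <= t - s by rewrite subr_ge0.
have h := avg_gau_step x ts (avg_taylor (gau s) tf).
have E := avg_gauD x s0 ts l0 f0; rewrite subrK in E.
by rewrite distrC (distrC s) (ger0_norm ts) -E.
Qed.

End lindeberg.

Section iid.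
Context d (T : measurableType d) (R : realType) (P : probability T R).
Implicit Types (K : R) (f : R -> R) (mu : probability R R).

Definition mfun_of (X : T -> R) (mX : measurable_fun setT X) : {mfun T >-> R} :=
  HB.pack X (isMeasurableFun.Build _ _ _ _ X mX).

Lemma indep2_comp (X Y : T -> R) (g h : R -> R) : measurable_fun setT g ->
  measurable_fun setT h -> indep2 P X Y -> indep2 P (g \o X) (h \o Y).
Proof.
move=> mg mh XY A B mA mB; apply: (XY (g @^-1` A) (h @^-1` B)).
- by rewrite -[X in measurable X]setTI; exact: mg.
- by rewrite -[X in measurable X]setTI; exact: mh.
Qed.

(** Induction on n. The last summand is averaged out and exchanged for a Gaussian of equal variance,
    so the second-order terms cancel and the two [cub] moments are the cost. The induction
    hypothesis is then applied to [avg (gau s) f], and the semigroup property collects the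
    variances. *)
Lemma lindeberg_iid (X : nat -> T -> R) mu s K :
  (forall k, measurable_fun setT (X k)) ->
  (forall k A, measurable A -> P (X k @^-1` A) = mu A) ->
  (forall n, indep2 P (fun w => \sum_(k < n) X k w) (X n)) ->
  mu.-integrable setT (EFin \o (fun y : R => y)) ->
  mu.-integrable setT (EFin \o (fun y : R => y ^+ 2)) ->
  \int[mu]_y y = 0 -> \int[mu]_y (y ^+ 2) = s ->
  forall n f f1 f2 x, taylor K f f1 f2 ->
  `|\int[P]_w f (x + \sum_(k < n) X k w) - avg (gau (n%:R * s)) f x| <=
  n%:R * (K * (\int[mu]_y cub y + \int[gau s]_y cub y)).
Proof.
move=> mX lX iX i1 i2 m0 v; have s0 : 0 <= s.
  by rewrite -v; apply: Rintegral_ge0 => y _; exact: sqr_ge0.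
have mS n : measurable_fun setT (fun w => \sum_(k < n) X k w).
  exact: measurable_sum.
elim=> [|n IH] f f1 f2 x tf; have [f0 l0 l1 l2 fr] := tf.
  rewrite !mul0r (avg_gau0 _ l0).
  under eq_Rintegral do rewrite big_ord0 addr0.
  by rewrite Rint_cst subrr normr0.
have mf := lipb_measurable l0.
have Aeq y : \int[distribution P (mfun_of (mX n))]_z f (y + z) = avg mu f y.
  rewrite /avg /Rintegral; congr fine; apply: eq_measure_integral => A mA _.
  exact: lX.
under eq_Rintegral do rewrite big_ord_recr/= addrA.
rewrite (@indep2_avg _ _ _ P (mfun_of (mS n)) (mfun_of (mX n)) f K x)//; [|exact: iX|exact: l0.1].
under eq_Rintegral do rewrite Aeq/=.
have step y : `|avg mu f y - avg (gau s) f y| <= K * (\int[mu]_y cub y + \int[gau s]_y cub y).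
  have h1 := avg_taylor_step y tf i1 i2 m0.
  have h2 := avg_taylor_step y tf (gau_integrable1 s) (gau_integrable2 s) (gau_mean s).
  rewrite v in h1; rewrite (gau_var s0) in h2.
  rewrite mulrDr; move: h1 h2; rewrite !ler_norml => /andP[? ?] /andP[? ?].
  by apply/andP; split; lra.
have tg := avg_taylor (gau s) tf; have [g0 lg _ _ _] := tg.
have mU : measurable_fun setT (fun w => x + \sum_(k < n) X k w) by exact: measurable_funD.
have iA (h : R -> R) : lipb K h -> P.-integrable setT (EFin \o (fun w => h (x + \sum_(k < n) X k w))).
  move=> lh; apply: (@bounded_integrable _ _ _ _ _ K); last by move=> w; exact: lh.1.
  exact: (measurableT_comp (lipb_measurable lh)).
have la := avg_lipb mu l0.
have h1 : `|\int[P]_w avg mu f (x + \sum_(k < n) X k w) -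
    \int[P]_w avg (gau s) f (x + \sum_(k < n) X k w)| <= K * (\int[mu]_y cub y + \int[gau s]_y cub y).
  rewrite -RintegralB//; try exact: iA.
  apply: Rint_le_cst => //; apply: measurable_funB.
    exact: (measurableT_comp (lipb_measurable la)).
  exact: (measurableT_comp (lipb_measurable lg)).
have h2 := IH _ _ _ x tg.
rewrite (avg_gauD x s0 _ l0 f0) ?mulr_ge0// in h2.
rewrite -natr1 !mulrDl !mul1r.
apply: (le_trans _ (lerD h2 h1)).
rewrite [leRHS]addrC; apply: le_trans (ler_normD _ _).
by rewrite addrA subrK.
Qed.

End iid.

Lemma avgE (R : realType) (mu : probability R R) (f : R -> R) x :
  avg mu f x = \int[mu]_y f (x + y).
Proof. by []. Qed.

Global Opaque avg.

Lemma dist_half (R : realFieldType) (y x z e : R) :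
  `|x - y| <= e / 2 -> `|y - z| <= e / 2 -> `|x - z| <= e.
Proof.
move=> xy yz; rewrite (splitr e); apply: le_trans (lerD xy yz).
exact: ler_distD.
Qed.

(** * Central limit theorem for i.i.d. sums and for sums of independent limits *)

Section clt.
Context d (T : measurableType d) (R : realType) (P : probability T R).
Implicit Types (K : R) (f : R -> R).

(* Convergence in law to N(0, s).  Uniformity in the translation [x] is what lets limits
   of independent summands be combined one summand at a time. *)
Definition gaussian_limit (Y : nat -> T -> R) (s : R) := forall K f f1 f2,
  taylor K f f1 f2 -> forall e : R, 0 < e -> \forall n \near \oo,
  forall x, `|\int[P]_w f (x + Y n w) - avg (gau s) f x| <= e.

(** The m n replacements cost m n / a n, which is bounded, times a n times the [cub] moments, which
    tends to 0. What remains is the shift of variance from m n * v / a n to lam * v. *)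
Lemma clt_iid (X : nat -> T -> R) (v lam : R) (a : nat -> R) (m : nat -> nat) :
  (forall k, measurable_fun setT (X k)) ->
  (forall k A, measurable A -> P (X k @^-1` A) = P (X 0%N @^-1` A)) ->
  (forall n, indep2 P (fun w => \sum_(k < n) X k w) (X n)) ->
  P.-integrable setT (EFin \o (fun w => X 0%N w)) ->
  P.-integrable setT (EFin \o (fun w => X 0%N w ^+ 2)) ->
  \int[P]_w X 0%N w = 0 -> \int[P]_w (X 0%N w ^+ 2) = v ->
  (forall n, 0 < a n) -> a n @[n --> \oo] --> +oo ->
  (m n)%:R / a n @[n --> \oo] --> lam -> 0 <= lam ->
  gaussian_limit (fun n w => (\sum_(k < m n) X k w) / Num.sqrt (a n)) (lam * v).
Proof.
move=> mX lX iX i1 i2 m0 vE a0 ay ma lam0 K f f1 f2 tf e e0.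
have v0 : 0 <= v by rewrite -vE; apply: Rintegral_ge0 => w _; exact: sqr_ge0.
have K0 : 0 <= K by have [_ l0 _ _ _] := tf; apply: le_trans (l0.1 0); exact: normr_ge0.
pose Y n k w := X k w / Num.sqrt (a n).
have mY n k : measurable_fun setT (Y n k) by exact: measurable_funM.
pose mu n : probability R R := distribution P (mfun_of (mY n 0%N)).
have msc n : measurable_fun setT (fun y : R => y / Num.sqrt (a n)) by exact: measurable_funM.
have lY n k A : measurable A -> P (Y n k @^-1` A) = mu n A.
  move=> mA; pose B := (fun y : R => y / Num.sqrt (a n)) @^-1` A.
  have mB : measurable B by rewrite -[X in measurable X]setTI; exact: msc.
  exact: (lX k B mB).
have iY n q : indep2 P (fun w => \sum_(k < q) Y n k w) (Y n q).
  have -> : (fun w => \sum_(k < q) Y n k w) = (fun y : R => y / Num.sqrt (a n)) \o (fun w => \sum_(k < q) X k w).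
    by apply/funext => w /=; rewrite mulr_suml.
  exact: (indep2_comp (msc n) (msc n) (iX q)).
have jY1 n : P.-integrable setT (EFin \o (fun w => Y n 0%N w)).
  by have := integrableZr measurableT (Num.sqrt (a n))^-1 i1; apply: eq_integrable.
have jY2 n : P.-integrable setT (EFin \o (fun w => Y n 0%N w ^+ 2)).
  have := integrableZr measurableT ((Num.sqrt (a n))^-1 ^+ 2) i2.
  by apply: eq_integrable => // w _ /=; rewrite /Y exprMn.
have nu1 n : (mu n).-integrable setT (EFin \o (fun y : R => y)).
  by apply: (law_integrable (V := mfun_of (mY n 0%N))) => //; exact: jY1.
have msq : measurable_fun setT (fun y : R => y ^+ 2) by exact: measurable_funX.
have nu2 n : (mu n).-integrable setT (EFin \o (fun y : R => y ^+ 2)).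
  by apply: (law_integrable (V := mfun_of (mY n 0%N))) => //; exact: jY2.
have mid : measurable_fun setT (fun y : R => y) by [].
have mu0 n : \int[mu n]_y y = 0.
  rewrite (law_Rint (V := mfun_of (mY n 0%N)) mid (jY1 n)).
  by rewrite RintegralZr// m0 mul0r.
have muv n : \int[mu n]_y (y ^+ 2) = v / a n.
  rewrite (law_Rint (V := mfun_of (mY n 0%N)) msq (jY2 n)).
  under eq_Rintegral do rewrite /= /Y exprMn exprVn sqr_sqrtr ?(ltW (a0 n))//.
  by rewrite RintegralZr// vE.
have main n x := lindeberg_iid (mY n) (lY n) (iY n) (nu1 n) (nu2 n) (mu0 n) (muv n) (m n) x tf.
have cmu : a n * \int[mu n]_y cub y @[n --> \oo] --> 0.
  have := cub_vanish (mX 0%N) i2 a0 ay.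
  rewrite (_ : (fun n => _) = (fun n => a n * \int[mu n]_y cub y))//.
  apply/funext => n; rewrite (law_Rint (V := mfun_of (mY n 0%N)) (g := @cub R))//.
    exact: measurable_cub.
  exact: (cub_integrable (mY n 0%N) (jY2 n)).
(* The law N(0, v / a n) is that of sqrt v * u divided by sqrt (a n) with u standard normal, so
   [cub_vanish] covers the Gaussian side as well. *)
have cga : a n * \int[gau (v / a n)]_y cub y @[n --> \oo] --> 0.
  have mN : measurable_fun setT (fun u : measurableTypeR R => Num.sqrt v * u : R).
    exact: mulrl_measurable.
  have iN : (normal_prob 0 1).-integrable setT (EFin \o (fun u : R => (Num.sqrt v * u) ^+ 2)).
    have := integrableZl measurableT (Num.sqrt v ^+ 2) (@stdn_integrable2 R).
    by apply: eq_integrable => // u _ /=; rewrite exprMn.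
  have := cub_vanish mN iN a0 ay.
  rewrite (_ : (fun n => _) = (fun n => a n * \int[gau (v / a n)]_y cub y))//.
  apply/funext => n.
  have sE (u : R) : Num.sqrt (v / a n) * u = Num.sqrt v * u / Num.sqrt (a n).
    by rewrite sqrtrM// sqrtrV ?(ltW (a0 n))// mulrAC.
  rewrite gau_Rint; [|exact: measurable_cub|].
    by congr (_ * _); apply: eq_Rintegral => u _; rewrite sE.
  under [X in EFin \o X]eq_fun do rewrite sE.
  apply: (@cub_integrable _ _ _ (normal_prob 0 1) (fun u => Num.sqrt v * u / Num.sqrt (a n))).
    exact: measurable_funM.
  have := integrableZr measurableT ((Num.sqrt (a n))^-1 ^+ 2) iN.
  by apply: eq_integrable => // w _ /=; rewrite [in RHS]exprMn.
have c1 : (m n)%:R / a n * (K * (a n * \int[mu n]_y cub y + a n * \int[gau (v / a n)]_y cub y))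
    @[n --> \oo] --> lam * (K * (0 + 0)).
  by apply: cvgM => //; apply: cvgM; [exact: cvg_cst|exact: cvgD].
have c2 : (m n)%:R / a n * v @[n --> \oo] --> lam * v by apply: cvgM => //; exact: cvg_cst.
rewrite addr0 mulr0 mulr0 in c1.
have e2 : 0 < e / 2 by rewrite divr_gt0.
(* A positive divisor even when K = 0. *)
have K1 : 0 < 2 * K + 1 by rewrite ltr_wpDl// mulr_ge0.
near=> n => x.
have h1 : (m n)%:R / a n * (K * (a n * \int[mu n]_y cub y + a n * \int[gau (v / a n)]_y cub y)) <= e / 2.
  apply: le_trans (ler_norm _) _; near: n.
  by move/cvgr0Pnorm_le : c1; exact.
have h2 : 2 * K * `|(m n)%:R / a n * v - lam * v| <= e / 2.
  apply: (@le_trans _ _ ((2 * K + 1) * `|(m n)%:R / a n * v - lam * v|)).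
    by rewrite ler_wpM2r// lerDl.
  rewrite mulrC -ler_pdivlMr// distrC; near: n.
  by move/cvgrPdist_le : c2; apply; rewrite divr_gt0.
have sn0 : 0 <= (m n)%:R / a n * v by rewrite mulr_ge0// divr_ge0// ltW.
have h3 := avg_gau_lip x sn0 (mulr_ge0 lam0 v0) tf.
have h4 := main n x.
have E : (m n)%:R * (v / a n) = (m n)%:R / a n * v by rewrite mulrA mulrAC.
rewrite E in h4.
have E' : (m n)%:R * (K * (\int[mu n]_y cub y + \int[gau (v / a n)]_y cub y)) =
   (m n)%:R / a n * (K * (a n * \int[mu n]_y cub y + a n * \int[gau (v / a n)]_y cub y)).
  rewrite -mulrDr (mulrCA K) -[in RHS]mulrA (mulrA (a n)^-1) mulVf ?mul1r//.
  by rewrite gt_eqF.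
rewrite E' in h4.
have -> : \int[P]_w f (x + (\sum_(k < m n) X k w) / Num.sqrt (a n)) =
          \int[P]_w f (x + \sum_(k < m n) Y n k w).
  by apply: eq_Rintegral => w _; rewrite mulr_suml.
exact: dist_half (le_trans h4 h1) (le_trans h3 h2).
Unshelve. all: by end_near. Qed.

(** Induction on J: half of e pays for exchanging the last summand for its Gaussian limit at every
    frozen value of the others, the other half for the induction hypothesis at the Gaussian average
    of f. *)
Lemma clt_sum (Y : nat -> nat -> T -> R) (s : nat -> R) (J : nat) :
  (forall j n, measurable_fun setT (Y j n)) ->
  (forall j, 0 <= s j) ->
  (forall j, (j < J)%N -> gaussian_limit (Y j) (s j)) ->
  (forall j n, (j < J)%N -> indep2 P (fun w => \sum_(i < j) Y i n w) (Y j n)) ->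
  gaussian_limit (fun n w => \sum_(j < J) Y j n w) (\sum_(j < J) s j).
Proof.
move=> mY s0; elim: J => [|J IH] gY iY K f f1 f2 tf e e0.
  have [f0 l0 _ _ _] := tf.
  apply: nearW => n x; rewrite big_ord0 (avg_gau0 _ l0).
  under eq_Rintegral do rewrite big_ord0 addr0.
  by rewrite Rint_cst subrr normr0 ltW.
have [f0 l0 _ _ _] := tf.
have {}IH := IH (fun j jJ => gY j (ltnW jJ)) (fun j n jJ => iY j n (ltnW jJ)).
have e2 : 0 < e / 2 by rewrite divr_gt0.
have tg := avg_taylor (gau (s J)) tf; have [g0 lg _ _ _] := tg.
have H1 := IH _ _ _ _ tg _ e2.
have H2 := gY J (ltnSn J) _ _ _ _ tf _ e2.
apply: filterS2 H1 H2 => n h1 h2 x.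
have {}h1 := h1 x.
have Sp : 0 <= \sum_(j < J) s j by apply: sumr_ge0 => j _; exact: s0.
rewrite (avg_gauD x (s0 J) Sp l0 f0) in h1.
have E : \sum_(j < J) s j + s J = \sum_(j < J.+1) s j by rewrite big_ord_recr.
rewrite E in h1.
have mS : measurable_fun setT (fun w => \sum_(j < J) Y j n w) by exact: measurable_sum.
under eq_Rintegral do rewrite big_ord_recr/= addrA.
have Aeq y : \int[distribution P (mfun_of (mY J n))]_z f (y + z) = \int[P]_w f (y + Y J n w).
  rewrite (law_Rint (V := mfun_of (mY J n)) (g := fun z => f (y + z)))//.
    exact: (shift_measurable _ (lipb_measurable l0)).
  apply: (@bounded_integrable _ _ _ _ _ K); last by move=> w; exact: l0.1.
  exact: (measurableT_comp (shift_measurable _ (lipb_measurable l0))).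
rewrite (@indep2_avg _ _ _ P (mfun_of mS) (mfun_of (mY J n)) f K x)//; last 3 first.
- exact: iY.
- exact: lipb_measurable l0.
- exact: l0.1.
have mU : measurable_fun setT (fun w => x + \sum_(k < J) Y k n w) by exact: measurable_funD.
have bd (h : R -> R) (mh : lipb K h) : P.-integrable setT (EFin \o (fun w => h (x + \sum_(j < J) Y j n w))).
  apply: (@bounded_integrable _ _ _ _ _ K); last by move=> w; exact: mh.1.
  exact: (measurableT_comp (lipb_measurable mh)).
pose A y := \int[P]_w f (y + Y J n w).
have la : lipb K A.
  rewrite (_ : A = avg (distribution P (mfun_of (mY J n))) f); first exact: avg_lipb.
  by apply/funext => y; rewrite avgE Aeq.
have h3 : `|\int[P]_w A (x + \sum_(j < J) Y j n w) -
    \int[P]_w avg (gau (s J)) f (x + \sum_(j < J) Y j n w)| <= e / 2.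
  rewrite -RintegralB//; try exact: bd.
  apply: Rint_le_cst.
    apply: measurable_funB.
      exact: (measurableT_comp (lipb_measurable la)).
    exact: (measurableT_comp (lipb_measurable lg)).
  by move=> w; exact: h2.
under eq_Rintegral do rewrite Aeq.
rewrite -/(A _).
exact: dist_half h3 h1.
Qed.

End clt.

(** * Smooth test functions *)

Section test_functions.
Context (R : realType).
Implicit Types (K : R) (g : R -> R).

(** Locating c by its distance to x treats both signs of y at once and is the form needed for powers
    of |y|. *)
Lemma mvt_norm g g' (x y : R) : (forall z, is_derive z (1 : R) g (g' z)) ->
  exists2 c, `|c - x| <= `|y| & g (x + y) - g x = g' c * y.
Proof.
move=> dg.
have cg : continuous g.
  by move=> z; apply/differentiable_continuous/derivable1_diffP; case: (dg z).
have [y0|y0] := leP 0 y.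
  have xy : x <= x + y by rewrite lerDl.
  have [c + ->] := MVT_segment xy (fun z _ => dg z) (continuous_subspaceT cg).
  rewrite in_itv/= => /andP[c1 c2]; exists c; last by rewrite addrC addKr.
  by rewrite ger0_norm ?subr_ge0// ger0_norm// lerBlDl.
have xy : x + y <= x by rewrite gerDl ltW.
have [c + h] := MVT_segment xy (fun z _ => dg z) (continuous_subspaceT cg).
rewrite in_itv/= => /andP[c1 c2]; exists c.
  by rewrite ler0_norm ?subr_le0// ltr0_norm// opprB lerBlDl -lerBlDr opprK.
by rewrite -opprB h; ring.
Qed.

Lemma mvt_bound g g' (x y K : R) : (forall z, is_derive z (1 : R) g (g' z)) ->
  (forall z, `|g' z| <= K) -> `|g (x + y) - g x| <= K * `|y|.
Proof.
move=> dg gK; have [c _ ->] := mvt_norm x y dg.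
by rewrite normrM ler_wpM2r.
Qed.

(** One integration of a bound: the power rises by one and the constant stays the same. *)
Lemma mvt_power (p p' : R -> R) K n y : (forall z, is_derive z (1 : R) p (p' z)) ->
  p 0 = 0 -> 0 <= K -> (forall z, `|p' z| <= K * `|z| ^+ n) ->
  `|p y| <= K * `|y| ^+ n.+1.
Proof.
move=> dp p0 K0 pK; have [c] := mvt_norm 0 y dp.
rewrite subr0 add0r p0 subr0 => cy ->.
rewrite normrM exprSr mulrA ler_wpM2r//; apply: (le_trans (pK c)).
by rewrite ler_wpM2l// lerXn2r// nnegrE.
Qed.

(** The cubic bound integrates the bound on g3 three times. The quadratic bound expands to first
    order only and pays K y ^+ 2 / 2 for the omitted term; with the remainder K y ^+ 2 this stays
    below 2 K y ^+ 2. *)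
Lemma taylor_derive (g0 g1 g2 g3 : R -> R) K :
  (forall x, is_derive x (1 : R) g0 (g1 x)) ->
  (forall x, is_derive x (1 : R) g1 (g2 x)) ->
  (forall x, is_derive x (1 : R) g2 (g3 x)) ->
  (forall x, 0 <= g0 x) ->
  (forall x, [/\ `|g0 x| <= K, `|g1 x| <= K, `|g2 x| <= K & `|g3 x| <= K]) ->
  taylor (2 * K) g0 g1 g2.
Proof.
move=> d0 d1 d2 g00 gK.
have K0 : 0 <= K by have [h _ _ _] := gK 0; apply: le_trans h.
have K2 : K <= 2 * K by rewrite mulr_natl mulr2n lerDl.
have L (g g' : R -> R) : (forall x, is_derive x (1 : R) g (g' x)) ->
    (forall x, `|g x| <= K) -> (forall x, `|g' x| <= K) -> lipb (2 * K) g.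
  move=> dg h h'; split=> [x|x y]; first exact: le_trans (h x) K2.
  have := mvt_bound y (x - y) dg h'; rewrite (addrC y) subrK => /le_trans; apply.
  by rewrite ler_wpM2r.
split => //.
- by apply: (L _ _ d0) => x; have [] := gK x.
- by apply: (L _ _ d1) => x; have [] := gK x.
- by apply: (L _ _ d2) => x; have [] := gK x.
move=> x y.
have sh (g g' : R -> R) : (forall z, is_derive z (1 : R) g (g' z)) ->
    forall z, is_derive z (1 : R) (fun z => g (x + z)) (g' (x + z)).
  move=> dg z.
  have dxz : is_derive z (1 : R) (fun z => x + z) 1.
    rewrite (_ : (fun z => x + z) = cst x + id)//; apply: is_derive_eq.
    by rewrite add0r.
  by have := @is_derive1_comp _ g (fun z => x + z) z _ _ (dg _) dxz; rewrite mulr1.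
have lin (c : R) z : is_derive z (1 : R) (fun z : R => z * c) c.
  rewrite (_ : (fun z => z * c) = c \*: id); last by apply/funext => u; rewrite /GRing.scale/= mulrC.
  by apply: is_derive_eq; rewrite /GRing.scale/= mulr1.
have quad (c : R) z : is_derive z (1 : R) (fun z : R => z ^+ 2 / 2 * c) (z * c).
  rewrite (_ : (fun z => z ^+ 2 / 2 * c) = (2^-1 * c) \*: (@idfun R ^+ 2)); last first.
    by apply/funext => u; rewrite -[RHS]/((2^-1 * c) * u ^+ 2); ring.
  apply: is_derive_eq; rewrite /GRing.scale/= mulr1 expr1.
  by field.
have r2 z : `|g2 (x + z) - g2 x| <= K * `|z| ^+ 1.
  by rewrite expr1; apply: (mvt_bound _ _ d2) => u; have [] := gK u.
have D1 z : is_derive z (1 : R) (fun z => g1 (x + z) - g1 x - z * g2 x) (g2 (x + z) - g2 x).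
  rewrite (_ : (fun _ => _) = (fun z => g1 (x + z)) - cst (g1 x) - (fun z => z * g2 x))//.
  have h1 := sh _ _ d1 z; have h2 := lin (g2 x) z.
  by apply: is_derive_eq; rewrite subr0.
have r1 z : `|g1 (x + z) - g1 x - z * g2 x| <= K * `|z| ^+ 2.
  apply: (mvt_power z D1) => //.
  by rewrite addr0 subrr mul0r subr0.
have D0 z : is_derive z (1 : R) (fun z => g0 (x + z) - g0 x - z * g1 x - z ^+ 2 / 2 * g2 x)
    (g1 (x + z) - g1 x - z * g2 x).
  rewrite (_ : (fun _ => _) = (fun z => g0 (x + z)) - cst (g0 x) - (fun z => z * g1 x) -
    (fun z => z ^+ 2 / 2 * g2 x))//.
  have h1 := sh _ _ d0 z; have h2 := lin (g1 x) z; have h3 := quad (g2 x) z.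
  by apply: is_derive_eq; rewrite subr0.
have r0 : `|g0 (x + y) - g0 x - y * g1 x - y ^+ 2 / 2 * g2 x| <= K * `|y| ^+ 3.
  apply: (mvt_power y D0) => //.
  by rewrite addr0 subrr mul0r subr0 expr0n/= mul0r mul0r subr0.
have q1 z : `|g1 (x + z) - g1 x| <= K * `|z| ^+ 1.
  by rewrite expr1; apply: (mvt_bound _ _ d1) => u; have [] := gK u.
have D q0 : is_derive q0 (1 : R) (fun z => g0 (x + z) - g0 x - z * g1 x) (g1 (x + q0) - g1 x).
  rewrite (_ : (fun _ => _) = (fun z => g0 (x + z)) - cst (g0 x) - (fun z => z * g1 x))//.
  have h1 := sh _ _ d0 q0; have h2 := lin (g1 x) q0.
  by apply: is_derive_eq; rewrite subr0.
have q0 : `|g0 (x + y) - g0 x - y * g1 x| <= K * `|y| ^+ 2.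
  apply: (mvt_power y D) => //.
  by rewrite addr0 subrr mul0r subr0.
rewrite minr_pMr ?mulr_ge0// le_min; apply/andP; split; last first.
  by apply: (le_trans r0); rewrite ler_wpM2r// exprn_ge0.
apply: (le_trans (ler_normB _ _)).
have g2x : `|g2 x| <= K by have [] := gK x.
rewrite normrM ger0_norm ?divr_ge0 ?sqr_ge0//.
rewrite real_normK ?num_real// in q0.
have := ler_wpM2l (sqr_ge0 y) g2x; have := mulr_ge0 K0 (sqr_ge0 y); lra.
Qed.

(** A smooth descending step at b. It solves L' = k (L ^+ 2 - L), so all its derivatives are
    polynomials in L and are bounded because L lies between 0 and 1. *)
Definition logistic (k b x : R) : R := (1 + expR (k * (x - b)))^-1.

Lemma logistic_bounds k b x : 0 < logistic k b x < 1.
Proof.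
have e0 := expR_gt0 (k * (x - b)); rewrite /logistic.
have h : 0 < 1 + expR (k * (x - b)) by rewrite addr_gt0.
by rewrite invr_gt0 h invf_lt1// ltrDl e0.
Qed.

Definition logistic1 (k b x : R) : R := k * (logistic k b x ^+ 2 - logistic k b x).

Definition logistic2 (k b x : R) : R :=
  k ^+ 2 * ((2 * logistic k b x - 1) * (logistic k b x ^+ 2 - logistic k b x)).

Definition logistic3 (k b x : R) : R :=
  k ^+ 3 * ((2 * (logistic k b x ^+ 2 - logistic k b x) + (2 * logistic k b x - 1) ^+ 2) *
    (logistic k b x ^+ 2 - logistic k b x)).

Lemma is_derive_logistic k b x : is_derive x (1 : R) (logistic k b) (logistic1 k b x).
Proof.
have d1 : is_derive x (1 : R) (fun x => k * (x - b)) k.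
  rewrite (_ : (fun _ => _) = k \*: (id - cst b))//.
  by apply: is_derive_eq; rewrite subr0 /GRing.scale/= mulr1.
have d2 := @is_derive1_comp _ expR (fun x => k * (x - b)) x _ _ (is_derive_expR _) d1.
have d3 : is_derive x (1 : R) (fun x => 1 + expR (k * (x - b))) (expR (k * (x - b)) * k).
  rewrite (_ : (fun _ => _) = cst 1 + (expR \o (fun x => k * (x - b))))//.
  by apply: is_derive_eq; rewrite add0r.
have e0 : 1 + expR (k * (x - b)) != 0 by rewrite gt_eqF// addr_gt0// expR_gt0.
have d4 := is_deriveV (f := fun x => 1 + expR (k * (x - b))) e0 d3.
apply: (is_derive_eq d4); rewrite /logistic1 /logistic.
rewrite /GRing.scale/=; field.
by rewrite addrC.
Qed.

Lemma logistic_taylor_bounds k b x : 1 <= k ->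
  [/\ `|logistic k b x| <= 2 * k ^+ 3, `|logistic1 k b x| <= 2 * k ^+ 3,
      `|logistic2 k b x| <= 2 * k ^+ 3 & `|logistic3 k b x| <= 2 * k ^+ 3].
Proof.
rewrite /logistic1 /logistic2 /logistic3.
have /andP[] := logistic_bounds k b x; move: (logistic k b x) => L L0 L1 k1.
have k0 : 0 <= k by apply: le_trans k1.
have k3 n : (n <= 3)%N -> k ^+ n <= k ^+ 3 by move=> n3; exact: ler_weXn2l.
have k30 : 0 <= k ^+ 3 by rewrite exprn_ge0.
have B c n : (n <= 3)%N -> `|c| <= 2 -> `|k ^+ n * c| <= 2 * k ^+ 3.
  move=> n3 c2; rewrite normrM ger0_norm ?exprn_ge0// mulrC.
  by apply: ler_pM => //; [exact: exprn_ge0|exact: k3].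
have q : `|L ^+ 2 - L| <= 1 by rewrite ler_norml; apply/andP; split; nra.
have l : `|2 * L - 1| <= 1 by rewrite ler_norml; apply/andP; split; lra.
have f : `|2 * (L ^+ 2 - L) + (2 * L - 1) ^+ 2| <= 2.
  by rewrite ler_norml; apply/andP; split; nra.
split.
- rewrite -[L]mul1r -(expr0 k); apply: B => //.
  by rewrite gtr0_norm//; lra.
- by rewrite -{1}(expr1 k); apply: B => //; apply: le_trans q _; lra.
- apply: B => //; rewrite normrM -[leRHS]mulr1; apply: ler_pM => //.
  by apply: le_trans l _; lra.
- apply: B => //; rewrite normrM -[leRHS]mulr1; exact: ler_pM.
Qed.

Let is_derive_logistic1 k b x : is_derive x (1 : R) (logistic1 k b) (logistic2 k b x).
Proof.
have dL := is_derive_logistic k b x.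
rewrite (_ : logistic1 k b = k \*: (logistic k b ^+ 2 - logistic k b))//.
apply: is_derive_eq; rewrite /logistic2 /GRing.scale/= expr1 /logistic1.
by ring.
Qed.

Let is_derive_logistic2 k b x : is_derive x (1 : R) (logistic2 k b) (logistic3 k b x).
Proof.
have dL := is_derive_logistic k b x.
rewrite (_ : logistic2 k b = (k ^+ 2) \*: ((2 \*: logistic k b - cst 1) * (logistic k b ^+ 2 - logistic k b)))//.
apply: is_derive_eq.
rewrite -[(2 \*: logistic k b - cst 1) x]/(2 * logistic k b x - 1).
rewrite -[(logistic k b ^+ 2 - logistic k b) x]/(logistic k b x ^+ 2 - logistic k b x).
rewrite /logistic3 /GRing.scale/= expr1 /logistic1.
by ring.
Qed.

Lemma logistic_anti k b c x : 0 <= k -> c <= b -> logistic k c x <= logistic k b x.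
Proof.
move=> k0 cb; rewrite /logistic lef_pV2 ?posrE ?addr_gt0 ?expR_gt0//.
by rewrite lerD2l ler_expR ler_wpM2l// lerD2l lerN2.
Qed.

(* Tends to the indicator of [-b, b] as [k] grows. *)
Definition bump k b x := logistic k b x - logistic k (- b) x.

Lemma bump_taylor k b : 1 <= k -> 0 <= b ->
  exists K f1 f2, taylor K (bump k b) f1 f2.
Proof.
(* Each of the two steps contributes 2 * k ^+ 3; the outer factor is the one in [taylor_derive]. *)
move=> k1 b0; exists (2 * (4 * k ^+ 3)).
have k0 : 0 <= k by apply: le_trans k1.
have D (f f' g g' : R -> R) : (forall x, is_derive x (1 : R) f (f' x)) ->
    (forall x, is_derive x (1 : R) g (g' x)) ->
    forall x, is_derive x (1 : R) (fun x => f x - g x) (f' x - g' x).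
  by move=> df dg x; have := is_deriveB (df x) (dg x).
exists (fun x => logistic1 k b x - logistic1 k (- b) x).
exists (fun x => logistic2 k b x - logistic2 k (- b) x).
have d0 := D _ _ _ _ (is_derive_logistic k b) (is_derive_logistic k (- b)).
have d1 := D _ _ _ _ (is_derive_logistic1 k b) (is_derive_logistic1 k (- b)).
have d2 := D _ _ _ _ (is_derive_logistic2 k b) (is_derive_logistic2 k (- b)).
apply: (taylor_derive d0 d1 d2) => x.
  by rewrite subr_ge0 logistic_anti// ge0_cp.
have [h0 h1 h2 h3] := logistic_taylor_bounds b x k1.
have [i0 i1 i2 i3] := logistic_taylor_bounds (- b) x k1.
have S (u v w : R) : `|u| <= 2 * w -> `|v| <= 2 * w -> `|u - v| <= 4 * w.
  move=> hu hv; apply: le_trans (ler_normB _ _) _.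
  by apply: le_trans (lerD hu hv) _; rewrite -mulrDl -natrD.
by split; apply: S.
Qed.

Lemma bump_sandwich r dl e : 0 <= r -> 0 < dl -> 0 < e ->
  exists k, 1 <= k /\ forall x,
  (`|x| <= r -> 1 <= bump k (r + dl) x + e) /\
  (bump k (r + dl) x <= 1) /\
  (r + 2 * dl <= `|x| -> bump k (r + dl) x <= e).
Proof.
(* The steps sit at distance dl from both radii, where each is within expR (- (k * dl)) of 0 or 1.
   With k * dl >= 2 / e this is at most e / 2, as expR y >= 1 + y. *)
move=> r0 d0 e0; pose k := Num.max 1 (2 / (e * dl)).
have k1 : 1 <= k by rewrite le_max lexx.
have kp : 0 < k by apply: lt_le_trans k1.
exists k; split => // x.
pose E := expR (- (k * dl)).
have Ee : 2 * E <= e.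
  rewrite /E expRN -ler_pdivlMl// -[leRHS]invrK lef_pV2 ?posrE ?expR_gt0 ?invr_gt0 ?mulr_gt0//.
  apply: le_trans _ (expR_ge1Dx _).
  have : 2 / (e * dl) <= k by rewrite le_max lexx orbT.
  rewrite ler_pdivrMr ?mulr_gt0// => h.
  rewrite invfM invrK ler_pdivrMr//; lra.
have E0 : 0 < E := expR_gt0 _.
have up b : b + dl <= x -> logistic k b x <= E.
  move=> bx; rewrite /logistic /E expRN lef_pV2 ?posrE ?addr_gt0 ?expR_gt0//.
  apply: (@le_trans _ _ (expR (k * (x - b)))).
    by rewrite ler_expR ler_wpM2l ?(ltW kp)// lerBrDl.
  by rewrite lerDr.
have dn b : x <= b - dl -> 1 - E <= logistic k b x.
  move=> bx; rewrite /logistic; have h : expR (k * (x - b)) <= E.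
    rewrite /E ler_expR -mulrN ler_wpM2l ?(ltW kp)//; lra.
  have h0 := expR_gt0 (k * (x - b)).
  rewrite -[leRHS]mul1r ler_pdivlMr ?addr_gt0//.
  nra.
have /andP[a0 a1] := logistic_bounds k (r + dl) x.
have /andP[c0 c1] := logistic_bounds k (- (r + dl)) x.
rewrite /bump; split; [|split].
- rewrite ler_norml => /andP[x1 x2].
  have h1 := dn (r + dl); have h2 := up (- (r + dl)).
  have {}h1 : 1 - E <= logistic k (r + dl) x by apply: h1; lra.
  have {}h2 : logistic k (- (r + dl)) x <= E by apply: h2; lra.
  lra.
- lra.
- rewrite lter_normr => /orP[x1|x1].
    have h1 : logistic k (r + dl) x <= E by apply: up; lra.
    lra.
  have h1 : 1 - E <= logistic k (- (r + dl)) x by apply: dn; lra.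
  lra.
Qed.

End test_functions.

(** * From smooth test functions to probabilities of balls *)

Section sandwich.
Context (R : realType).

Lemma Rint_indic d (T : measurableType d) (P : probability T R) A : measurable A ->
  \int[P]_x \1_A x = fine (P A).
Proof. by move=> mA; rewrite /Rintegral integral_indic// setIT. Qed.

Lemma measurable_ball d (T : measurableType d) (V : T -> R) (r : R) :
  measurable_fun setT V -> measurable [set w | `|V w| <= r].
Proof.
move=> mV; rewrite -[X in measurable X]setTI.
by apply: measurable_fun_le => //; exact: measurableT_comp.
Qed.

Lemma prob_le_bump d (T : measurableType d) (P : probability T R) (V : T -> R) f
  (r r' e K : R) : measurable_fun setT V -> lipb K f ->
  (forall x, `|x| <= r -> 1 <= f x + e) -> (forall x, f x <= 1) ->
  (forall x, 0 <= f x) -> 0 <= e ->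
  (forall x, r' <= `|x| -> f x <= e) ->
  fine (P [set w | `|V w| <= r]) <= \int[P]_w f (V w) + e /\
  \int[P]_w f (V w) <= fine (P [set w | `|V w| <= r']) + e.
Proof.
move=> mV lf f1 fle1 f0 e0 f2.
have mf := lipb_measurable lf.
have mfV : measurable_fun setT (fun w => f (V w)) by exact: (measurableT_comp mf).
have ifV : P.-integrable setT (EFin \o (fun w => f (V w))).
  by apply: (@bounded_integrable _ _ _ _ _ K) => // w; exact: lf.1.
have ic (c : R) : P.-integrable setT (EFin \o (fun _ : T => c)) := finite_measure_integrable_cst P c measurableT.
have iD (g h : T -> R) : P.-integrable setT (EFin \o g) -> P.-integrable setT (EFin \o h) ->
    P.-integrable setT (EFin \o (fun w => g w + h w)).
  by move=> ig ih; have := integrableD measurableT ig ih; apply: eq_integrable.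
have iI A : measurable A -> P.-integrable setT (EFin \o (\1_A : T -> R)).
  move=> mA; apply: (@bounded_integrable _ _ _ _ _ 1); first exact: measurable_indic.
  by move=> w; rewrite indicE; case: (_ \in _); rewrite ?normr1 ?normr0.
have mB s := measurable_ball s mV.
rewrite -!Rint_indic//; split.
  rewrite -[X in _ <= _ + X](Rint_cst P) -RintegralD//.
  apply: le_Rintegral => //; [exact: iI|exact: iD|].
  move=> w _; rewrite indicE; case: (boolP (w \in _)) => [|_]; last by rewrite addr_ge0.
  by rewrite inE/= => /f1.
rewrite -[X in _ <= _ + X](Rint_cst P) -RintegralD//; try exact: iI.
apply: le_Rintegral => //; first by apply: iD => //; exact: iI.
move=> w _; rewrite indicE; case: (boolP (w \in _)) => [_|].
  by rewrite (le_trans (fle1 _))// lerDl.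
rewrite notin_setE/= => /negP; rewrite -ltNge => /ltW /f2 h.
by rewrite add0r.
Qed.

(** Up to small errors a bump lies between the indicators of the two balls. The slack 2 * dl in the
    radius absorbs the smoothing; continuity of the limit enters only later, through the
    distribution function. *)
Lemma gaussian_limit_ball d (T : measurableType d) (P : probability T R)
    (U : nat -> T -> R) (s r dl e : R) :
  (forall n, measurable_fun setT (U n)) -> gaussian_limit P U s ->
  0 <= r -> 0 < dl -> 0 < e -> \forall n \near \oo,
  fine (P [set w | `|U n w| <= r]) <=
    fine (normal_prob 0 1 [set u : R | `|Num.sqrt s * u| <= r + 2 * dl]) + e /\
  fine (normal_prob 0 1 [set u : R | `|Num.sqrt s * u| <= r]) <=
    fine (P [set w | `|U n w| <= r + 2 * dl]) + e.
Proof.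
(* One third for the bump under each of the two laws, one for the convergence in law. *)
move=> mU gU r0 d0 e0; have e3 : 0 < e / 3 by rewrite divr_gt0.
have [k [k1 bs]] := bump_sandwich r0 d0 e3.
have b0 : 0 <= r + dl by rewrite addr_ge0// ltW.
have [K [f1 [f2 tb]]] := bump_taylor k1 b0.
have [p0 lp _ _ _] := tb.
have b1 x := (bs x).1; have b2 x := (bs x).2.1; have b3 x := (bs x).2.2.
have mN : measurable_fun setT (fun u : measurableTypeR R => Num.sqrt s * u : R).
  exact: mulrl_measurable.
have [n1 n2] := prob_le_bump (normal_prob 0 1) mN lp b1 b2 p0 (ltW e3) b3.
apply: filterS (gU _ _ _ _ tb _ e3) => n /(_ 0).
rewrite (avg_gau_mu _ _ lp).
under eq_Rintegral do rewrite add0r.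
under [X in _ - X]eq_Rintegral do rewrite add0r.
rewrite ler_norml => /andP[h1 h2].
have [m1 m2] := prob_le_bump P (mU n) lp b1 b2 p0 (ltW e3) b3.
move: n1 n2 h1 h2 m1 m2.
set A := \int[_]_x _; set B := \int[P]_x _.
move: A B (fine _) (fine _) (fine _) (fine _) => A B a1 a2 a3 a4.
by clear => *; split; lra.
Qed.

End sandwich.

(** * Stochastic order symbols *)

Section in_probability.
Context d (T : measurableType d) (R : realType) (P : probability T R).
Implicit Types X Y : nat -> T -> R.

Definition big_event X (e : R) n := [set w | e < `|X n w|].

(* [op] and [Op] are o_P(1) and O_P(1). *)
Definition op X := (forall n, measurable_fun setT (X n)) /\
  forall e, 0 < e -> forall r, 0 < r -> \forall n \near \oo, fine (P (big_event X e n)) <= r.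

Definition Op X := (forall n, measurable_fun setT (X n)) /\
  forall r, 0 < r -> exists2 K, 0 < K & \forall n \near \oo, fine (P (big_event X K n)) <= r.

Lemma measurable_big X e n : (forall n, measurable_fun setT (X n)) ->
  measurable (big_event X e n).
Proof.
move=> mX; rewrite (_ : big_event X e n = ~` [set w | `|X n w| <= e]).
  by apply: measurableC; exact: measurable_ball.
by apply/seteqP; split => w; rewrite /big_event/= ltNge => /negP.
Qed.

Lemma fineP_le A B : measurable A -> measurable B -> A `<=` B -> fine (P A) <= fine (P B).
Proof.
by move=> mA mB AB; apply: fine_le; rewrite ?fin_num_measure// le_measure ?inE.
Qed.

Lemma fineP_leU A B C : measurable A -> measurable B -> measurable C ->
  A `<=` B `|` C -> fine (P A) <= fine (P B) + fine (P C).
Proof.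
move=> mA mB mC AB; rewrite -fineD ?fin_num_measure//.
apply: fine_le; rewrite ?fin_num_measure//.
  by rewrite fin_numD !fin_num_measure.
apply: (@le_trans _ _ (P (B `|` C))).
  by apply: le_measure; rewrite ?inE//; exact: measurableU.
exact: measureU2.
Qed.

(** Reduces a rule for o_P to an inclusion of events; each event on the right receives half of the
    probability budget. *)
Lemma opP_sub X Y Z : (forall n, measurable_fun setT (Z n)) -> op X -> op Y ->
  (forall e, 0 < e -> exists dl, 0 < dl /\ forall n, big_event Z e n `<=` big_event X dl n `|` big_event Y dl n) ->
  op Z.
Proof.
move=> mZ [mX oX] [mY oY] sub; split=> // e e0 r r0.
have [dl [d0 s]] := sub e e0.
have r2 : 0 < r / 2 by rewrite divr_gt0.
apply: filterS2 (oX _ d0 _ r2) (oY _ d0 _ r2) => n h1 h2.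
rewrite (splitr r); apply: le_trans (lerD h1 h2).
by apply: fineP_leU; [exact: measurable_big..|exact: s].
Qed.

Lemma op_add X Y : op X -> op Y -> op (fun n w => X n w + Y n w).
Proof.
move=> oX oY; apply: (opP_sub _ oX oY).
  by move=> n; apply: measurable_funD; [exact: oX.1|exact: oY.1].
move=> e e0; exists (e / 2); split; first by rewrite divr_gt0.
move=> n w; rewrite /big_event/= => h.
have [h1|h1] := ltP (e / 2) `|X n w|; first by left.
have [h2|h2] := ltP (e / 2) `|Y n w|; first by right.
have := ler_normD (X n w) (Y n w); lra.
Qed.

Lemma op_Op X : op X -> Op X.
Proof.
move=> [mX oX]; split=> // r r0; exists 1 => //; exact: oX.
Qed.

Lemma Op_sub X Y Z : (forall n, measurable_fun setT (Z n)) -> Op X -> Op Y ->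
  (forall K, 0 < K -> exists2 L, 0 < L & forall n, big_event Z L n `<=` big_event X K n `|` big_event Y K n) ->
  Op Z.
Proof.
move=> mZ [mX oX] [mY oY] sub; split=> // r r0.
have r2 : 0 < r / 2 by rewrite divr_gt0.
have [K1 K10 h1] := oX _ r2; have [K2 K20 h2] := oY _ r2.
have K0 : 0 < Num.max K1 K2 by rewrite lt_max K10.
have [L L0 s] := sub _ K0; exists L => //.
apply: filterS2 h1 h2 => n h1 h2.
rewrite (splitr r); apply: le_trans (lerD h1 h2).
apply: fineP_leU; [exact: measurable_big..|].
move=> w /s[]; rewrite /big_event/= gt_max => /andP[? ?]; by [left|right].
Qed.

Lemma Op_add X Y : Op X -> Op Y -> Op (fun n w => X n w + Y n w).
Proof.
move=> oX oY; apply: (Op_sub _ oX oY).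
  by move=> n; apply: measurable_funD; [exact: oX.1|exact: oY.1].
move=> K K0; exists (2 * K); first by rewrite mulr_gt0.
move=> n w; rewrite /big_event/= => h.
have [h1|h1] := ltP K `|X n w|; first by left.
have [h2|h2] := ltP K `|Y n w|; first by right.
have := ler_normD (X n w) (Y n w); lra.
Qed.

Lemma Op_mul X Y : Op X -> Op Y -> Op (fun n w => X n w * Y n w).
Proof.
move=> oX oY; apply: (Op_sub _ oX oY).
  by move=> n; apply: measurable_funM; [exact: oX.1|exact: oY.1].
move=> K K0; exists (K * K); first by rewrite mulr_gt0.
move=> n w; rewrite /big_event/= normrM => h.
have [h1|h1] := ltP K `|X n w|; first by left.
have [h2|h2] := ltP K `|Y n w|; first by right.
have := ler_pM (normr_ge0 _) (normr_ge0 _) h1 h2; lra.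
Qed.

(** The bound K on Y depends on the budget r, while the threshold in [opP_sub] may depend on e only;
    hence the direct argument. *)
Lemma op_mulO X Y : op X -> Op Y -> op (fun n w => X n w * Y n w).
Proof.
move=> [mX oX] [mY oY]; split.
  by move=> n; exact: measurable_funM.
move=> e e0 r r0.
have r2 : 0 < r / 2 by rewrite divr_gt0.
have [K K0 hY] := oY _ r2.
have eK : 0 < e / K by rewrite divr_gt0.
apply: filterS2 (oX _ eK _ r2) hY => n h1 h2.
rewrite (splitr r); apply: le_trans (lerD h1 h2).
apply: fineP_leU; [|exact: measurable_big..|].
  by apply: measurable_big => k; exact: measurable_funM.
move=> w; rewrite /big_event/= normrM => h.
have [x1|x1] := ltP (e / K) `|X n w|; first by left.
have [x2|x2] := ltP K `|Y n w|; first by right.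
have := ler_pM (normr_ge0 _) (normr_ge0 _) x1 x2.
by rewrite divfK ?gt_eqF// leNgt h.
Qed.

Lemma cst_op (c : nat -> R) : c n @[n --> \oo] --> 0 -> op (fun n _ => c n).
Proof.
move=> c0; split=> // e e0 r r0; near=> n.
rewrite (_ : big_event _ _ _ = set0) ?measure0 ?(ltW r0)//.
apply/seteqP; split => // w; rewrite /big_event/= => h.
have : `|c n| <= e by near: n; move/cvgr0Pnorm_le : c0; exact.
by rewrite leNgt h.
Unshelve. all: by end_near. Qed.

Lemma cst_Op (c : nat -> R) (l : R) : c n @[n --> \oo] --> l -> Op (fun n _ => c n).
Proof.
move=> cl; split=> // r r0; exists (`|l| + 1); first by rewrite ltr_wpDl.
near=> n.
rewrite (_ : big_event _ _ _ = set0) ?measure0 ?(ltW r0)//.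
apply/seteqP; split => // w; rewrite /big_event/= => h.
have : `|l - c n| <= 1 by near: n; move/cvgrPdist_le : cl; exact.
have := lerB_dist (c n) l; rewrite distrC => h1 h2.
lra.
Unshelve. all: by end_near. Qed.

Lemma sqrt_inv_cvg0 (a : nat -> R) : (forall n, 0 < a n) -> a n @[n --> \oo] --> +oo ->
  (Num.sqrt (a n))^-1 @[n --> \oo] --> 0.
Proof.
move=> a0 ay; apply/gtr0_cvgV0; first by apply: nearW => n; rewrite sqrtr_gt0.
apply/cvgryPge => A; move/cvgryPge : ay => /(_ (A ^+ 2)); apply: filterS => n h.
by rewrite (le_trans (ler_norm A))// -sqrtr_sqr ler_sqrt// ltW.
Qed.

Definition cvgp X (c : R) := op (fun n w => X n w - c).

Lemma cvgp_measurable X c n : cvgp X c -> measurable_fun setT (X n).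
Proof.
move=> [mX _]; have := measurable_funD (mX n) (measurable_cst c).
by apply: eq_measurable_fun => w _ /=; rewrite subrK.
Qed.

Lemma eq_op X Y : (forall n w, X n w = Y n w) -> op X -> op Y.
Proof. by move=> XY; rewrite (_ : X = Y)//; apply/funext => n; apply/funext => w. Qed.

Lemma cvgp_Op X c : cvgp X c -> Op X.
Proof.
have hc : Op (fun _ _ => c) by apply: (@cst_Op (fun=> c) c); exact: cvg_cst.
move=> h; have := Op_add (op_Op h) hc.
by rewrite (_ : (fun n w => _) = X)//; apply/funext => n; apply/funext => w; rewrite subrK.
Qed.

Lemma cvgp_cst (c : R) : cvgp (fun _ _ => c) c.
Proof.
apply: (@eq_op (fun _ _ => 0)); first by move=> n w; rewrite subrr.
by apply: cst_op; exact: cvg_cst.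
Qed.

Lemma cvgp_add X Y a b : cvgp X a -> cvgp Y b -> cvgp (fun n w => X n w + Y n w) (a + b).
Proof.
move=> hX hY; apply: eq_op (op_add hX hY) => n w /=; ring.
Qed.

Lemma cvgp_mul X Y a b : cvgp X a -> cvgp Y b -> cvgp (fun n w => X n w * Y n w) (a * b).
Proof.
move=> hX hY.
have h1 := op_mulO hX (cvgp_Op hY).
have hc : Op (fun _ _ => a) by apply: (@cst_Op (fun=> a) a); exact: cvg_cst.
have h2 := op_mulO hY hc.
apply: eq_op (op_add h1 h2) => n w /=; ring.
Qed.

Lemma measurable_inv (f : T -> R) : measurable_fun setT f ->
  measurable_fun setT (fun w => (f w)^-1).
Proof.
move=> mf; have mI : measurable_fun setT (fun x : R => x^-1).
  rewrite -(setvU [set (0 : R)]); apply/measurable_funU => //; first exact: measurableC.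
  split; last exact: measurable_fun_set1.
  apply: open_continuous_measurable_fun.
    by apply: closed_openC; exact: closed_eq.
  by move=> x /set_mem /= /eqP; exact: inv_continuous.
exact: (measurableT_comp mI).
Qed.

Lemma cvgp_inv X a : a != 0 -> cvgp X a -> cvgp (fun n w => (X n w)^-1) a^-1.
Proof.
move=> a0 hX; have mX n := cvgp_measurable n hX.
apply: (opP_sub _ hX hX).
  by move=> n; apply: measurable_funB => //; exact: measurable_inv.
(* The first bound keeps |X| above |a| / 2; the second then makes |X - a| / (|X| |a|) at most e. *)
move=> e e0; pose dl := Num.min (`|a| / 2) (e * `|a| ^+ 2 / 2).
have na : 0 < `|a| by rewrite normr_gt0.
exists dl; split; first by rewrite lt_min !divr_gt0// mulr_gt0// exprn_gt0.
move=> n w; rewrite /big_event/= => h; left; rewrite ltNge; apply/negP => hd.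
move: hd; rewrite le_min => /andP[d1 d2].
have xa : `|a| / 2 <= `|X n w|.
  have := lerB_dist a (X n w); rewrite distrC; lra.
have x0 : X n w != 0 by rewrite -normr_gt0; apply: lt_le_trans xa; rewrite divr_gt0.
have E : (X n w)^-1 - a^-1 = - (X n w - a) / (X n w * a).
  by field; rewrite x0 a0.
move: h; rewrite E normrM normrN normfV normrM ltNge; apply/negP; rewrite negbK.
rewrite ler_pdivrMr ?mulr_gt0 ?normr_gt0//.
apply: (le_trans d2); rewrite expr2 mulrA -!mulrA ler_wpM2l ?(ltW e0)//.
rewrite mulrC -mulrA mulrC ler_wpM2r//; lra.
Qed.

Lemma chebyshev2 (X : T -> R) (e : R) : measurable_fun setT X ->
  P.-integrable setT (EFin \o (fun w => X w ^+ 2)) -> 0 < e ->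
  fine (P [set w | e < `|X w|]) <= (\int[P]_w (X w ^+ 2)) / e ^+ 2.
Proof.
move=> mX iX e0.
have mX2 : measurable_fun setT (fun w => X w ^+ 2) by exact: measurable_funX.
have e20 : 0 < e ^+ 2 by rewrite exprn_gt0.
have h := markovR mX2 iX (fun w => sqr_ge0 _) e20.
have mB : measurable [set w | e ^+ 2 <= X w ^+ 2].
  by rewrite -[X in measurable X]setTI; exact: measurable_fun_le.
apply: (@le_trans _ _ (fine (P [set w | e ^+ 2 <= X w ^+ 2]))).
  apply: fineP_le => //.
    exact: (@measurable_big (fun _ => X) e 0%N).
  move=> w /= ew; rewrite -[X in _ <= X]real_normK ?num_real//.
  by rewrite lerXn2r ?nnegrE ?(ltW e0)// ltW.
by rewrite -lee_fin fineK// fin_num_measure.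
Qed.

Lemma Op_second_moment X (c : R) : (forall n, measurable_fun setT (X n)) ->
  (forall n, P.-integrable setT (EFin \o (fun w => X n w ^+ 2))) ->
  (forall n, \int[P]_w (X n w ^+ 2) <= c) -> Op X.
Proof.
move=> mX iX Xc; split=> // r r0.
have c0 : 0 <= c by apply: le_trans (Xc 0%N); apply: Rintegral_ge0 => w _; exact: sqr_ge0.
(* Chebyshev gives c / K ^+ 2, which is at most r for this K; the 1 keeps K positive when c = 0. *)
pose K := Num.sqrt (c / r + 1).
have K0 : 0 < K by rewrite sqrtr_gt0 ltr_wpDl// divr_ge0// ltW.
exists K => //; apply: nearW => n.
apply: (le_trans (chebyshev2 (mX n) (iX n) K0)).
rewrite ler_pdivrMr ?exprn_gt0//; apply: (le_trans (Xc n)).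
rewrite /K sqr_sqrtr ?addr_ge0 ?divr_ge0 ?(ltW r0)//.
by rewrite mulrDr mulr1 mulrCA mulfV ?gt_eqF// mulr1 lerDl ltW.
Qed.

(** Truncating |X - c| at 1 supplies a dominating constant, so the means tend to 0 and Markov's
    inequality concludes. *)
Lemma as_cvgp X (c : R) : (forall n, measurable_fun setT (X n)) ->
  {ae P, forall w, X n w @[n --> \oo] --> c} -> cvgp X c.
Proof.
move=> mX Xc.
have mY n : measurable_fun setT (fun w => X n w - c) by exact: measurable_funB.
split=> // e e0 r r0.
pose g n w : R := Num.min 1 `|X n w - c|.
have mg n : measurable_fun setT (g n).
  by apply: measurable_minr => //; exact: measurableT_comp.
have g0 n w : 0 <= g n w by rewrite le_min ler01 normr_ge0.
have g1 n w : `|g n w| <= 1 by rewrite ger0_norm// ge_min lexx.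
have ig n : P.-integrable setT (EFin \o g n) by apply: (@bounded_integrable _ _ _ _ _ 1).
have h1 n : measurable_fun setT (EFin \o g n) by exact/measurable_EFinP.
have h2 : {ae P, forall w, setT w -> (EFin \o g n) w @[n --> \oo] --> 0%E}.
  apply: filterS Xc => w Xw _; apply/fine_cvgP; split; first exact: nearW.
  apply/cvgr0Pnorm_le => e1 e10; near=> n; rewrite /= ger0_norm// /g ge_min; apply/orP; right.
  by rewrite distrC; near: n; move/cvgrPdist_le : Xw; exact.
have h3 : {ae P, forall w n, setT w -> (`|(EFin \o g n) w| <= (cst 1%E) w)%E}.
  by apply: aeW => w n _; rewrite /= lee_fin.
have ic : P.-integrable setT (cst 1%E) := finite_measure_integrable_cst P 1 measurableT.
have [_ _] := dominated_convergence measurableT h1 (measurable_cst _) h2 ic h3.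
rewrite integral0; under eq_fun do rewrite RintE//.
move=> /fine_cvgP[_] /cvgr0Pnorm_le h.
(* The truncated variable never exceeds 1, so the threshold is truncated in the same way. *)
pose q := Num.min 1 e.
have q0 : 0 < q by rewrite lt_min ltr01.
have rq : 0 < r * q by rewrite mulr_gt0.
apply: filterS (h _ rq) => n /=; rewrite ger0_norm ?Rintegral_ge0// => hn.
have := markovR (mg n) (ig n) (g0 n) q0.
rewrite -[X in (X <= _)%E]fineK ?fin_num_measure// ?lee_fin; last first.
  by rewrite -[X in measurable X]setTI; exact: measurable_fun_le.
move=> hm; apply: (@le_trans _ _ (fine (P [set x | q <= g n x]))).
  apply: fineP_le; first exact: measurable_big.
    by rewrite -[X in measurable X]setTI; exact: measurable_fun_le.
  by move=> w; rewrite /big_event/= => ew; rewrite le_min !ge_min lexx/= (ltW ew) orbT.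
by apply: (le_trans hm); rewrite ler_pdivrMr.
Unshelve. all: by end_near. Qed.

End in_probability.

(** * Sums of independent variables *)

Section sums.
Context d (T : measurableType d) (R : realType) (P : probability T R).

Definition sigma_measurable (G : set (set T)) (f : T -> R) :=
  forall B : set R, measurable B -> gen_sigma G (f @^-1` B).

Lemma sigma_measurableP G (f : T -> R) :
  sigma_measurable G f <-> @measurable_fun _ _ (g_sigma_algebraType G) R setT f.
Proof.
split=> [h _ B mB|h B mB]; first by rewrite setTI; exact: h.
by have := h measurableT B mB; rewrite setTI.
Qed.

Lemma sigma_measurable_sum G I (s : seq I) (f : I -> T -> R) :
  (forall i, sigma_measurable G (f i)) ->
  sigma_measurable G (fun w => \sum_(i <- s) f i w).
Proof.
move=> h; apply/sigma_measurableP; apply: measurable_sum => i.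
exact/sigma_measurableP.
Qed.

(** Grouping of independent families. Intersections of one event per index of s form a pi-system on
    which independence from Y i0 is an instance of the hypothesis, and the sum is measurable for the
    sigma-algebra they generate. *)
Lemma indep_sum (I : eqType) (G : I -> set (set T)) (Y : I -> T -> R) (s : seq I) (i0 : I) :
  mutually_independent P G -> (forall i, gen_sigma (G i) `<=` measurable) ->
  (forall i, sigma_measurable (G i) (Y i)) -> uniq s -> i0 \notin s ->
  indep2 P (fun w => \sum_(i <- s) Y i w) (Y i0).
Proof.
move=> iG Gm GY us i0s A B mA mB.
have sI i C D : gen_sigma (G i) C -> gen_sigma (G i) D -> gen_sigma (G i) (C `&` D).
  exact: (@measurableI _ (g_sigma_algebraType (G i))).
have sT i : gen_sigma (G i) setT.
  exact: (@measurableT _ (g_sigma_algebraType (G i))).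
pose H : set (set T) := [set C | exists A : I -> set T,
   (forall i, i \in s -> gen_sigma (G i) (A i)) /\ C = \bigcap_(i in [set i | i \in s]) A i].
have HI : setI_closed H.
  move=> C D [A1 [h1 ->]] [A2 [h2 ->]]; exists (fun i => A1 i `&` A2 i); split.
    by move=> i si; apply: sI; [exact: h1|exact: h2].
  by rewrite bigcapI.
have HT : H setT.
  exists (fun=> setT); split; first by move=> i _; exact: sT.
  by apply/esym/bigcapT.
have Hm : H `<=` measurable.
  move=> C [A1 [h1 ->]]; apply: fin_bigcap_measurable; first exact: finite_seq.
  by move=> i /= si; apply: (Gm i); exact: h1.
have mE : measurable (Y i0 @^-1` B) by apply: (Gm i0); exact: GY.
have HE C : H C -> (P (C `&` Y i0 @^-1` B) = P C * P (Y i0 @^-1` B))%E.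
  move=> [A1 [h1 ->]].
  pose A2 i := if i == i0 then Y i0 @^-1` B else A1 i.
  have e1 : \bigcap_(i in [set i | i \in s]) A1 i `&` Y i0 @^-1` B =
            \bigcap_(i in [set i | i \in i0 :: s]) A2 i.
    apply/seteqP; split=> [w [h hB] i /=|w h].
      rewrite inE /A2; case: eqP => [->//|_ /= si]; exact: h.
    split; last by have := h i0; rewrite /A2 eqxx; apply; rewrite /= mem_head.
    move=> i /= si; have := h i; rewrite /A2; case: eqP => [ii0|_]; last first.
      by apply; rewrite /= inE si orbT.
    by rewrite -ii0 si in i0s.
  rewrite e1 iG/=; last 2 first.
  - by rewrite i0s.
  - move=> i; rewrite inE /A2; case: eqP => [->|_ /= si]; first by move=> _; exact: GY.
    exact: h1.
  rewrite big_cons {1}/A2 eqxx muleC; congr (_ * _)%E.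
  rewrite iG//; apply: eq_big_seq => i si; rewrite /A2; case: eqP => // ii0.
  by rewrite -ii0 si in i0s.
apply: (pi_indep HI HT Hm mE HE).
have : sigma_measurable H (fun w => \sum_(i <- s) Y i w).
  (* Summands outside s are set to 0, because [sigma_measurable_sum] asks for measurability at every
     index. *)
  rewrite (_ : (fun w => _) = (fun w => \sum_(i <- s) (if i \in s then Y i w else 0))); last first.
    by apply/funext => w; apply: eq_big_seq => i ->.
  apply: sigma_measurable_sum => i.
  case: (boolP (i \in s)) => si; last first.
    by apply/sigma_measurableP; exact: measurable_cst.
  move=> D mD; apply: sub_sigma_algebra.
  exists (fun j => if j == i then Y i @^-1` D else setT); split.
    by move=> j _; case: eqP => [->|_]; [exact: GY|exact: sT].
  apply/seteqP; split=> [w wD j /= _|w]; first by case: eqP.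
  by move/(_ i si); rewrite eqxx.
exact.
Qed.

Lemma integrable_sqr1 (f : T -> R) : measurable_fun setT f ->
  P.-integrable setT (EFin \o (fun w => f w ^+ 2)) -> P.-integrable setT (EFin \o f).
Proof.
move=> mf i2.
have i1 : P.-integrable setT (EFin \o (fun w => 1 + f w ^+ 2)).
  have := integrableD measurableT (finite_measure_integrable_cst P 1 measurableT) i2.
  exact: eq_integrable.
apply: integrable_le i1 => // w.
have := sqr_ge0 (`|f w| - 1); have := sqr_ge0 (f w).
rewrite sqrrB expr1n mulr1 -normrX (ger0_norm (sqr_ge0 _)) mulr2n; lra.
Qed.

(** Independence from the partial sum factors the cross term into a product of means, and the new
    mean is 0. *)
Lemma sum_variance (X : nat -> T -> R) (v : R) :
  (forall k, measurable_fun setT (X k)) ->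
  (forall n, indep2 P (fun w => \sum_(k < n) X k w) (X n)) ->
  (forall k, P.-integrable setT (EFin \o (fun w => X k w ^+ 2))) ->
  (forall k, \int[P]_w X k w = 0) -> (forall k, \int[P]_w (X k w ^+ 2) = v) ->
  forall n, P.-integrable setT (EFin \o (fun w => (\sum_(k < n) X k w) ^+ 2)) /\
  \int[P]_w ((\sum_(k < n) X k w) ^+ 2) = n%:R * v.
Proof.
move=> mX iX i2 m0 vE; elim=> [|n [IHi IHv]].
  split; last first.
    by under eq_Rintegral do rewrite big_ord0 expr0n/=; rewrite Rint_cst mul0r.
  rewrite (_ : _ \o _ = cst 0%E); first exact: integrable0.
  by apply/funext => w /=; rewrite big_ord0 expr0n.
have mS : measurable_fun setT (fun w => \sum_(k < n) X k w) by exact: measurable_sum.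
have iS := integrable_sqr1 mS IHi; have i1 := integrable_sqr1 (mX n) (i2 n).
have iM := @indep2_integrableM _ _ _ P (mfun_of mS) (mfun_of (mX n)) (iX n) iS i1.
have eM := @indep2_RintM _ _ _ P (mfun_of mS) (mfun_of (mX n)) (iX n) iS i1.
rewrite /= m0 mulr0 in eM.
have iD (g h : T -> R) : P.-integrable setT (EFin \o g) -> P.-integrable setT (EFin \o h) ->
    P.-integrable setT (EFin \o (fun w => g w + h w)).
  by move=> ig ih; have := integrableD measurableT ig ih; apply: eq_integrable.
have iZ (c : R) g : P.-integrable setT (EFin \o g) -> P.-integrable setT (EFin \o (fun w => c * g w)).
  by move=> ig; have := integrableZl measurableT c ig; apply: eq_integrable.
have E w : (\sum_(k < n.+1) X k w) ^+ 2 =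
    (\sum_(k < n) X k w) ^+ 2 + 2 * ((\sum_(k < n) X k w) * X n w) + X n w ^+ 2.
  by rewrite big_ord_recr/=; ring.
have iT := iD _ _ (iD _ _ IHi (iZ 2 _ iM)) (i2 n).
split.
  by apply: eq_integrable iT => // w _ /=; rewrite -E.
under eq_Rintegral do rewrite E.
rewrite RintegralD//; last exact: (iD _ _ IHi (iZ 2 _ iM)).
rewrite RintegralD//; last exact: iZ.
by rewrite RintegralZl// eM mulr0 addr0 IHv vE -natr1 mulrDl mul1r.
Qed.

Lemma measurable_random (N : T -> nat) (f : nat -> T -> R) :
  (forall A : set nat, measurable (N @^-1` A)) -> (forall q, measurable_fun setT (f q)) ->
  measurable_fun setT (fun w => f (N w) w).
Proof.
move=> mN mf _ B mB; rewrite setTI.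
rewrite (_ : _ @^-1` B = \bigcup_q (N @^-1` [set q] `&` f q @^-1` B)).
  apply: bigcup_measurable => q _; apply: measurableI; first exact: mN.
  by rewrite -[X in measurable X]setTI; exact: mf.
apply/seteqP; split=> [w /= wB|w [q _ [/= -> //]]].
by exists (N w).
Qed.

(* Chebyshev's inequality is applied on each event [N n = q] with [q] close to [m n]; there
   the difference is a sum of [`|q - m n|] terms which is independent of the event. *)
Lemma random_index (X : nat -> T -> R) (N : nat -> T -> nat) (m : nat -> nat)
    (a : nat -> R) (v lam : R) :
  (forall k, measurable_fun setT (X k)) ->
  (forall n (A : set nat), measurable (N n @^-1` A)) ->
  (forall p q (n k : nat) e, (p <= q)%N -> 
     (P ((N n @^-1` [set k]) `&` [set w | (e < `|\sum_(p <= k < q) X k w|)%R]) =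
      P (N n @^-1` [set k]) * P [set w | (e < `|\sum_(p <= k < q) X k w|)%R])%E) ->
  (forall p q, P.-integrable setT (EFin \o (fun w => (\sum_(p <= k < q) X k w) ^+ 2)) /\
     \int[P]_w ((\sum_(p <= k < q) X k w) ^+ 2) = (q - p)%:R * v) ->
  (forall n, 0 < a n) ->
  cvgp P (fun n w => (N n w)%:R / a n) lam -> (m n)%:R / a n @[n --> \oo] --> lam ->
  op P (fun n w => (\sum_(0 <= k < N n w) X k w - \sum_(0 <= k < m n) X k w) / Num.sqrt (a n)).
Proof.
move=> mX mN iN V a0 cN cm.
have mS p q : measurable_fun setT (fun w => \sum_(p <= k < q) X k w) by exact: measurable_sum.
have v0 : 0 <= v.
  have [_] := V 0%N 1%N; rewrite subn0 mul1r => <-.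
  by apply: Rintegral_ge0 => w _; exact: sqr_ge0.
have mZ n : measurable_fun setT (fun w => (\sum_(0 <= k < N n w) X k w - \sum_(0 <= k < m n) X k w) / Num.sqrt (a n)).
  apply: measurable_funM => //; apply: measurable_funB => //.
  by apply: (@measurable_random (N n) (fun q w => \sum_(0 <= k < q) X k w)).
split=> // e e0 r r0.
have r2 : 0 < r / 2 by rewrite divr_gt0.
(* At most dl * a n terms differ, with total variance at most dl * a n * v; Chebyshev at level e *
   sqrt (a n) then yields r / 2. The 1 guards against v = 0. *)
pose dl := r / 2 * e ^+ 2 / (v + 1).
have v1 : 0 < v + 1 by rewrite ltr_wpDl.
have d0 : 0 < dl by rewrite divr_gt0// mulr_gt0// exprn_gt0.
have cNm : op P (fun n w => (N n w)%:R / a n - (m n)%:R / a n).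
  have h1 : op P (fun n (w : T) => lam - (m n)%:R / a n).
    apply: cst_op; rewrite -(subrr lam); apply: cvgB => //; exact: cvg_cst.
  by apply: eq_op (op_add cN h1) => n w /=; rewrite addrA subrK.
apply: filterS (cNm.2 _ d0 _ r2) => n hn.
pose G := [set w | `|(N n w)%:R - (m n)%:R| <= dl * a n /\
   e * Num.sqrt (a n) < `|\sum_(0 <= k < N n w) X k w - \sum_(0 <= k < m n) X k w|].
have sa0 : 0 < Num.sqrt (a n) by rewrite sqrtr_gt0.
pose E q := [set w | e * Num.sqrt (a n) < `|\sum_(0 <= k < q) X k w - \sum_(0 <= k < m n) X k w|].
have mE q : measurable (E q).
  apply: (@measurable_big _ _ _ (fun _ w => \sum_(0 <= k < q) X k w - \sum_(0 <= k < m n) X k w) _ 0%N) => _.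
  exact: measurable_funB.
have mGq q : measurable (N n @^-1` [set q] `&` E q) by exact: measurableI.
have key q : `|q%:R - (m n)%:R| <= dl * a n ->
    fine (P (N n @^-1` [set q] `&` E q)) <= r / 2 * fine (P (N n @^-1` [set q])).
  move=> qm.
  pose p1 := minn q (m n); pose p2 := maxn q (m n).
  have EE : E q = [set w | e * Num.sqrt (a n) < `|\sum_(p1 <= k < p2) X k w|].
    apply/seteqP; split => w; rewrite /E/= /p1 /p2; case: (leqP q (m n)) => h.
    - by rewrite (big_cat_nat (leq0n q) h)/= opprD addrA subrr sub0r normrN.
    - by rewrite (big_cat_nat (leq0n (m n)) (ltnW h))/= addrAC subrr add0r.
    - by rewrite (big_cat_nat (leq0n q) h)/= opprD addrA subrr sub0r normrN.
    - by rewrite (big_cat_nat (leq0n (m n)) (ltnW h))/= addrAC subrr add0r.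
  rewrite EE iN; last by rewrite /p1 /p2 geq_min leq_max leqnn.
  rewrite fineM ?fin_num_measure//; last by rewrite -EE.
  rewrite mulrC ler_wpM2r ?fine_ge0//.
  have [Vi Ve] := V p1 p2.
  have es : 0 < e * Num.sqrt (a n) by rewrite mulr_gt0.
  apply: (le_trans (chebyshev2 (mS _ _) Vi es)).
  rewrite Ve exprMn sqr_sqrtr ?(ltW (a0 n))// ler_pdivrMr; last by rewrite mulr_gt0 ?exprn_gt0.
  have -> : (p2 - p1)%:R = `|q%:R - (m n)%:R| :> R.
    rewrite /p1 /p2; case: (leqP q (m n)) => h.
      by rewrite distrC ger0_norm ?subr_ge0 ?ler_nat// natrB.
    by rewrite ger0_norm ?subr_ge0 ?ler_nat ?(ltnW h)// natrB// ltnW.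
  apply: (@le_trans _ _ (dl * a n * v)); first by rewrite ler_wpM2r.
  apply: (@le_trans _ _ (dl * a n * (v + 1))).
    by rewrite ler_wpM2l ?lerDl// mulr_ge0 ?(ltW d0)// ltW.
  suff -> : dl * a n * (v + 1) = r / 2 * (e ^+ 2 * a n) by [].
  have dlE : dl * (v + 1) = r / 2 * e ^+ 2 by rewrite /dl mulfVK// gt_eqF.
  by rewrite mulrA -dlE; exact: mulrAC.
pose B := big_event (fun n w => (N n w)%:R / a n - (m n)%:R / a n) dl n.
have mB : measurable B by apply: measurable_big; exact: cNm.1.
have mlt Q : measurable [set w | (N n w < Q)%N] by exact: (mN n [set k | (k < Q)%N]).
have mGQ Q : measurable (G `&` [set w | (N n w < Q)%N]).
  rewrite (_ : G `&` _ = \bigcup_(q in [set q | (q < Q)%N /\ `|q%:R - (m n)%:R| <= dl * a n]) (N n @^-1` [set q] `&` E q)).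
    by apply: bigcup_measurable => q _.
  apply/seteqP; split => [w [[/= g1 g2] g3]|w [q /= [q1 q2] [h g2]]].
    by exists (N n w).
  by rewrite -h in q1 q2 g2; split.
(* [key] is summed over q < Q; values of q far from m n contribute nothing, since [G] excludes
   them. *)
have ind Q : fine (P (G `&` [set w | (N n w < Q)%N])) <= r / 2 * fine (P [set w | (N n w < Q)%N]).
  elim: Q => [|Q IH].
    have -> : G `&` [set w | (N n w < 0)%N] = set0 by apply/seteqP; split => // w [].
    by rewrite measure0/= mulr_ge0 ?fine_ge0// ltW.
  have SE : [set w | (N n w < Q.+1)%N] = [set w | (N n w < Q)%N] `|` N n @^-1` [set Q].
    apply/seteqP; split => w /=; first by rewrite ltnS leq_eqVlt => /orP[/eqP|]; [right|left].
    by case=> [/ltnW//|->].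
  rewrite SE.
  have -> : P ([set w | (N n w < Q)%N] `|` N n @^-1` [set Q]) =
     (P [set w | (N n w < Q)%N] + P (N n @^-1` [set Q]))%E.
    rewrite measureU//; apply/seteqP; split => // w [/= h1 h2].
    by rewrite h2 ltnn in h1.
  rewrite fineD ?fin_num_measure// mulrDr.
  have [hq|hq] := leP `|Q%:R - (m n)%:R| (dl * a n).
    apply: le_trans (lerD IH (key _ hq)).
    apply: fineP_leU => //; first by rewrite -SE; exact: mGQ.
    move=> w [gw [h|/= h]]; first by left; split.
    by right; split=> //; case: gw => _; rewrite /= h.
  apply: (@le_trans _ _ (fine (P (G `&` [set w | (N n w < Q)%N])))).
    rewrite (_ : G `&` (_ `|` _) = G `&` [set w | (N n w < Q)%N])//.
    apply/seteqP; split => [w [gw [h|/= h]]|w [gw h]]; [by split| |by split=> //; left].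
    by case: gw => /=; rewrite h leNgt hq.
  by rewrite (le_trans IH)// lerDl mulr_ge0 ?fine_ge0// ltW.
(* On [G] the index is at most dl * a n + m n, so finitely many values exhaust it. *)
pose Q := (Num.truncn (dl * a n + (m n)%:R)).+1.
have GQ : G = G `&` [set w | (N n w < Q)%N].
  apply/seteqP; split => [w gw|w []//]; split => //=.
  have q0 : 0 <= dl * a n + (m n)%:R by apply: addr_ge0 => //; apply: mulr_ge0; exact: ltW.
  rewrite /Q ltnS truncn_ge_nat//.
  case: gw => /= + _; rewrite ler_norml => /andP[_]; lra.
have mG : measurable G by rewrite GQ.
rewrite (splitr r); apply: le_trans (lerD hn (_ : fine (P G) <= r / 2)).
  apply: fineP_leU => //; first exact: measurable_big.
  move=> w; rewrite /big_event/= normrM normfV (gtr0_norm sa0) ltr_pdivlMr// => h.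
  have [h1|h1] := ltP dl `|(N n w)%:R / a n - (m n)%:R / a n|; [by left|right].
  split => //=; move: h1; rewrite -mulrBl normrM normfV (gtr0_norm (a0 n)).
  by rewrite ler_pdivrMr.
rewrite GQ; apply: (le_trans (ind Q)).
rewrite -[leRHS]mulr1 ler_wpM2l ?(ltW r2)//.
by rewrite -lee_fin fineK ?fin_num_measure// probability_le1.
Qed.

End sums.

(** * Claims weighted by a function of their delay *)

Section marked.
Context d (Om : measurableType d) (R : realType) (P : probability Om R).

(** The terms of C_{i,t}, of V_t and of the linearised error differ only in the weight c, so laws,
    moments and limits are established once for all c. *)
Definition wt (Z : Om -> R) (D : Om -> nat) (c : nat -> R) (w : Om) : R := Z w * c (D w).

Lemma measurable_nat_comp (D : Om -> nat) (c : nat -> R) :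
  (forall A : set nat, measurable (D @^-1` A)) -> measurable_fun setT (fun w => c (D w)).
Proof. by move=> mD _ B mB; rewrite setTI; exact: (mD (c @^-1` B)). Qed.

Lemma measurable_wt Z D c : measurable_fun setT Z ->
  (forall A : set nat, measurable (D @^-1` A)) -> measurable_fun setT (wt Z D c).
Proof. by move=> mZ mD; apply: measurable_funM => //; exact: measurable_nat_comp. Qed.

Lemma sigma_measurable_nat G (D : Om -> nat) (c : nat -> R) :
  (forall A : set nat, gen_sigma G (D @^-1` A)) -> sigma_measurable G (fun w => c (D w)).
Proof. by move=> mD B mB; exact: (mD (c @^-1` B)). Qed.

Lemma sigma_measurable_wt G Z D c (mu : R) : sigma_measurable G Z ->
  (forall A : set nat, gen_sigma G (D @^-1` A)) ->
  sigma_measurable G (fun w => wt Z D c w - mu).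
Proof.
move=> mZ mD; apply/sigma_measurableP; apply: measurable_funB; last exact: measurable_cst.
apply: measurable_funM; first exact/sigma_measurableP.
by apply/sigma_measurableP; exact: sigma_measurable_nat.
Qed.

Lemma probability_fibers (T : nat) (D : Om -> nat) (B : set Om) :
  (forall A : set nat, measurable (D @^-1` A)) -> (forall w, (D w <= T)%N) -> measurable B ->
  P B = (\sum_(t < T.+1) P (B `&` D @^-1` [set t : nat]))%E.
Proof.
move=> mD DT mB; pose F t := B `&` D @^-1` [set t : nat].
have mF t : measurable (F t) by exact: measurableI.
rewrite -(@measure_bigsetU _ _ _ P F) //; last first.
  by apply/trivIsetP => i j _ _ ij; apply/seteqP; split => // w [[_ /= hi] [_ /= hj]]; rewrite -hi -hj eqxx in ij.
congr (P _); apply/seteqP; split=> [w Bw|].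
  rewrite -bigcup_mkord; exists (D w); first by rewrite /= ltnS.
  by split.
by rewrite -bigcup_mkord => w [t _ []].
Qed.

(** The joint laws are compared on rectangles only. As the delay takes finitely many values, cutting
    the event along D = t turns each piece into a rectangle. *)
Lemma wt_law (T : nat) (Z1 Z2 : Om -> R) (D1 D2 : Om -> nat) c :
  measurable_fun setT Z1 -> (forall A : set nat, measurable (D1 @^-1` A)) ->
  measurable_fun setT Z2 -> (forall A : set nat, measurable (D2 @^-1` A)) ->
  (forall w, (D1 w <= T)%N) -> (forall w, (D2 w <= T)%N) ->
  (forall (A : set nat) (B : set R), measurable B ->
     P ([set w | A (D1 w)] `&` [set w | B (Z1 w)]) =
     P ([set w | A (D2 w)] `&` [set w | B (Z2 w)])) ->
  forall A, measurable A -> P (wt Z1 D1 c @^-1` A) = P (wt Z2 D2 c @^-1` A).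
Proof.
move=> mZ1 mD1 mZ2 mD2 b1 b2 law A mA.
have mW1 : measurable (wt Z1 D1 c @^-1` A).
  by rewrite -[X in measurable X]setTI; exact: measurable_wt.
have mW2 : measurable (wt Z2 D2 c @^-1` A).
  by rewrite -[X in measurable X]setTI; exact: measurable_wt.
rewrite (probability_fibers mD1 b1 mW1) (probability_fibers mD2 b2 mW2).
apply: eq_bigr => t _.
have mB : measurable ((fun x : R => x * c t) @^-1` A).
  by rewrite -[X in measurable X]setTI; apply: measurable_funM.
have E (Z : Om -> R) (D : Om -> nat) : wt Z D c @^-1` A `&` D @^-1` [set val t] =
    [set w | [set val t] (D w)] `&` [set w | ((fun x : R => x * c t) @^-1` A) (Z w)].
  apply/seteqP; split=> w /= [h1 h2]; split=> //; first by rewrite -h2.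
  by rewrite /wt/= h1.
by rewrite !E; exact: law.
Qed.

Lemma same_law_Rint (X Y : Om -> R) (f : R -> R) :
  measurable_fun setT X -> measurable_fun setT Y -> measurable_fun setT f ->
  (forall A, measurable A -> P (X @^-1` A) = P (Y @^-1` A)) ->
  P.-integrable setT (EFin \o (f \o Y)) ->
  P.-integrable setT (EFin \o (f \o X)) /\ \int[P]_w f (X w) = \int[P]_w f (Y w).
Proof.
move=> mX mY mf law iY.
have iX : P.-integrable setT (EFin \o (f \o X)).
  apply/integrableP; split; first by apply/measurable_EFinP; exact: measurableT_comp.
  case/integrableP: iY => _; apply: le_lt_trans.
  rewrite (_ : (\int[P]_x `|(EFin \o (f \o X)) x|)%E = \int[distribution P (mfun_of mX)]_x `|f x|%:E)%E; last first.
    rewrite ge0_integral_distribution//; by apply/measurable_EFinP; apply: measurableT_comp.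
  rewrite (_ : (\int[P]_x `|(EFin \o (f \o Y)) x|)%E = \int[distribution P (mfun_of mY)]_x `|f x|%:E)%E; last first.
    rewrite ge0_integral_distribution//; by apply/measurable_EFinP; apply: measurableT_comp.
  rewrite le_eqVlt; apply/orP; left; apply/eqP; apply: eq_measure_integral => A mA _; exact: law.
split=> //.
rewrite -(@law_Rint _ _ _ _ (mfun_of mX))// -(@law_Rint _ _ _ _ (mfun_of mY))//.
by rewrite /Rintegral; congr fine; apply: eq_measure_integral => A mA _; exact: law.
Qed.

End marked.

(** * One row of claims with a random number of terms *)

Section row.
Context d (Om : measurableType d) (R : realType) (P : probability Om R) (T : nat)
  (D : nat -> Om -> nat) (Z : nat -> Om -> R) (D0 : Om -> nat) (Z0 : Om -> R).
Hypothesis mD : forall k (A : set nat), measurable (D k @^-1` A).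
Hypothesis mZ : forall k, measurable_fun setT (Z k).
Hypothesis mD0 : forall A : set nat, measurable (D0 @^-1` A).
Hypothesis mZ0 : measurable_fun setT Z0.
Hypothesis bD : forall k w, (D k w <= T)%N.
Hypothesis bD0 : forall w, (D0 w <= T)%N.
Hypothesis law : forall k (A : set nat) (B : set R), measurable B ->
     P ([set w | A (D k w)] `&` [set w | B (Z k w)]) =
     P ([set w | A (D0 w)] `&` [set w | B (Z0 w)]).
Hypothesis iZ : P.-integrable setT (fun w => (Z0 w ^+ 2)%:E).
Hypothesis ind : mutually_independent P (fun k => events_nat (D k) `|` events_real (Z k)).

Lemma integrable_mark (f : Om -> R) (c : nat -> R) : measurable_fun setT f ->
  P.-integrable setT (EFin \o f) -> P.-integrable setT (EFin \o (fun w => f w * c (D0 w))).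
Proof.
move=> mf iF.
pose K := \sum_(t < T.+1) `|c t|.
have cK w : `|c (D0 w)| <= K.
  have h : (D0 w < T.+1)%N by rewrite ltnS.
  by rewrite /K (bigD1 (Ordinal h))//= lerDl sumr_ge0.
have iK : P.-integrable setT (EFin \o (fun w => K * `|f w|)).
  have := integrableZl measurableT K (integrable_norm iF).
  exact: eq_integrable.
apply: integrable_le iK.
  by apply: measurable_funM => //; exact: measurable_nat_comp.
by move=> w; rewrite normrM mulrC ler_wpM2r.
Qed.

Lemma integrable_sqr_wt c : P.-integrable setT (EFin \o (fun w => wt Z0 D0 c w ^+ 2)).
Proof.
have := @integrable_mark (fun w => Z0 w ^+ 2) (fun t => c t ^+ 2) (measurable_funX _ mZ0) iZ.
by apply: eq_integrable => // w _ /=; rewrite /wt exprMn.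
Qed.

Lemma integrable_wt c : P.-integrable setT (EFin \o wt Z0 D0 c).
Proof. by apply: integrable_sqr1; [exact: measurable_wt|exact: integrable_sqr_wt]. Qed.

Definition cwt (c : nat -> R) k w := wt (Z k) (D k) c w - \int[P]_w wt Z0 D0 c w.
Let cwt0 (c : nat -> R) w := wt Z0 D0 c w - \int[P]_w wt Z0 D0 c w.

Lemma measurable_cwt c k : measurable_fun setT (cwt c k).
Proof. by apply: measurable_funB => //; exact: measurable_wt. Qed.

Let mcwt0 c : measurable_fun setT (cwt0 c).
Proof. by apply: measurable_funB => //; exact: measurable_wt. Qed.

Lemma cwt_law0 c k A : measurable A -> P (cwt c k @^-1` A) = P (cwt0 c @^-1` A).
Proof.
move=> mA; pose B := (fun x : R => x - \int[P]_w wt Z0 D0 c w) @^-1` A.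
have mB : measurable B by rewrite -[X in measurable X]setTI; exact: measurable_funB.
exact: (@wt_law _ _ _ P T (Z k) Z0 (D k) D0 c (mZ k) (mD k) mZ0 mD0 (bD k) bD0 (@law k) B mB).
Qed.

Let icwt0 c : P.-integrable setT (EFin \o (fun w => cwt0 c w ^+ 2)).
Proof.
set mu := \int[P]_w wt Z0 D0 c w.
have iD (g h : Om -> R) : P.-integrable setT (EFin \o g) -> P.-integrable setT (EFin \o h) ->
    P.-integrable setT (EFin \o (fun w => g w + h w)).
  by move=> ig ih; have := integrableD measurableT ig ih; apply: eq_integrable.
have iS : P.-integrable setT (EFin \o (fun w => - 2 * mu * wt Z0 D0 c w)).
  have := integrableZl measurableT (- 2 * mu) (integrable_wt c); exact: eq_integrable.
have iC : P.-integrable setT (EFin \o (fun=> mu ^+ 2)).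
  exact: finite_measure_integrable_cst.
have := iD _ _ (iD _ _ (integrable_sqr_wt c) iS) iC.
by apply: eq_integrable => // w _ /=; congr EFin; rewrite /cwt0 -/mu; ring.
Qed.

Definition var0 (c : nat -> R) := \int[P]_w (cwt0 c w ^+ 2).

Lemma cwt_sqr c k : P.-integrable setT (EFin \o (fun w => cwt c k w ^+ 2)) /\
  \int[P]_w (cwt c k w ^+ 2) = var0 c.
Proof.
apply: (@same_law_Rint _ _ _ P _ _ (fun x => x ^+ 2)) => //.
- exact: measurable_cwt.
- exact: cwt_law0.
- exact: icwt0.
Qed.

Lemma cwt_mean c k : P.-integrable setT (EFin \o cwt c k) /\ \int[P]_w cwt c k w = 0.
Proof.
have i0 : P.-integrable setT (EFin \o cwt0 c) by apply: integrable_sqr1.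
have [iw e] := @same_law_Rint _ _ _ P (cwt c k) _ id (measurable_cwt c k) (mcwt0 c) (@measurable_id _ _ setT) (@cwt_law0 c k) i0.
split=> //; rewrite e /cwt0 RintegralB//; first by rewrite Rint_cst subrr.
- exact: integrable_wt.
- exact: finite_measure_integrable_cst.
Qed.

Let sub_gen k (G := events_nat (D k) `|` events_real (Z k)) : gen_sigma G `<=` measurable.
Proof.
apply: smallest_sub; first exact: sigma_algebra_measurable.
move=> _ [[A _ <-]|[B mB <-]]; first exact: mD.
by rewrite -[X in measurable X]setTI; exact: mZ.
Qed.

Lemma sigma_measurable_cwt G c k : events_nat (D k) `|` events_real (Z k) `<=` gen_sigma G ->
  sigma_measurable G (cwt c k).
Proof.
move=> h; apply: sigma_measurable_wt.
  by move=> B mB; apply: h; right; exists B.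
by move=> A; apply: h; left; exists A.
Qed.

(** The offset p makes [sum_variance] available for an arbitrary block of claims, as the gap between
    a random and a deterministic index is such a block. *)
Lemma indep_cwt c p n : indep2 P (fun w => \sum_(k < n) cwt c (k + p) w) (cwt c (n + p)).
Proof.
rewrite (_ : (fun w => _) = (fun w => \sum_(k <- index_iota p (n + p)) cwt c k w)); last first.
  by apply/funext => w; rewrite -[in RHS](add0n p) big_addn addnK big_mkord.
apply: (indep_sum ind sub_gen); last first.
- by rewrite mem_index_iota ltnn andbF.
- exact: iota_uniq.
- by move=> k; apply: sigma_measurable_cwt; exact: sub_sigma_algebra.
Qed.

Lemma cwt_variance c p q :
  P.-integrable setT (EFin \o (fun w => (\sum_(p <= k < q) cwt c k w) ^+ 2)) /\
  \int[P]_w ((\sum_(p <= k < q) cwt c k w) ^+ 2) = (q - p)%:R * var0 c.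
Proof.
have E : (fun w => \sum_(p <= k < q) cwt c k w) = (fun w => \sum_(k < q - p) cwt c (k + p) w).
  by apply/funext => w; rewrite -{1}(add0n p) big_addn big_mkord.
have := @sum_variance _ _ _ P (fun k => cwt c (k + p)) (var0 c) (fun k => measurable_cwt c _)
  (indep_cwt c p) (fun k => (cwt_sqr c _).1) (fun k => (cwt_mean c _).2) (fun k => (cwt_sqr c _).2) (q - p)%N.
have E' w : \sum_(p <= k < q) cwt c k w = \sum_(k < q - p) cwt c (k + p) w by exact: (congr1 (fun f => f w) E).
rewrite (_ : (fun w => (\sum_(k < q - p) cwt c (k + p) w) ^+ 2) = (fun w => (\sum_(p <= k < q) cwt c k w) ^+ 2))//.
by apply/funext => w; rewrite E'.
Qed.

Lemma row_clt c (lam : R) (a : nat -> R) (m : nat -> nat) :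
  \int[P]_w wt Z0 D0 c w = 0 ->
  (forall n, 0 < a n) -> a n @[n --> \oo] --> +oo ->
  (m n)%:R / a n @[n --> \oo] --> lam -> 0 <= lam ->
  gaussian_limit P (fun n w => (\sum_(0 <= k < m n) wt (Z k) (D k) c w) / Num.sqrt (a n))
    (lam * \int[P]_w (wt Z0 D0 c w ^+ 2)).
Proof.
move=> c0 a0 ay ma lam0.
have E k : cwt c k = wt (Z k) (D k) c by apply/funext => w; rewrite /cwt c0 subr0.
have v0 : var0 c = \int[P]_w (wt Z0 D0 c w ^+ 2).
  by apply: eq_Rintegral => w _; rewrite /cwt0 c0 subr0.
rewrite (_ : (fun n w => _) = (fun n w => (\sum_(k < m n) cwt c k w) / Num.sqrt (a n))); last first.
  by apply/funext => n; apply/funext => w; rewrite big_mkord; congr (_ / _); apply: eq_bigr => k _; rewrite E.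
rewrite -v0; apply: clt_iid => //.
- exact: measurable_cwt.
- by move=> k A mA; rewrite !cwt_law0.
- move=> n; have := indep_cwt c 0 n; rewrite addn0.
  by under eq_fun do under eq_bigr do rewrite addn0.
- exact: (cwt_mean c 0).1.
- exact: (cwt_sqr c 0).1.
- exact: (cwt_mean c 0).2.
- exact: (cwt_sqr c 0).2.
Qed.

Lemma row_random_index c (N : nat -> Om -> nat) (m : nat -> nat) G1 G2 (a : nat -> R) (lam : R) :
  (forall k, events_nat (D k) `|` events_real (Z k) `<=` gen_sigma G1) ->
  (forall n (A : set nat), measurable (N n @^-1` A)) ->
  (forall n (A : set nat), gen_sigma G2 (N n @^-1` A)) ->
  (forall A B, gen_sigma G1 A -> gen_sigma G2 B -> P (B `&` A) = P B * P A)%E ->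
  (forall n, 0 < a n) -> cvgp P (fun n w => (N n w)%:R / a n) lam ->
  (m n)%:R / a n @[n --> \oo] --> lam ->
  op P (fun n w => (\sum_(0 <= k < N n w) cwt c k w - \sum_(0 <= k < m n) cwt c k w) / Num.sqrt (a n)).
Proof.
move=> G1s mN G2s iG a0 cN cm.
apply: (random_index (v := var0 c) (lam := lam)) => //.
- exact: measurable_cwt.
- move=> p q n k e _; apply: iG; last exact: G2s.
  have h : sigma_measurable G1 (fun w => \sum_(p <= k < q) cwt c k w).
    by apply: sigma_measurable_sum => j; exact: sigma_measurable_cwt.
  have mB : measurable [set x : R | e < `|x|].
    rewrite (_ : [set x : R | e < `|x|] = ~` [set x : R | `|x| <= e]).
      by apply: measurableC; apply: measurable_ball; exact: measurable_id.
    by apply/seteqP; split => x /=; rewrite ltNge => /negP.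
  exact: (h _ mB).
- exact: cwt_variance.
Qed.

Lemma row_Op c (m : nat -> nat) (a : nat -> R) (lam : R) : (forall n, 0 < a n) ->
  (forall n, (m n)%:R <= lam * a n) ->
  Op P (fun n w => (\sum_(0 <= k < m n) cwt c k w) / Num.sqrt (a n)).
Proof.
move=> a0 ma.
have mS n : measurable_fun setT (fun w => \sum_(0 <= k < m n) cwt c k w).
  by apply: measurable_sum => k; exact: measurable_cwt.
have E n w : ((\sum_(0 <= k < m n) cwt c k w) / Num.sqrt (a n)) ^+ 2 =
    (a n)^-1 * (\sum_(0 <= k < m n) cwt c k w) ^+ 2.
  by rewrite exprMn exprVn sqr_sqrtr ?(ltW (a0 n))// mulrC.
have [I V] : (forall n, P.-integrable setT (EFin \o (fun w => (\sum_(0 <= k < m n) cwt c k w) ^+ 2))) /\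
    forall n, \int[P]_w ((\sum_(0 <= k < m n) cwt c k w) ^+ 2) = (m n)%:R * var0 c.
  by split=> n; have [? h] := cwt_variance c 0 (m n); rewrite ?h ?subn0.
have v0 : 0 <= var0 c by apply: Rintegral_ge0 => w _; exact: sqr_ge0.
apply: (@Op_second_moment _ _ _ P _ (lam * var0 c)).
- by move=> n; exact: measurable_funM.
- move=> n; have := integrableZl measurableT (a n)^-1 (I n).
  by apply: eq_integrable => // w _ /=; rewrite E.
- move=> n; under eq_Rintegral do rewrite E.
  rewrite RintegralZl// V mulrA ler_wpM2r// mulrC ler_pdivrMr//.
Qed.

(** The centred part is O_P(1) at scale sqrt (a n), hence negligible at scale a n; the means
    contribute N / a n times mu. *)
Lemma row_lln c (N : nat -> Om -> nat) (a : nat -> R) (lam : R) :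
  (forall n, 0 < a n) -> a n @[n --> \oo] --> +oo ->
  cvgp P (fun n w => (N n w)%:R / a n) lam ->
  Op P (fun n w => (\sum_(0 <= k < N n w) cwt c k w) / Num.sqrt (a n)) ->
  cvgp P (fun n w => (\sum_(0 <= k < N n w) wt (Z k) (D k) c w) / a n)
    (lam * \int[P]_w wt Z0 D0 c w).
Proof.
move=> a0 ay cN oS; set mu := \int[P]_w wt Z0 D0 c w.
have h1 := op_mulO (cst_op P (sqrt_inv_cvg0 a0 ay)) oS.
have h2 := cvgp_mul cN (cvgp_cst P mu).
apply: eq_op (op_add h1 h2) => n w.
have -> : \sum_(0 <= k < N n w) wt (Z k) (D k) c w =
    \sum_(0 <= k < N n w) cwt c k w + (N n w)%:R * mu.
  rewrite [X in _ = X + _](_ : _ = \sum_(0 <= k < N n w) (wt (Z k) (D k) c w + (- mu))); last by [].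
  by rewrite big_split/= sumr_const_nat subn0 mulNrn mulr_natl subrK.
have e : (a n)^-1 = (Num.sqrt (a n))^-1 * (Num.sqrt (a n))^-1.
  by rewrite -invfM -expr2 sqr_sqrtr// ltW.
rewrite e; ring.
Qed.

End row.

(** * Delta method for a product of ratios *)

Section expansion.
Context d (Om : measurableType d) (R : realType) (P : probability Om R).
Implicit Types X Y B : nat -> Om -> R.

Lemma eq_Op X Y : (forall n w, X n w = Y n w) -> Op P X -> Op P Y.
Proof. by move=> XY; rewrite (_ : X = Y)//; apply/funext => n; apply/funext => w. Qed.

Lemma cvgp_sum_in (I : eqType) (s : seq I) (X : I -> nat -> Om -> R) (a : I -> R) :
  (forall i, i \in s -> cvgp P (X i) (a i)) ->
  cvgp P (fun n w => \sum_(i <- s) X i n w) (\sum_(i <- s) a i).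
Proof.
elim: s => [|i s IH] h.
  by apply: eq_op (cvgp_cst P 0) => n w; rewrite !big_nil.
have h1 := cvgp_add (h i (mem_head i s)) (IH (fun j js => h j (@mem_behead _ (i :: s) j js))).
by apply: eq_op h1 => n w; rewrite !big_cons.
Qed.

Lemma op_sum_in (I : eqType) (s : seq I) (X : I -> nat -> Om -> R) :
  (forall i, i \in s -> op P (X i)) -> op P (fun n w => \sum_(i <- s) X i n w).
Proof.
move=> h; have := @cvgp_sum_in _ s X (fun=> 0).
rewrite big1// => H; apply: eq_op (H _) => [n w|i si]; first by rewrite subr0.
by apply: eq_op (h i si) => n w; rewrite subr0.
Qed.

Lemma Op_sum_in (I : eqType) (s : seq I) (X : I -> nat -> Om -> R) :
  (forall i, i \in s -> Op P (X i)) -> Op P (fun n w => \sum_(i <- s) X i n w).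
Proof.
elim: s => [|i s IH] h.
  by apply: eq_Op (cvgp_Op (cvgp_cst P 0)) => n w; rewrite big_nil.
have h1 := Op_add (h i (mem_head i s)) (IH (fun j js => h j (@mem_behead _ (i :: s) j js))).
by apply: eq_Op h1 => n w; rewrite big_cons.
Qed.

(** The size of X is irrelevant, only its support counts: this disposes of terms that carry a
    diverging factor. *)
Lemma op_support X Y (dl : R) : (forall n, measurable_fun setT (X n)) -> op P Y -> 0 < dl ->
  (forall n w, X n w != 0 -> dl < `|Y n w|) -> op P X.
Proof.
move=> mX oY d0 h; apply: (opP_sub mX oY oY) => e e0.
exists dl; split=> // n w; rewrite /big_event/= => ex; left; apply: h.
by apply: contraTneq ex => ->; rewrite normr0 -leNgt ltW.
Qed.

Lemma op_cstM (c : R) X : op P X -> op P (fun n w => c * X n w).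
Proof.
move=> oX; have := op_mulO oX (cvgp_Op (cvgp_cst P c)).
by apply: eq_op => n w; rewrite mulrC.
Qed.

Variable a : nat -> R.
Hypothesis a0 : forall n, 0 < a n.
Hypothesis ay : a n @[n --> \oo] --> +oo.

Let sa n : 0 < Num.sqrt (a n). Proof. by rewrite sqrtr_gt0. Qed.

(** Write V for the normalised B1 - f B0. The error is ((B0 / a n)^-1 - b^-1) V, an o_P(1) times an
    O_P(1), plus sqrt (a n) f (B0 / B0 - 1). *)
Lemma ratio_expansion B0 B1 (f b : R) :
  (forall n, measurable_fun setT (B0 n)) -> b != 0 ->
  cvgp P (fun n w => B0 n w / a n) b ->
  Op P (fun n w => (B1 n w - f * B0 n w) / Num.sqrt (a n)) ->
  op P (fun n w => Num.sqrt (a n) * (B1 n w / B0 n w - f) -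
                   (B1 n w - f * B0 n w) / Num.sqrt (a n) / b).
Proof.
move=> mB b0 cB oV.
have h1 := op_mulO (cvgp_inv b0 cB) oV.
(* [B0 / B0] is 1 except where [B0 = 0], an event of vanishing probability. *)
have h2 : op P (fun n w => Num.sqrt (a n) * (f * (B0 n w / B0 n w - 1))).
  apply: (@op_support _ _ (`|b| / 2) _ cB); last 2 first.
  - by rewrite divr_gt0 ?normr_gt0.
  - move=> n w; case: (eqVneq (B0 n w) 0) => [->|B0n]; last by rewrite divff// subrr !mulr0 eqxx.
    by move=> _; rewrite mul0r sub0r normrN ltr_pdivrMr// mulr_natr mulr2n ltrDl normr_gt0.
  - move=> n; apply: measurable_funM => //; apply: measurable_funM => //; apply: measurable_funB => //.
    by apply: measurable_funM => //; exact: measurable_inv.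
apply: eq_op (op_add h1 h2) => n w.
have e : a n = Num.sqrt (a n) ^+ 2 by rewrite sqr_sqrtr// ltW.
have s0 : Num.sqrt (a n) != 0 by rewrite gt_eqF.
rewrite {1}e; move: (Num.sqrt (a n)) s0 => s s0.
case: (eqVneq (B0 n w) 0) => [->|Bn]; first by rewrite !mul0r !invr0; field; rewrite b0 s0.
by field; rewrite b0 s0.
Qed.

Lemma ratio_cvgp B0 B1 (f b : R) :
  (forall n, measurable_fun setT (B0 n)) -> b != 0 ->
  cvgp P (fun n w => B0 n w / a n) b ->
  Op P (fun n w => (B1 n w - f * B0 n w) / Num.sqrt (a n)) ->
  cvgp P (fun n w => B1 n w / B0 n w) f.
Proof.
move=> mB b0 cB oV; have h1 := ratio_expansion mB b0 cB oV.
have h2 := Op_mul oV (cvgp_Op (cvgp_cst P b^-1)).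
have := op_mulO (cst_op P (sqrt_inv_cvg0 a0 ay)) (Op_add (op_Op h1) h2).
by apply: eq_op => n w; rewrite subrK mulKf// gt_eqF.
Qed.

(** Product rule, by induction: with u, f the new factors and p, q the old products, u p - f q is (u
    - f) (p - q) + f (p - q) + q (u - f). Multiplied by sqrt (a n) the first term is o_P(1) times
    O_P(1), and the other two are linearised. *)
Lemma prod_expansion (I : eqType) (r : seq I) (B0 B1 : I -> nat -> Om -> R) (f b : I -> R) :
  (forall t, t \in r -> forall n, measurable_fun setT (B0 t n)) ->
  (forall t, t \in r -> b t != 0) -> (forall t, t \in r -> f t != 0) ->
  (forall t, t \in r -> cvgp P (fun n w => B0 t n w / a n) (b t)) ->
  (forall t, t \in r -> Op P (fun n w => (B1 t n w - f t * B0 t n w) / Num.sqrt (a n))) ->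
  op P (fun n w => Num.sqrt (a n) * (\prod_(t <- r) (B1 t n w / B0 t n w) - \prod_(t <- r) f t) -
    (\prod_(t <- r) f t) * \sum_(t <- r) (f t * b t)^-1 * ((B1 t n w - f t * B0 t n w) / Num.sqrt (a n))).
Proof.
elim: r => [|t r IH] mB b0 f0 cB oV.
  by apply: eq_op (cvgp_cst P 0) => n w; rewrite !big_nil !subrr !mulr0 subr0.
have tr : t \in t :: r by exact: mem_head.
have sub u : u \in r -> u \in t :: r by move=> ur; rewrite inE ur orbT.
have {}IH := IH (fun u ur => mB u (sub u ur)) (fun u ur => b0 u (sub u ur))
  (fun u ur => f0 u (sub u ur)) (fun u ur => cB u (sub u ur)) (fun u ur => oV u (sub u ur)).
have h1 := ratio_expansion (mB t tr) (b0 t tr) (cB t tr) (oV t tr).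
have h2 := ratio_cvgp (mB t tr) (b0 t tr) (cB t tr) (oV t tr).
have oS : Op P (fun n w => (\prod_(t <- r) f t) * \sum_(t <- r) (f t * b t)^-1 * ((B1 t n w - f t * B0 t n w) / Num.sqrt (a n))).
  apply: Op_mul (cvgp_Op (cvgp_cst P _)) _; apply: Op_sum_in => u ur.
  exact: Op_mul (cvgp_Op (cvgp_cst P _)) (oV u (sub u ur)).
have h3 := op_mulO h2 (Op_add (op_Op IH) oS).
have h4 := op_add (op_cstM (f t) IH) (op_cstM (\prod_(t <- r) f t) h1).
apply: eq_op (op_add h3 h4) => n w; rewrite !big_cons.
move: (\prod_(t <- r) (B1 t n w / B0 t n w)) (\prod_(t <- r) f t) => p q.
move: (\sum_(t <- r) _) (B1 t n w / B0 t n w) => S u.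
move: (Num.sqrt (a n)) (gt_eqF (sa n)) (f0 t tr) (b0 t tr) => s s0 ft bt.
by field; rewrite ft bt s0.
Qed.

End expansion.

(** * The general model along a sequence *)

Section cohorts.
Context (R : realType) (d : measure_display) (Omega : measurableType d)
  (P : probability Omega R) (T : nat)
  (M : nat -> R -> Omega -> nat) (D : nat -> nat -> Omega -> nat)
  (Z : nat -> nat -> Omega -> R) (lam : nat -> R) (a : nat -> R).
Hypothesis mM : forall i a (A : set nat), 0 <= a -> measurable (M i a @^-1` A).
Hypothesis mD : forall i k (A : set nat), measurable (D i k @^-1` A).
Hypothesis mZ : forall i k, measurable_fun setT (Z i k).
Hypothesis D1 : forall i k w, (1 <= D i k w)%N.
Hypothesis Epos : forall t, (1 <= t <= T)%N -> 0 < EZeq P D Z t.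
Hypothesis bD : forall i k w, (D i k w <= T)%N.
Hypothesis law : forall i k (A : set nat) (B : set R), (1 <= i <= T)%N -> (1 <= k)%N ->
     measurable B ->
     P ([set w | A (D i k w)] `&` [set w | B (Z i k w)]) =
     P ([set w | A (D 1 1 w)] `&` [set w | B (Z 1 1 w)]).
Hypothesis ind1 : forall i, (1 <= i <= T)%N ->
     mutually_independent P
       (fun k : nat => events_nat (D i k.+1) `|` events_real (Z i k.+1)).
Hypothesis iZ : P.-integrable setT (fun w => (Z 1 1 w ^+ 2)%:E).
Hypothesis ind2 : forall i, (1 <= i <= T)%N ->
     mutually_independent P
       (fun b : bool => if b then
          \bigcup_(k in [set k : nat | (1 <= k)%N])
             (events_nat (D i k) `|` events_real (Z i k))
        else \bigcup_(a in [set a : R | 0 <= a]) events_nat (M i a)).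
Hypothesis ind3 : mutually_independent P
    (fun j : 'I_T => let i := j.+1 in
       \bigcup_(a in [set a : R | 0 <= a]) events_nat (M i a) `|`
       \bigcup_(k in [set k : nat | (1 <= k)%N])
             (events_nat (D i k) `|` events_real (Z i k))).
Hypothesis Mlam : forall i, (1 <= i <= T)%N -> 0 < lam i /\
     {ae P, forall w, (M i a w)%:R / a @[a --> +oo] --> lam i}.
Hypothesis a0 : forall n, 0 < a n.
Hypothesis ay : a n @[n --> \oo] --> +oo.

(* The claims of row [i] are reindexed from 0.  [csum] runs over the random number [M] of
   claims, [dsum] over the deterministic number of claims which replaces it. *)
Definition csum i c n w := \sum_(0 <= k < M i (a n) w) wt (Z i k.+1) (D i k.+1) c w.
Definition dsum i c n w :=
  \sum_(0 <= k < Num.truncn (lam i * a n)) wt (Z i k.+1) (D i k.+1) c w.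
Definition EZc (c : nat -> R) := \int[P]_w wt (Z 1 1) (D 1 1) c w.
Definition EZ2c (c : nat -> R) := \int[P]_w (wt (Z 1 1) (D 1 1) c w ^+ 2).

Lemma CitE i t n w : Cit M D Z i t (a n) w = csum i (fun x => (x <= t)%N%:R) n w.
Proof. by rewrite /Cit /csum big_add1. Qed.

Let lawk i (iT : (1 <= i <= T)%N) k (A : set nat) (B : set R) : measurable B ->
     P ([set w | A (D i k.+1 w)] `&` [set w | B (Z i k.+1 w)]) =
     P ([set w | A (D 1 1 w)] `&` [set w | B (Z 1 1 w)]).
Proof. exact: law. Qed.

Let mN i n (A : set nat) : measurable (M i (a n) @^-1` A).
Proof. exact/mM/ltW. Qed.

Lemma truncn_cvg i : 0 < lam i -> (Num.truncn (lam i * a n))%:R / a n @[n --> \oo] --> lam i.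
Proof.
move=> l0.
have ai : (a n)^-1 @[n --> \oo] --> 0 by apply/gtr0_cvgV0 => //; exact: nearW.
have h : lam i - (a n)^-1 @[n --> \oo] --> lam i.
  by rewrite -[X in _ --> X]subr0; apply: cvgB => //; exact: cvg_cst.
have hc : lam i @[n --> \oo] --> lam i by exact: cvg_cst.
apply: (squeeze_cvgr _ h hc); apply: nearW => n.
have lan : 0 <= lam i * a n by rewrite mulr_ge0// ltW.
have /andP[h1 h2] := truncn_itv lan.
rewrite ler_pdivlMr// ler_pdivrMr// h1 andbT mulrBl mulVf ?gt_eqF// lerBlDr.
by rewrite (le_trans (ltW h2))// -natr1.
Qed.

Let truncn_bd i n : 0 < lam i -> (Num.truncn (lam i * a n))%:R <= lam i * a n.
Proof. by move=> l0; rewrite truncn_le// mulr_ge0// ltW. Qed.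

Let Mcvg i : (1 <= i <= T)%N -> cvgp P (fun n w => (M i (a n) w)%:R / a n) (lam i).
Proof.
move=> iT; have [l0 h] := Mlam iT; apply: as_cvgp.
  move=> n; apply: measurable_funM => //.
  exact: (@measurable_nat_comp _ _ _ _ (fun k => k%:R)).
apply: filterS h => w h.
exact: (cvg_comp a (fun a => (M i a w)%:R / a) ay h).
Qed.

Lemma csum_cwt i c n w : EZc c = 0 ->
  csum i c n w = \sum_(0 <= k < M i (a n) w) cwt P (fun k => D i k.+1) (fun k => Z i k.+1) (D 1 1) (Z 1 1) c k w.
Proof. by move=> c0; apply: eq_bigr => k _; rewrite /cwt -/(EZc c) c0 subr0. Qed.

Lemma dsum_cwt i c n w : EZc c = 0 ->
  dsum i c n w = \sum_(0 <= k < Num.truncn (lam i * a n)) cwt P (fun k => D i k.+1) (fun k => Z i k.+1) (D 1 1) (Z 1 1) c k w.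
Proof. by move=> c0; apply: eq_bigr => k _; rewrite /cwt -/(EZc c) c0 subr0. Qed.

Let random_cwt i c : (1 <= i <= T)%N ->
  op P (fun n w => (\sum_(0 <= k < M i (a n) w) cwt P (fun k => D i k.+1) (fun k => Z i k.+1) (D 1 1) (Z 1 1) c k w
   - \sum_(0 <= k < Num.truncn (lam i * a n)) cwt P (fun k => D i k.+1) (fun k => Z i k.+1) (D 1 1) (Z 1 1) c k w)
   / Num.sqrt (a n)).
Proof.
move=> iT; have [l0 _] := Mlam iT.
apply: (@row_random_index _ _ _ P T (fun k => D i k.+1) (fun k => Z i k.+1) (D 1 1) (Z 1 1)
  (fun k => mD i k.+1) (fun k => mZ i k.+1) (mD 1 1) (mZ 1 1) (fun k => bD i k.+1) (bD 1 1)
  (lawk iT) iZ (ind1 iT) c (fun n => M i (a n)) _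
  (\bigcup_(k in [set k : nat | (1 <= k)%N]) (events_nat (D i k) `|` events_real (Z i k)))
  (\bigcup_(a in [set a : R | 0 <= a]) events_nat (M i a)) a (lam i)) => //.
- by move=> k A h; apply: sub_sigma_algebra; exists k.+1.
- by move=> n A; apply: sub_sigma_algebra; exists (a n); [exact/ltW|exists A].
- move=> A B hA hB; have := ind2 iT (J := [:: false; true]) (A := fun b : bool => if b then A else B).
  rewrite !big_cons big_nil mule1 => <-//.
    congr (P _); apply/seteqP; split=> [w [hb ha] [] //|w h].
    by split; [exact: (h false)|exact: (h true)].
  by case.
- exact: Mcvg.
- exact: truncn_cvg.
Qed.

Let dOp_cwt i c : (1 <= i <= T)%N ->
  Op P (fun n w => (\sum_(0 <= k < Num.truncn (lam i * a n)) cwt P (fun k => D i k.+1) (fun k => Z i k.+1) (D 1 1) (Z 1 1) c k w)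
   / Num.sqrt (a n)).
Proof.
move=> iT; have [l0 _] := Mlam iT.
apply: (@row_Op _ _ _ P T (fun k => D i k.+1) (fun k => Z i k.+1) (D 1 1) (Z 1 1)
  (fun k => mD i k.+1) (fun k => mZ i k.+1) (mD 1 1) (mZ 1 1) (fun k => bD i k.+1) (bD 1 1)
  (lawk iT) iZ (ind1 iT) c _ a (lam i)) => // n; exact: truncn_bd.
Qed.

Lemma csum_dsum i c : (1 <= i <= T)%N -> EZc c = 0 ->
  op P (fun n w => (csum i c n w - dsum i c n w) / Num.sqrt (a n)).
Proof.
move=> iT c0; apply: eq_op (random_cwt c iT) => n w.
by rewrite csum_cwt// dsum_cwt.
Qed.

Lemma dsum_Op i c : (1 <= i <= T)%N -> EZc c = 0 ->
  Op P (fun n w => dsum i c n w / Num.sqrt (a n)).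
Proof.
move=> iT c0; have := dOp_cwt c iT; congr (Op P _).
by apply/funext => n; apply/funext => w; rewrite dsum_cwt.
Qed.

Lemma csum_cvgp i c : (1 <= i <= T)%N -> cvgp P (fun n w => csum i c n w / a n) (lam i * EZc c).
Proof.
move=> iT; have [l0 _] := Mlam iT.
apply: (@row_lln _ _ _ P (fun k => D i k.+1) (fun k => Z i k.+1) (D 1 1) (Z 1 1)
  c (fun n => M i (a n)) a (lam i)) => //; first exact: Mcvg.
have := Op_add (op_Op (random_cwt c iT)) (dOp_cwt c iT); congr (Op P _).
by apply/funext => n; apply/funext => w; rewrite -mulrDl subrK.
Qed.

Let dsum_sigma (j : 'I_T) c n : sigma_measurable
   (\bigcup_(a in [set a : R | 0 <= a]) events_nat (M j.+1 a) `|`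
       \bigcup_(k in [set k : nat | (1 <= k)%N])
             (events_nat (D j.+1 k) `|` events_real (Z j.+1 k)))
   (fun w => dsum j.+1 c n w / Num.sqrt (a n)).
Proof.
apply/sigma_measurableP; apply: measurable_funM; last exact: measurable_cst.
apply/sigma_measurableP; apply: sigma_measurable_sum => k.
have := @sigma_measurable_wt _ _ R (\bigcup_(a in [set a : R | 0 <= a]) events_nat (M j.+1 a) `|`
       \bigcup_(k in [set k : nat | (1 <= k)%N])
             (events_nat (D j.+1 k) `|` events_real (Z j.+1 k))) (Z j.+1 k.+1) (D j.+1 k.+1) c 0.
rewrite (_ : (fun w => _ - 0) = wt (Z j.+1 k.+1) (D j.+1 k.+1) c); last by apply/funext => w; rewrite subr0.
apply.
- by move=> B mB; apply: sub_sigma_algebra; right; exists k.+1 => //; right; exists B.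
- by move=> A; apply: sub_sigma_algebra; right; exists k.+1 => //; left; exists A.
Qed.

Lemma measurable_dsum i c n : measurable_fun setT (fun w => dsum i c n w / Num.sqrt (a n)).
Proof.
by apply: measurable_funM => //; apply: measurable_sum => k; exact: measurable_wt.
Qed.

Lemma dsum_clt (eta : nat -> nat -> R) : (forall j, EZc (eta j) = 0) ->
  gaussian_limit P (fun n w => \sum_(j < T) dsum j.+1 (eta j) n w / Num.sqrt (a n))
    (\sum_(j < T) lam j.+1 * EZ2c (eta j)).
Proof.
move=> e0.
(* [clt_sum] wants nonnegative variances at every index, whereas [lam] is controlled on the rows 1
   to T only. *)
pose l j : R := if (j < T)%N then lam j.+1 else 0.
have lE (j : 'I_T) : l j = lam j.+1 by rewrite /l ltn_ord.
have l0 j : 0 <= l j.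
  by rewrite /l; case: ltnP => // jT; have [|h _] := @Mlam j.+1; rewrite ?jT// ltW.
rewrite (eq_bigr (fun j : 'I_T => l j * EZ2c (eta j))); last by move=> j _; rewrite lE.
apply: (@clt_sum _ _ _ P (fun j n w => dsum j.+1 (eta j) n w / Num.sqrt (a n)) (fun j => l j * EZ2c (eta j))).
- by move=> j n; exact: measurable_dsum.
- by move=> j; rewrite mulr_ge0//; apply: Rintegral_ge0 => w _; exact: sqr_ge0.
- move=> j jT; have iT : (1 <= j.+1 <= T)%N by [].
  have [lj _] := Mlam iT; rewrite /l jT.
  apply: (@row_clt _ _ _ P T (fun k => D j.+1 k.+1) (fun k => Z j.+1 k.+1) (D 1 1) (Z 1 1)
    (fun k => mD j.+1 k.+1) (fun k => mZ j.+1 k.+1) (mD 1 1) (mZ 1 1) (fun k => bD j.+1 k.+1) (bD 1 1)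
    (lawk iT) iZ (ind1 iT) (eta j)) => //; [exact: e0|exact: truncn_cvg|exact: ltW].
- move=> j n jT.
  pose F (i : nat) w := dsum i.+1 (eta i) n w / Num.sqrt (a n).
  (* (GM3) is indexed by ['I_T], so the earlier rows are listed as ordinals. *)
  pose s : seq 'I_T := seq.filter (fun i : 'I_T => (i < j)%N) (index_enum _).
  have -> : (fun w => \sum_(i < j) dsum i.+1 (eta i) n w / Num.sqrt (a n)) = (fun w => \sum_(i <- s) F i w).
    by apply/funext => w; rewrite big_filter -(big_ord_widen T (F^~ w) (ltnW jT)).
  apply: (@indep_sum _ _ _ P _ _ (fun j : 'I_T => fun w => dsum j.+1 (eta j) n w / Num.sqrt (a n))
    _ (Ordinal jT) ind3).
  + move=> i; apply: smallest_sub; first exact: sigma_algebra_measurable.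
    move=> _ [[b b0 [A _ <-]]|[k _ [[A _ <-]|[B mB <-]]]]; [exact: mM|exact: mD|].
    by rewrite -[X in measurable X]setTI; exact: mZ.
  + by move=> i; exact: dsum_sigma.
  + by rewrite filter_uniq// index_enum_uniq.
  + by rewrite mem_filter/= ltnn.
Qed.

Lemma measurable_csum i c n : measurable_fun setT (csum i c n).
Proof.
apply: (@measurable_random _ _ R (M i (a n)) (fun q w => \sum_(0 <= k < q) wt (Z i k.+1) (D i k.+1) c w)).
  by move=> A; exact: mN.
by move=> q; apply: measurable_sum => k; exact: measurable_wt.
Qed.

Let iwt c : P.-integrable setT (EFin \o wt (Z 1 1) (D 1 1) c).
Proof. exact: (integrable_wt (mD 1 1) (mZ 1 1) (bD 1 1) iZ). Qed.

Lemma EZc_sub (k : R) (c1 c2 : nat -> R) :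
  EZc (fun x => c1 x - k * c2 x) = EZc c1 - k * EZc c2.
Proof.
have iK : P.-integrable setT (EFin \o (fun w => k * wt (Z 1 1) (D 1 1) c2 w)).
  have := integrableZl measurableT k (iwt c2); exact: eq_integrable.
have eZ : \int[P]_w (k * wt (Z 1 1) (D 1 1) c2 w) = k * EZc c2 by apply: RintegralZl => //; exact: iwt.
rewrite -eZ /EZc -RintegralB//.
by apply: eq_Rintegral => w _; rewrite /wt; ring.
Qed.

Lemma EZc0 : EZc (fun=> 0) = 0.
Proof.
rewrite /EZc; under eq_Rintegral do rewrite /wt mulr0.
exact: Rint_cst.
Qed.

Lemma EZc_sum0 (I : eqType) (r : seq I) (k : R) (z : I -> nat -> R) (c : I -> R) :
  (forall t, t \in r -> EZc (z t) = 0) -> EZc (fun x => k * \sum_(t <- r) c t * z t x) = 0.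
Proof.
elim: r => [|t r IH] z0.
  by rewrite (_ : (fun x => _) = fun=> 0) ?EZc0//; apply/funext => x; rewrite big_nil mulr0.
rewrite (_ : (fun x => _) = fun x => k * \sum_(s <- r) c s * z s x - (- (k * c t)) * z t x).
  rewrite EZc_sub IH ?z0 ?mem_head ?mulr0 ?subr0// => s sr.
  by rewrite z0// inE sr orbT.
by apply/funext => x; rewrite big_cons; ring.
Qed.

Definition ile (t x : nat) : R := (x <= t)%N%:R.

Lemma EZleE t : EZle P D Z t = EZc (ile t). Proof. by []. Qed.

Lemma EZleS t : EZle P D Z t.+1 = EZle P D Z t + EZeq P D Z t.+1.
Proof.
have e : EZeq P D Z t.+1 = EZc (fun x => (x == t.+1)%:R) by [].
have := EZc_sub (- 1) (ile t) (fun x => (x == t.+1)%:R).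
rewrite mulN1r opprK e !EZleE => <-; congr EZc; apply/funext => x; rewrite /ile leq_eqVlt ltnS mulN1r opprK addrC.
by case: eqP => [->|_] /=; rewrite ?ltnn ?addr0 ?add0r.
Qed.

Lemma EZle_gt0 t : (1 <= t <= T)%N -> 0 < EZle P D Z t.
Proof.
case: t => // t; elim: t => [|t IH] tT; rewrite EZleS.
  have -> : EZle P D Z 0 = 0.
    rewrite EZleE -[RHS]EZc0; apply: eq_Rintegral => w _.
    by rewrite /wt/ile leqNgt D1.
  by rewrite add0r Epos.
by apply: addr_gt0; [apply: IH; rewrite /= ltnW|exact: Epos].
Qed.

Lemma fdev_gt0 t : (1 <= t < T)%N -> 0 < fdev P D Z t.
Proof.
move=> /andP[t1 tT]; rewrite /fdev divr_gt0// EZle_gt0//; first by rewrite t1 ltnW.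
Qed.

(* [Z * zt t D] is the contribution of one claim to C_{i,t+1} - f_t C_{i,t}. *)
Definition zt t (x : nat) : R := ile t.+1 x - fdev P D Z t * ile t x.

Lemma EZc_zt t : (1 <= t < T)%N -> EZc (zt t) = 0.
Proof.
move=> /andP[t1 tT]; rewrite EZc_sub -!EZleE /fdev divfK ?subrr//.
by rewrite gt_eqF// EZle_gt0// t1 ltnW.
Qed.

Definition Lam t := \sum_(1 <= j < (T - t).+1) lam j.

Let index_range t i : (1 <= t)%N -> i \in index_iota 1 (T - t).+1 -> (1 <= i <= T)%N.
Proof.
move=> t1; rewrite mem_index_iota => /andP[-> /=]; rewrite ltnS => h.
exact: leq_trans h (leq_subr _ _).
Qed.

Lemma Lam_gt0 t : (1 <= t < T)%N -> 0 < Lam t.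
Proof.
move=> /andP[t1 tT].
have h i : i \in index_iota 1 (T - t).+1 -> 0 < lam i by move=> /(index_range t1) /Mlam[].
rewrite /Lam big_nat_recl; last by rewrite subn_gt0.
have T1 : (1 <= T)%N by exact: leq_trans t1 (ltnW tT).
have [l1 _] := @Mlam 1%N T1; rewrite ltr_wpDr// big_nat; apply: sumr_ge0 => i /andP[_ iT].
by apply/ltW/h; rewrite mem_index_iota/=.
Qed.

(** The factor 1 / (f_t b_t), where b_t is [Lam t * EZle P D Z t]. *)
Definition coef t := (fdev P D Z t * (Lam t * EZle P D Z t))^-1.

(* Weight of a claim of row [j + 1] in the linearised error: that row enters V_t if and only
   if [j + 1 <= T - t]. *)
Definition eta t0 j (x : nat) : R := (\prod_(t0 <= t < T) fdev P D Z t) *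
  \sum_(t0 <= t < T) ((t + j < T)%N%:R * coef t) * zt t x.

Lemma EZc_eta t0 j : (1 <= t0)%N -> EZc (eta t0 j) = 0.
Proof.
move=> t1; apply: EZc_sum0 => t; rewrite mem_index_iota => /andP[h1 h2].
by apply: EZc_zt; rewrite h2 (leq_trans t1).
Qed.

(** Exchange of the sums over t and over rows, which turns the dependent V_t into independent row
    sums. *)
Lemma dsum_eta t0 n w :
  \sum_(j < T) dsum j.+1 (eta t0 j) n w / Num.sqrt (a n) =
  (\prod_(t0 <= t < T) fdev P D Z t) *
    \sum_(t0 <= t < T) coef t * \sum_(1 <= i < (T - t).+1) dsum i (zt t) n w / Num.sqrt (a n).
Proof.
have E j : dsum j.+1 (eta t0 j) n w / Num.sqrt (a n) =
    (\prod_(t0 <= t < T) fdev P D Z t) * \sum_(t0 <= t < T)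
      ((t + j < T)%N%:R * coef t) * (dsum j.+1 (zt t) n w / Num.sqrt (a n)).
  under [X in _ = _ * X]eq_bigr do rewrite mulrA.
  rewrite -mulr_suml mulrA; congr (_ / _).
  under [X in _ = _ * X]eq_bigr do rewrite /dsum mulr_sumr.
  rewrite exchange_big/= mulr_sumr [LHS]/dsum; apply: eq_bigr => k _.
  rewrite /wt /eta mulrCA; congr (_ * _); rewrite mulr_sumr; apply: eq_bigr => t _.
  by rewrite mulrCA.
under [LHS]eq_bigr do rewrite E.
rewrite -mulr_sumr exchange_big/=; congr (_ * _); apply: eq_bigr => t _.
rewrite big_add1/= big_mkord (big_ord_widen T (fun i => dsum i.+1 (zt t) n w / Num.sqrt (a n)) (leq_subr t T)).
rewrite mulr_sumr [in RHS]big_mkcond/=; apply: eq_bigr => j _.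
by rewrite ltn_subRL; case: ifP => _; rewrite ?mul1r// !mul0r.
Qed.

(** Two errors add up: that of the delta method, and that of exchanging every random row length
    inside V_t for the deterministic one. *)
Lemma fhat_expansion t0 : (1 <= t0)%N ->
  op P (fun n w => Num.sqrt (a n) * (\prod_(t0 <= t < T) fhat M D Z T t (a n) w -
                                     \prod_(t0 <= t < T) fdev P D Z t) -
    \sum_(j < T) dsum j.+1 (eta t0 j) n w / Num.sqrt (a n)).
Proof.
move=> t01.
pose B0 t n w := \sum_(1 <= i < (T - t).+1) Cit M D Z i t (a n) w.
pose B1 t n w := \sum_(1 <= i < (T - t).+1) Cit M D Z i t.+1 (a n) w.
have tr t : t \in index_iota t0 T -> (1 <= t < T)%N.
  by rewrite mem_index_iota => /andP[h1 h2]; rewrite h2 (leq_trans t01).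
have VE t n w : (B1 t n w - fdev P D Z t * B0 t n w) / Num.sqrt (a n) =
    \sum_(1 <= i < (T - t).+1) csum i (zt t) n w / Num.sqrt (a n).
  rewrite -mulr_suml; congr (_ / _); rewrite /B1 /B0 mulr_sumr -sumrB; apply: eq_bigr => i _.
  rewrite !CitE /csum mulr_sumr -sumrB; apply: eq_bigr => k _.
  by rewrite /wt /zt /ile; ring.
have H : op P (fun n w => Num.sqrt (a n) *
    (\prod_(t0 <= t < T) (B1 t n w / B0 t n w) - \prod_(t0 <= t < T) fdev P D Z t) -
    (\prod_(t0 <= t < T) fdev P D Z t) * \sum_(t0 <= t < T) coef t *
       ((B1 t n w - fdev P D Z t * B0 t n w) / Num.sqrt (a n))).
  apply: (@prod_expansion _ _ _ P a a0 ay nat (index_iota t0 T) B0 B1 (fun t => fdev P D Z t)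
    (fun t => Lam t * EZle P D Z t)) => t /tr tT.
  - move=> n; apply: measurable_sum => i.
    have := measurable_csum i (fun x => (x <= t)%N%:R) n.
    by apply: eq_measurable_fun => w _; rewrite CitE.
  - by rewrite gt_eqF// mulr_gt0 ?Lam_gt0 ?EZle_gt0//; case/andP: tT => -> /ltnW.
  - by rewrite gt_eqF// fdev_gt0.
  - have := @cvgp_sum_in _ _ _ P _ (index_iota 1 (T - t).+1) (fun i n w => csum i (ile t) n w / a n)
      (fun i => lam i * EZc (ile t)) (fun i iT => csum_cvgp (ile t) (index_range (proj1 (andP tT)) iT)).
    rewrite -mulr_suml -EZleE; apply: eq_op => n w; congr (_ - _).
    by rewrite -mulr_suml; congr (_ / _); apply: eq_bigr => i _; rewrite CitE.
  - have := @Op_sum_in _ _ _ P _ (index_iota 1 (T - t).+1) (fun i n w => csum i (zt t) n w / Num.sqrt (a n)).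
    move=> /(_ _) h; apply: eq_Op (h _) => [n w|i iT]; first by rewrite VE.
    have iT' := index_range (proj1 (andP tT)) iT.
    have := Op_add (op_Op (csum_dsum iT' (EZc_zt tT))) (dsum_Op iT' (EZc_zt tT)).
    by apply: eq_Op => n w; rewrite -mulrDl subrK.
have H2 : op P (fun n w => (\prod_(t0 <= t < T) fdev P D Z t) * \sum_(t0 <= t < T) coef t *
   \sum_(1 <= i < (T - t).+1) (csum i (zt t) n w - dsum i (zt t) n w) / Num.sqrt (a n)).
  apply: op_cstM; apply: op_sum_in => t /tr tT; apply: op_cstM; apply: op_sum_in => i iT.
  exact: csum_dsum (index_range (proj1 (andP tT)) iT) (EZc_zt tT).
apply: eq_op (op_add H H2) => n w.
rewrite dsum_eta -addrA; congr (_ + _); rewrite -mulrN -mulrDr -mulrN; congr (_ * _).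
rewrite -!sumrN -big_split/=; apply: eq_bigr => t _.
rewrite VE -!mulrN -mulrDr; congr (_ * _); rewrite -!sumrN -big_split/=; apply: eq_bigr => i _.
by rewrite mulrBl; ring.
Qed.

(** Linear in g, so the variance of a combination of weights is obtained by expanding its square. *)
Definition EE2 (g : nat -> R) := \int[P]_w wt (fun w => Z 1 1 w ^+ 2) (D 1 1) g w.

Let iEE2 g : P.-integrable setT (EFin \o wt (fun w => Z 1 1 w ^+ 2) (D 1 1) g).
Proof.
exact: (@integrable_mark _ _ _ P T (D 1 1) (mD 1 1) (bD 1 1) _ g (measurable_funX _ (mZ 1 1)) iZ).
Qed.

Lemma EE2_add (k : R) (c1 c2 : nat -> R) :
  EE2 (fun x => c1 x + k * c2 x) = EE2 c1 + k * EE2 c2.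
Proof.
have eZ : \int[P]_w (k * wt (fun w => Z 1 1 w ^+ 2) (D 1 1) c2 w) = k * EE2 c2.
  by apply: RintegralZl => //; exact: iEE2.
have iK : P.-integrable setT (EFin \o (fun w => k * wt (fun w => Z 1 1 w ^+ 2) (D 1 1) c2 w)).
  have := integrableZl measurableT k (iEE2 c2); exact: eq_integrable.
rewrite -eZ /EE2 -RintegralD//.
by apply: eq_Rintegral => w _; rewrite /wt; ring.
Qed.

Lemma EE20 : EE2 (fun=> 0) = 0.
Proof. by rewrite /EE2; under eq_Rintegral do rewrite /wt mulr0; exact: Rint_cst. Qed.

Lemma EE2_sum (I : eqType) (r : seq I) (c : I -> R) (g : I -> nat -> R) :
  EE2 (fun x => \sum_(t <- r) c t * g t x) = \sum_(t <- r) c t * EE2 (g t).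
Proof.
elim: r => [|t r IH].
  by rewrite big_nil -[RHS]EE20; congr EE2; apply/funext => x; rewrite big_nil.
rewrite big_cons -IH addrC -EE2_add; congr EE2; apply/funext => x.
by rewrite big_cons addrC.
Qed.

Lemma EE2M (k : R) g : EE2 (fun x => k * g x) = k * EE2 g.
Proof.
have := EE2_add k (fun=> 0) g; rewrite EE20 add0r => <-.
by congr EE2; apply/funext => x; rewrite add0r.
Qed.

Lemma EZ2cE c : EZ2c c = EE2 (fun x => c x ^+ 2).
Proof. by apply: eq_Rintegral => w _; rewrite /wt exprMn. Qed.

(** The weight [zt t] is 1 at t + 1, 1 - f_t up to t, and 0 beyond. *)
Lemma EE2_zt t : EE2 (fun x => zt t x ^+ 2) =
  EZ2eq P D Z t.+1 + (fdev P D Z t - 1) ^+ 2 * EZ2le P D Z t.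
Proof.
have -> : EZ2eq P D Z t.+1 = EE2 (fun x => (x == t.+1)%:R) by [].
have -> : EZ2le P D Z t = EE2 (ile t) by [].
rewrite -EE2_add; congr EE2; apply/funext => x; rewrite /zt /ile leq_eqVlt ltnS.
case: eqP => [->|_] /=; first by rewrite ltnn /=; ring.
by case: (x <= t)%N; rewrite /=; ring.
Qed.

(** With k the mean of Z I{D = t}, integrating 2 k Z I{D = t} <= Z^2 I{D = t} + k^2 bounds the
    second moment below by k^2 > 0. *)
Lemma EZ2eq_gt0 t : (1 <= t <= T)%N -> 0 < EZ2eq P D Z t.
Proof.
move=> /Epos h.
have e1 : EZeq P D Z t = EZc (fun x => (x == t)%:R) by [].
have e2 : EZ2eq P D Z t = EE2 (fun x => (x == t)%:R) by [].
pose k := EZeq P D Z t; have k0 : 0 < k by [].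
have iK (c : R) : P.-integrable setT (EFin \o (fun w => c * wt (Z 1 1) (D 1 1) (fun x => (x == t)%:R) w)).
  have := integrableZl measurableT c (iwt (fun x => (x == t)%:R)); exact: eq_integrable.
have ik2 : P.-integrable setT (EFin \o (fun=> k ^+ 2)) by exact: finite_measure_integrable_cst.
have := @le_Rintegral _ _ _ P setT (fun w => 2 * k * wt (Z 1 1) (D 1 1) (fun x => (x == t)%:R) w)
   (fun w => wt (fun w => Z 1 1 w ^+ 2) (D 1 1) (fun x => (x == t)%:R) w + k ^+ 2).
have is2 : P.-integrable setT (EFin \o (fun w => wt (fun w => Z 1 1 w ^+ 2) (D 1 1) (fun x => (x == t)%:R) w + k ^+ 2)).
  by have := integrableD measurableT (iEE2 (fun x => (x == t)%:R)) ik2; exact: eq_integrable.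
move=> /(_ measurableT (iK _) is2).
rewrite RintegralD// RintegralZl//.
rewrite Rint_cst -/(EE2 _) -/(EZc _) -e1 -e2 -/k => H.
have : 2 * k * k <= EZ2eq P D Z t + k ^+ 2.
  apply: H => w _; rewrite /wt; case: (D 1 1 w == t); rewrite /= ?mulr1 ?mulr0 ?add0r ?sqr_ge0//.
  have := sqr_ge0 (Z 1 1 w - k); rewrite sqrrB mulr2n; lra.
have : 0 < k ^+ 2 by rewrite exprn_gt0.
rewrite expr2; lra.
Qed.

Lemma EZ2le_ge0 t : 0 <= EZ2le P D Z t.
Proof. by apply: Rintegral_ge0 => w _; rewrite mulr_ge0// sqr_ge0. Qed.

Lemma EE2_zt_gt0 t : (1 <= t < T)%N -> 0 < EE2 (fun x => zt t x ^+ 2).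
Proof.
move=> /andP[t1 tT]; rewrite EE2_zt ltr_wpDr ?EZ2eq_gt0//.
by rewrite mulr_ge0 ?sqr_ge0 ?EZ2le_ge0.
Qed.

Lemma EE2_zt_sigma t : (1 <= t < T)%N ->
  EE2 (fun x => zt t x ^+ 2) = sigma2 P D Z t * EZle P D Z t.
Proof.
move=> /andP[t1 tT]; rewrite EE2_zt /sigma2.
have e0 : EZle P D Z t != 0 by rewrite gt_eqF// EZle_gt0// t1 ltnW.
have q0 : EZeq P D Z t.+1 != 0 by rewrite gt_eqF// Epos.
have -> : fdev P D Z t - 1 = EZeq P D Z t.+1 / EZle P D Z t.
  by rewrite /fdev EZleS; field; rewrite e0.
by field; rewrite e0 q0.
Qed.

Lemma coef_gt0 t : (1 <= t < T)%N -> 0 < coef t.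
Proof.
move=> tT; have tT' : (1 <= t <= T)%N by case/andP: tT => -> /ltnW.
rewrite /coef invr_gt0; apply: mulr_gt0; first exact: fdev_gt0.
by apply: mulr_gt0; [exact: Lam_gt0|exact: EZle_gt0].
Qed.

Lemma prod_fdev_gt0 t0 : (1 <= t0)%N -> 0 < \prod_(t0 <= t < T) fdev P D Z t.
Proof.
move=> t01; rewrite big_nat; apply: prodr_gt0 => t /andP[h1 h2].
by rewrite fdev_gt0// h2 (leq_trans t01).
Qed.

Definition limvar t0 := \sum_(j < T) lam j.+1 * EZ2c (eta t0 j).

Lemma limvar_gt0 t0 : (1 <= t0 < T)%N -> 0 < limvar t0.
Proof.
move=> t0T; have /andP[t01 t0T'] := t0T.
have l0 (j : 'I_T) : 0 < lam j.+1 by have [] := @Mlam j.+1 (ltn_ord j).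
have jT : (T - t0.+1 < T)%N by rewrite ltn_subrL/= (leq_trans _ t0T').
(* Row [T - t0] contributes through [t = t0] alone, so its variance cannot vanish by
   cancellation. *)
rewrite /limvar (bigD1 (Ordinal jT))//= ltr_wpDr//.
  by apply: sumr_ge0 => j _; apply: mulr_ge0; [exact/ltW|apply: Rintegral_ge0 => w _; exact: sqr_ge0].
apply: mulr_gt0; first exact: (l0 (Ordinal jT)).
have -> : eta t0 (T - t0.+1) = (fun x => (\prod_(t0 <= t < T) fdev P D Z t) * coef t0 * zt t0 x).
  apply/funext => x; rewrite /eta -!mulrA; congr (_ * _); rewrite big_ltn//.
  have e : (t0 + (T - t0.+1)).+1 = T by rewrite -addSn subnKC.
  rewrite {1}e leqnn mul1r big_nat big1 ?addr0//.
  move=> t /andP[h1 h2]; rewrite (_ : (t + (T - t0.+1) < T)%N = false) ?mul0r//.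
  apply/negbTE; rewrite -leqNgt -{1}(subnKC t0T') leq_add2r//.
rewrite EZ2cE.
under [X in EE2 X]eq_fun do rewrite exprMn.
by rewrite EE2M mulr_gt0 ?EE2_zt_gt0// exprn_gt0// mulr_gt0 ?prod_fdev_gt0 ?coef_gt0.
Qed.

(** Write Q for sqrt (a n) times the error of the product, U for its linearisation and c for the
    limit of C / a n. The difference is (C / a n - c) Q^2 + c (Q - U) (Q + U), each term an o_P(1)
    times an O_P(1). *)
Lemma cohort_limit i : (2 <= i <= T)%N -> let t0 := (T - i + 1)%N in
  op P (fun n w => Cit M D Z i t0 (a n) w *
         (\prod_(t0 <= s < T) fdev P D Z s - \prod_(t0 <= s < T) fhat M D Z T s (a n) w) ^+ 2
     - lam i * EZle P D Z t0 * (\sum_(j < T) dsum j.+1 (eta t0 j) n w / Num.sqrt (a n)) ^+ 2).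
Proof.
move=> /andP[i2 iT] t0; have i1T : (1 <= i <= T)%N by rewrite iT (leq_trans _ i2).
have t01 : (1 <= t0)%N by rewrite /t0 addn1.
have hE := fhat_expansion t01.
have oU : Op P (fun n w => \sum_(j < T) dsum j.+1 (eta t0 j) n w / Num.sqrt (a n)).
  apply: Op_sum_in => j _; apply: dsum_Op; last exact: EZc_eta.
  by rewrite /= ltn_ord.
have oQ := Op_add (op_Op hE) oU.
have hC := csum_cvgp (ile t0) i1T.
have h1 := op_mulO hC (Op_mul oQ oQ).
have h2 := op_cstM (lam i * EZle P D Z t0) (op_mulO hE (Op_add oQ oU)).
apply: eq_op (op_add h1 h2) => n w; rewrite -EZleE CitE.
have e : (a n)^-1 = (Num.sqrt (a n))^-1 * (Num.sqrt (a n))^-1.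
  by rewrite -invfM -expr2 sqr_sqrtr// ltW.
have s0 : Num.sqrt (a n) != 0 by rewrite gt_eqF// sqrtr_gt0.
rewrite e subrK -/(ile t0); move: (Num.sqrt (a n)) s0 (\sum_(j < T) _) => s s0 S.
by field; rewrite s0.
Qed.

Lemma measurable_limit i t0 n :
  measurable_fun setT (fun w => Cit M D Z i t0 (a n) w *
         (\prod_(t0 <= s < T) fdev P D Z s - \prod_(t0 <= s < T) fhat M D Z T s (a n) w) ^+ 2).
Proof.
have mC j t : measurable_fun setT (Cit M D Z j t (a n)).
  have := measurable_csum j (ile t) n.
  by apply: eq_measurable_fun => w _; rewrite CitE.
apply: measurable_funM => //; apply: measurable_funX; apply: measurable_funB => //.
apply: measurable_prod => s _; apply: measurable_funM; first exact: measurable_sum.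
by apply: measurable_inv; exact: measurable_sum.
Qed.

Lemma measurable_dsums t0 n :
  measurable_fun setT (fun w => \sum_(j < T) dsum j.+1 (eta t0 j) n w / Num.sqrt (a n)).
Proof. by apply: measurable_sum => j; exact: measurable_dsum. Qed.

(** * Explicit variance when claim size and delay are independent *)

Section independent.
Hypothesis ZD : mutually_independent P
  (fun b : bool => if b then events_nat (D 1 1) else events_real (Z 1 1)).

Let ED (g : nat -> R) := \int[P]_w g (D 1 1 w).

Lemma factor_mark (f : R -> R) (g : nat -> R) : measurable_fun setT f ->
  P.-integrable setT (EFin \o (fun w => f (Z 1 1 w))) ->
  \int[P]_w (f (Z 1 1 w) * g (D 1 1 w)) = (\int[P]_w f (Z 1 1 w)) * ED g.
Proof.
move=> mf iF.
have mfZ : measurable_fun setT (fun w => f (Z 1 1 w)) by exact: measurableT_comp.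
have mg : measurable_fun setT (fun w => g (D 1 1 w)) by exact: measurable_nat_comp.
apply: (@indep2_RintM _ _ _ P (mfun_of mfZ) (mfun_of mg)) => //.
  move=> A B mA mB; have := ZD (J := [:: false; true])
    (A := fun b : bool => if b then (fun w => g (D 1 1 w)) @^-1` B else (fun w => f (Z 1 1 w)) @^-1` A).
  rewrite !big_cons big_nil mule1 => <-//.
    congr (P _); apply/seteqP; split=> [w [hb ha] [] //|w h].
    by split; [exact: (h false)|exact: (h true)].
  case=> _; apply: sub_sigma_algebra; first by exists (g @^-1` B).
  by exists (f @^-1` A) => //=; rewrite -[X in measurable X]setTI; exact: mf.
have := @integrable_mark _ _ _ P T (D 1 1) (mD 1 1) (bD 1 1) (fun=> 1) g (measurable_cst _)
  (finite_measure_integrable_cst _ _ measurableT).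
by apply: eq_integrable => // w _ /=; rewrite mul1r.
Qed.

(** Under independence E[Z] E[[zt s] (D)] = 0, and E[Z] cannot vanish because E[Z I{D <= s}] > 0. So
    [zt s] (D) itself is centred, and it remains so when paired with Z^2. *)
Lemma EE2_cross s t : (1 <= s)%N -> (s < t)%N -> (t < T)%N -> EE2 (fun x => zt t x * zt s x) = 0.
Proof.
move=> s1 st tT.
have sT : (1 <= s < T)%N by rewrite s1 (ltn_trans st).
have iZ1 : P.-integrable setT (EFin \o (fun w => id (Z 1 1 w))).
  by apply: integrable_sqr1 => //; exact: mZ.
have E0 : ED (zt s) = 0.
  have h1 := EZc_zt sT; rewrite /EZc (factor_mark (zt s) (@measurable_id _ _ setT) iZ1) in h1.
  have := @EZle_gt0 s; rewrite EZleE /EZc (factor_mark (ile s) (@measurable_id _ _ setT) iZ1).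
  rewrite s1 (ltnW (ltn_trans st tT)) => /(_ isT).
  move/eqP: h1; rewrite mulf_eq0 => /orP[/eqP ->|/eqP //]; by rewrite mul0r ltxx.
(* [zt s x] vanishes unless [x <= s.+1 <= t], where [zt t x = 1 - f_t]. *)
have -> : (fun x => zt t x * zt s x) = (fun x => (1 - fdev P D Z t) * zt s x).
  apply/funext => x; rewrite /zt /ile.
  have [h|h] := leqP x s.+1.
    by rewrite (leq_trans h (leqW st)) (leq_trans h st) /=; ring.
  by rewrite (leqNgt x s) (ltnW h)/=; ring.
rewrite EE2M /EE2 (@factor_mark (fun z => z ^+ 2) (zt s) (measurable_funX _ (@measurable_id _ _ setT)) iZ).
by rewrite E0 !mulr0.
Qed.

(** Orthogonality leaves the diagonal terms. Row indicators equal their squares, so summing over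
    rows gives one factor [Lam t], which cancels one of the two in [coef t ^+ 2]. *)
Lemma limvar_formula i : (2 <= i <= T)%N -> let t0 := (T - i + 1)%N in
  lam i * EZle P D Z t0 * limvar t0 =
  lam i * EZle P D Z t0 * \prod_(t0 <= s < T) fdev P D Z s ^+ 2 *
       \sum_(t0 <= t < T) ((sigma2 P D Z t / fdev P D Z t ^+ 2) /
           \sum_(1 <= j < (T - t).+1) lam j * EZle P D Z t).
Proof.
move=> iT t0; suff -> : limvar t0 = (\prod_(t0 <= s < T) fdev P D Z s) ^+ 2 *
    \sum_(t0 <= t < T) ((sigma2 P D Z t / fdev P D Z t ^+ 2) /
           \sum_(1 <= j < (T - t).+1) lam j * EZle P D Z t).
  by rewrite prodrXl !mulrA.
have t01 : (1 <= t0)%N by rewrite /t0 addn1.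
have tr t : t \in index_iota t0 T -> (1 <= t < T)%N.
  by rewrite mem_index_iota => /andP[h1 h2]; rewrite h2 (leq_trans t01).
have cross t s : t \in index_iota t0 T -> s \in index_iota t0 T -> s != t ->
    EE2 (fun x => zt t x * zt s x) = 0.
  move=> /tr/andP[h1 h2] /tr/andP[h3 h4]; rewrite neq_ltn => /orP[h|h]; first exact: EE2_cross.
  under [X in EE2 X]eq_fun do rewrite mulrC.
  exact: EE2_cross.
have V j : EZ2c (eta t0 j) = (\prod_(t0 <= t < T) fdev P D Z t) ^+ 2 *
    \sum_(t0 <= t < T) (t + j < T)%N%:R * coef t ^+ 2 * (sigma2 P D Z t * EZle P D Z t).
  rewrite EZ2cE; under [X in EE2 X]eq_fun do rewrite /eta exprMn.
  rewrite EE2M; congr (_ * _).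
  pose k t := (t + j < T)%N%:R * coef t.
  have -> : (fun x => (\sum_(t0 <= t < T) (t + j < T)%N%:R * coef t * zt t x) ^+ 2) =
      (fun x => \sum_(t0 <= t < T) k t * \sum_(t0 <= s < T) k s * (zt t x * zt s x)).
    apply/funext => x; rewrite expr2 mulr_suml; apply: eq_bigr => t _.
    rewrite -mulrA; congr (_ * _); rewrite mulr_sumr; apply: eq_bigr => s _.
    by rewrite mulrCA.
  rewrite EE2_sum; apply: eq_big_seq => t tin; rewrite EE2_sum.
  rewrite (bigD1_seq t) ?iota_uniq//= big_seq_cond big1 ?addr0.
    under [X in EE2 X]eq_fun do rewrite -expr2.
    rewrite (EE2_zt_sigma (tr _ tin)) /k; case: (t + j < T)%N; rewrite /= ?mul0r//; ring.
  by move=> s /andP[sin st]; rewrite (cross t s)// mulr0.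
rewrite /limvar; under [LHS]eq_bigr do rewrite V mulrCA mulr_sumr.
rewrite -mulr_sumr; congr (_ * _); rewrite exchange_big/=; apply: eq_big_seq => t tin.
have tT := tr _ tin; have /andP[t1 t2] := tT.
have f0 : fdev P D Z t != 0 by rewrite gt_eqF// fdev_gt0.
have e0 : EZle P D Z t != 0 by rewrite gt_eqF// EZle_gt0// t1 ltnW.
have L0 : Lam t != 0 by rewrite gt_eqF// Lam_gt0.
rewrite -mulr_suml -/(Lam t).
have -> : \sum_(j < T) lam j.+1 * ((t + j < T)%N%:R * coef t ^+ 2 * (sigma2 P D Z t * EZle P D Z t)) =
    Lam t * (coef t ^+ 2 * (sigma2 P D Z t * EZle P D Z t)).
  rewrite /Lam mulr_suml big_add1/= big_mkord.
  rewrite (big_ord_widen T (fun j => lam j.+1 * (coef t ^+ 2 * (sigma2 P D Z t * EZle P D Z t))) (leq_subr t T)).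
  rewrite [in RHS]big_mkcond/=; apply: eq_bigr => j _.
  by rewrite ltn_subRL; case: ifP => _; rewrite ?mul1r// !mul0r mulr0.
by rewrite /coef; field; rewrite f0 L0 e0.
Qed.

End independent.

End cohorts.

(** * Passing to the chi-squared limit *)

Section chi2.
Context (R : realType) d (Om : measurableType d) (P : probability Om R).

Lemma sqr_le_norm (c x y : R) : 0 < c -> 0 <= y ->
  (c * x ^+ 2 <= y) = (`|x| <= Num.sqrt (y / c)).
Proof.
move=> c0 y0; have yc : 0 <= y / c by rewrite divr_ge0// ltW.
by rewrite mulrC -ler_pdivlMr// -sqrtr_sqr ler_sqrt.
Qed.

(** The level y corresponds to the ball of radius sqrt (y / c), and dl is half the gap between the
    two radii. For y1 < 0 both events at level y1 are empty. *)
Lemma chi2_sandwich (U : nat -> Om -> R) (s c y1 y2 e : R) :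
  (forall n, measurable_fun setT (U n)) -> gaussian_limit P U s ->
  0 < s -> 0 < c -> y1 < y2 -> 0 < e -> \forall n \near \oo,
  fine (P [set w | c * U n w ^+ 2 <= y1]) <= scaled_chi2_1_cdf (c * s) y2 + e /\
  scaled_chi2_1_cdf (c * s) y1 <= fine (P [set w | c * U n w ^+ 2 <= y2]) + e.
Proof.
move=> mU gU s0 c0 y12 e0.
have [y10|y10] := ltP y1 0.
  apply: nearW => n; rewrite /scaled_chi2_1_cdf.
  have -> : [set w | c * U n w ^+ 2 <= y1] = set0.
    by apply/seteqP; split => // w /=; rewrite leNgt (lt_le_trans y10)// mulr_ge0 ?sqr_ge0// ltW.
  have -> : [set u : R | c * s * u ^+ 2 <= y1] = set0.
    by apply/seteqP; split => // w /=; rewrite leNgt (lt_le_trans y10)// mulr_ge0 ?sqr_ge0// mulr_ge0// ltW.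
  by rewrite !measure0/= !addr_ge0 ?fine_ge0// ltW.
have y20 : 0 <= y2 by rewrite (le_trans y10)// ltW.
pose r := Num.sqrt (y1 / c); pose dl := (Num.sqrt (y2 / c) - r) / 2.
have r2 : r + 2 * dl = Num.sqrt (y2 / c).
  by rewrite /dl mulrC divfK ?pnatr_eq0// addrC subrK.
have d0 : 0 < dl.
  rewrite divr_gt0// subr_gt0 /r ltr_sqrt ?ltr_pM2r ?invr_gt0//.
  by rewrite divr_gt0// (le_lt_trans y10).
have Us n y : 0 <= y -> [set w | c * U n w ^+ 2 <= y] = [set w | `|U n w| <= Num.sqrt (y / c)].
  by move=> h; apply/seteqP; split => w /=; rewrite sqr_le_norm.
have Ns y : 0 <= y -> [set u : R | c * s * u ^+ 2 <= y] = [set u : R | `|Num.sqrt s * u| <= Num.sqrt (y / c)].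
  move=> h; have E u : c * s * u ^+ 2 = c * (Num.sqrt s * u) ^+ 2.
    by rewrite exprMn sqr_sqrtr ?mulrA//; exact: ltW.
  by apply/seteqP; split => w /=; rewrite E sqr_le_norm.
have := gaussian_limit_ball mU gU (sqrtr_ge0 (y1 / c)) d0 e0.
by apply: filterS => n; rewrite -/r r2 /scaled_chi2_1_cdf !Us// !Ns.
Qed.

(** Y is compared with c U^2 at levels shifted by h, at the cost of an o_P event, and c U^2 with the
    limit at levels shifted by another h. Continuity at x pays for the total shift; each of these
    three costs e / 3. *)
Lemma chi2_limit (U Y : nat -> Om -> R) (s c x : R) :
  (forall n, measurable_fun setT (U n)) -> (forall n, measurable_fun setT (Y n)) ->
  gaussian_limit P U s -> 0 < s -> 0 < c ->
  op P (fun n w => Y n w - c * U n w ^+ 2) ->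
  {for x, continuous (scaled_chi2_1_cdf (c * s))} ->
  fine (P [set w | Y n w <= x]) @[n --> \oo] --> scaled_chi2_1_cdf (c * s) x.
Proof.
move=> mU mY gU s0 c0 oY cF; set F := scaled_chi2_1_cdf (c * s).
have mle (f : Om -> R) y : measurable_fun setT f -> measurable [set w | f w <= y].
  by move=> mf; rewrite -[X in measurable X]setTI; exact: measurable_fun_le.
have mU2 n : measurable_fun setT (fun w => c * U n w ^+ 2).
  by apply: measurable_funM => //; exact: measurable_funX.
apply/cvgrPdist_le => e e0.
have e3 : 0 < e / 3 by rewrite divr_gt0.
have [dl d0 hF] : exists2 dl, 0 < dl & forall y, `|x - y| < dl -> `|F x - F y| <= e / 3.
  by have := cF; move/cvgrPdist_le => /(_ _ e3); rewrite near_nbhs => /nbhs_ballP[dl d0 h]; exists dl.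
(* This keeps x + 2 h and x - 2 h strictly inside the window of continuity. *)
pose h := dl / 3; have h0 : 0 < h by rewrite divr_gt0.
have F1 : `|F x - F (x + 2 * h)| <= e / 3.
  by apply: hF; rewrite opprD addNKr normrN gtr0_norm ?mulr_gt0// /h; lra.
have F2 : `|F x - F (x - 2 * h)| <= e / 3.
  by apply: hF; rewrite opprB addrC subrK gtr0_norm ?mulr_gt0// /h; lra.
have l1 : x + h < x + 2 * h by lra.
have l2 : x - 2 * h < x - h by lra.
have A1 := chi2_sandwich mU gU s0 c0 l1 e3.
have A2 := chi2_sandwich mU gU s0 c0 l2 e3.
have A3 := oY.2 _ h0 _ e3.
apply: filterS3 A1 A2 A3 => n [B1 _] [_ B2] B3.
have mb : measurable (big_event (fun n w => Y n w - c * U n w ^+ 2) h n).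
  by apply: measurable_big => k; exact: oY.1.
have C1 : fine (P [set w | Y n w <= x]) <= fine (P [set w | c * U n w ^+ 2 <= x + h]) +
    fine (P (big_event (fun n w => Y n w - c * U n w ^+ 2) h n)).
  apply: fineP_leU => //; [exact: mle|exact: mle|].
  move=> w /= yx; have [|g] := ltP h `|Y n w - c * U n w ^+ 2|; [by right|left].
  by move: g; rewrite ler_norml => /andP[g1 g2]; lra.
have C2 : fine (P [set w | c * U n w ^+ 2 <= x - h]) <= fine (P [set w | Y n w <= x]) +
    fine (P (big_event (fun n w => Y n w - c * U n w ^+ 2) h n)).
  apply: fineP_leU => //; [exact: mle|exact: mle|].
  move=> w /= yx; have [|g] := ltP h `|Y n w - c * U n w ^+ 2|; [by right|left].
  by move: g; rewrite ler_norml => /andP[g1 g2]; lra.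
move: F1 F2; rewrite !ler_norml => /andP[F1 F1'] /andP[F2 F2'].
rewrite -/F in B1 B2.
move: B1 B2 B3 C1 C2 F1 F1' F2 F2'; clear hF.
move: (fine (P (big_event _ h n))) (fine (P [set w | Y n w <= x])) (fine (P [set w | c * U n w ^+ 2 <= x + h]))
  (fine (P [set w | c * U n w ^+ 2 <= x - h])) (F x) (F (x + 2 * h)) (F (x - 2 * h)) => p1 p2 p3 p4 f1 f2 f3.
by move=> *; apply/andP; split; lra.
Qed.

Lemma cvg_in_distribution_seq (Y : R -> Om -> R) (F : R -> R) :
  (forall b, 0 < b -> measurable_fun setT (Y b)) ->
  (forall (a : nat -> R) x, (forall n, 0 < a n) -> a n @[n --> \oo] --> +oo ->
     {for x, continuous F} -> fine (P [set w | Y (a n) w <= x]) @[n --> \oo] --> F x) ->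
  cvg_in_distribution P Y F.
Proof.
move=> mY H x cx; apply/fine_cvgP; split.
  near=> b; apply: fin_num_measure.
  have b0 : 0 < b by near: b; exact: nbhs_pinfty_gt.
  by rewrite -[X in measurable X]setTI; apply: measurable_fun_le => //; exact: mY.
apply/cvg_pinftyP => u uy.
(* A sequence tending to infinity may start with nonpositive terms; the maximum makes it positive
   and changes it at finitely many indices only. *)
pose v n := Num.max (u n) 1.
have v0 n : 0 < v n by rewrite lt_max ltr01 orbT.
have vy : v n @[n --> \oo] --> +oo.
  apply/cvgryPge => A; move/cvgryPge : uy => /(_ A); apply: filterS => n h.
  by rewrite le_max h.
have uv : \forall n \near \oo, v n = u n.
  by move/cvgryPge : uy => /(_ 1); apply: filterS => n h; rewrite /v max_l.
apply: cvg_trans (H v x v0 vy cx); apply: near_eq_cvg.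
by apply: filterS uv => n ->.
Unshelve. all: by end_near. Qed.

End chi2.

Theorem theorem2 (R : realType) (d : measure_display) (Omega : measurableType d)
  (P : probability Omega R) (T : nat)
  (M : nat -> R -> Omega -> nat) (D : nat -> nat -> Omega -> nat)
  (Z : nat -> nat -> Omega -> R) (lam : nat -> R) :
  (2 <= T)%N ->
  (* measurability of the random variables *)
  (forall i a (A : set nat), 0 <= a -> measurable (M i a @^-1` A)) ->
  (forall i k (A : set nat), measurable (D i k @^-1` A)) ->
  (forall i k, measurable_fun setT (Z i k)) ->
  (* D_{i,k} takes values in {1,...,T} *)
  (forall i k w, (1 <= D i k w <= T)%N) ->
  (* (GM1) common distribution of all pairs (D_{i,k}, Z_{i,k}), i in T, k >= 1 *)
  (forall i k (A : set nat) (B : set R), (1 <= i <= T)%N -> (1 <= k)%N ->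
     measurable B ->
     P ([set w | A (D i k w)] `&` [set w | B (Z i k w)]) =
     P ([set w | A (D 1 1 w)] `&` [set w | B (Z 1 1 w)])) ->
  (* (GM1) independence of (D_{i,k}, Z_{i,k})_{k >= 1} for each i *)
  (forall i, (1 <= i <= T)%N ->
     mutually_independent P
       (fun k : nat => events_nat (D i k.+1) `|` events_real (Z i k.+1))) ->
  (* (GM1) moment conditions *)
  (P.-integrable setT (fun w => (Z 1 1 w ^+ 2)%:E)) ->
  (forall t, (1 <= t <= T)%N -> 0 < EZeq P D Z t) ->
  (* (GM2) (D_{i,k}, Z_{i,k})_k independent of (M^alpha_i)_alpha *)
  (forall i, (1 <= i <= T)%N ->
     mutually_independent P
       (fun b : bool => if b then
          \bigcup_(k in [set k : nat | (1 <= k)%N])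
             (events_nat (D i k) `|` events_real (Z i k))
        else \bigcup_(a in [set a : R | 0 <= a]) events_nat (M i a))) ->
  (* (GM3) independence across i of the families *)
  mutually_independent P
    (fun j : 'I_T => let i := j.+1 in
       \bigcup_(a in [set a : R | 0 <= a]) events_nat (M i a) `|`
       \bigcup_(k in [set k : nat | (1 <= k)%N])
             (events_nat (D i k) `|` events_real (Z i k))) ->
  (* (GM4) M^alpha_i / alpha -> lambda_i a.s. *)
  (forall i, (1 <= i <= T)%N -> 0 < lam i /\
     {ae P, forall w, (M i a w)%:R / a @[a --> +oo] --> lam i}) ->
  forall i, (2 <= i <= T)%N ->
  exists gam : R, 0 < gam /\
    cvg_in_distribution P
      (fun a w => Cit M D Z i (T - i + 1) a w *
         (\prod_(T - i + 1 <= s < T) fdev P D Z s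
          - \prod_(T - i + 1 <= s < T) fhat M D Z T s a w) ^+ 2)
      (scaled_chi2_1_cdf (gam ^+ 2)) /\
    (mutually_independent P
       (fun b : bool => if b then events_nat (D 1 1) else events_real (Z 1 1)) ->
     gam ^+ 2 =
       lam i * EZle P D Z (T - i + 1) *
       \prod_(T - i + 1 <= s < T) fdev P D Z s ^+ 2 *
       \sum_(T - i + 1 <= t < T)
          ((sigma2 P D Z t / fdev P D Z t ^+ 2) /
           \sum_(1 <= j < (T - t).+1) lam j * EZle P D Z t)).

Proof.
move=> T2 mM mD mZ bD law ind1 iZ Epos ind2 ind3 Mlam i iT.
have D1 j k w : (1 <= D j k w)%N by case/andP: (bD j k w).
have DT j k w : (D j k w <= T)%N by case/andP: (bD j k w).
have /andP[i2 i_leT] := iT.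
pose t0 := (T - i + 1)%N.
(* As i >= 2, the range of development years is not empty, so the limit does not degenerate. *)
have t0T : (1 <= t0 < T)%N.
  rewrite /t0 addn1/=; apply: (@leq_trans (T - 2).+2); first by rewrite !ltnS leq_sub2l.
  by rewrite -addn2 subnK.
have i1T : (1 <= i <= T)%N by rewrite i_leT andbT ltnW.
have t0T' : (1 <= t0 <= T)%N by case/andP: t0T => -> /ltnW.
pose c := lam i * EZle P D Z t0; pose s := limvar P T D Z lam t0.
have c0 : 0 < c.
  by apply: mulr_gt0; [case: (Mlam i i1T)|exact: (EZle_gt0 mD mZ D1 Epos DT iZ t0T')].
have s0 : 0 < s by exact: (limvar_gt0 mD mZ D1 Epos DT iZ Mlam t0T).
have cs0 : 0 < c * s by exact: mulr_gt0.
(* c is the limit of the normalised C_{i,t0} and s the variance of the linearised error. *)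
exists (Num.sqrt (c * s)); rewrite sqrtr_gt0 sqr_sqrtr ?(ltW cs0)//.
split=> //; split; last first.
  by move=> ZD; exact: (limvar_formula mD mZ D1 Epos DT iZ Mlam ZD iT).
apply: cvg_in_distribution_seq.
  (* Measurability at a fixed parameter b is the sequential statement along the constant sequence
     b. *)
  by move=> b b0; exact: (measurable_limit P T mM mD mZ (fun _ : nat => b0) i t0 0%N).
move=> a x a0 ay.
apply: (chi2_limit (measurable_dsums P T lam a mD mZ t0)) => //.
- by move=> n; exact: (measurable_limit P T mM mD mZ a0 i t0 n).
- apply: (dsum_clt mM mD mZ DT law ind1 iZ ind3 Mlam a0 ay) => j.
  by apply: (EZc_eta lam mD mZ D1 Epos DT iZ); case/andP: t0T.
- exact: (cohort_limit mM mD mZ D1 Epos DT law ind1 iZ ind2 Mlam a0 ay iT).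
Qed.
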